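(* Assume (SH), and suppose $H\in C^{2,1}_{loc}(\mathbb{R}^n\times(\mathbb{R}^n\setminus\{0\}))$ and $\phi:\mathbb{R}^n\to\mathbb{R}$ is locally Lipschitz. Let $\overline{x}$ be an optimal solution for $\mathcal{P}(t_0,x_0)$ and suppose that there exists a nonvanishing dual arc $\overline{p}$ associated with $\overline{x}$ such that, for some $R_0\in S(n)$, $$(-\overline{p}(t_0),-R_0)\in J_x^{2,-}V(t_0,x_0).$$ Let the solution $R$ of the Riccati equation $$\dot R(t)+H_{px}[t]R(t)+R(t)H_{xp}[t]+R(t)H_{pp}[t]R(t)+H_{xx}[t]=0,\qquad R(t_0)=R_0,$$ be defined on $[t_0,a]$ for some $a\in(t_0,T]$. Then $$(-\overline{p}(t),-R(t))\in J_x^{2,-}V(t,\overline{x}(t))\quad\text{for all }t\in[t_0,a].$$ Moreover, if $\phi$ is locally semiconcave, then $a$ may be taken equal to $T$ (that is, $R$ is defined on all of $[t_0,T]$ and the inclusion holds for all $t\in[t_0,T]$).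
   Context: Fix $T\in\mathbb{R}$, a multifunction $F:\mathbb{R}^n\rightrightarrows\mathbb{R}^n$ and $\phi:\mathbb{R}^n\to\mathbb{R}$. An arc is an absolutely continuous function on a compact interval. For $(t_0,x_0)\in(-\infty,T]\times\mathbb{R}^n$, the Mayer problem $\mathcal{P}(t_0,x_0)$ is to minimize $\phi(x(T))$ over all arcs $x:[t_0,T]\to\mathbb{R}^n$ with $\dot x(s)\in F(x(s))$ for a.e. $s\in[t_0,T]$ and $x(t_0)=x_0$; a minimizer is called an optimal solution for $\mathcal{P}(t_0,x_0)$. The value function $V:(-\infty,T]\times\mathbb{R}^n\to\mathbb{R}$ is the infimum $V(t_0,x_0)$ of this problem. The Hamiltonian is $H(x,p)=\sup_{v\in F(x)}\langle v,p\rangle$, $x,p\in\mathbb{R}^n$. (SH): (i) $F(x)$ is nonempty, convex, compact for each $x$; (ii) $F$ is locally Lipschitz, i.e. each $x$ has a neighborhood $K$ and a constant $c>0$ with $F(z)\subset F(y)+c|z-y|B(0,1)$ for all $z,y\in K$; (iii) there is $\gamma>0$ with $\max\{|v|:v\in F(x)\}\le\gamma(1+|x|)$ for all $x$. $B(x,\epsilon)$ is the closed ball. A dual arc associated with an optimal $\overline{x}$ is an arc $\overline{p}:[t_0,T]\to\mathbb{R}^n$ with $\dot{\overline{x}}(s)\in\partial_p^-H(\overline{x}(s),\overline{p}(s))$, $-\dot{\overline{p}}(s)\in\partial_x^-H(\overline{x}(s),\overline{p}(s))$ for a.e. $s\in[t_0,T]$ and $-\overline{p}(T)\in\partial\phi(\overline{x}(T))$,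 where $\partial_x^-H,\partial_p^-H$ are the Fréchet subdifferentials of $H(\cdot,p)$, $H(x,\cdot)$ and $\partial\phi$ is the Clarke generalized gradient. The Fréchet subdifferential is $\partial^-f(x)=\{p:\liminf_{y\to x}\frac{f(y)-f(x)-\langle p,y-x\rangle}{|y-x|}\ge0\}$. $H_{px}[t]=\nabla^2_{px}H(\overline{x}(t),\overline{p}(t))$ and similarly for $H_{xp}[t],H_{pp}[t],H_{xx}[t]$; here $H_{xp}$ is the Jacobian in $x$ of $\nabla_pH$ and $H_{px}=H_{xp}^*$ is the Jacobian in $p$ of $\nabla_xH$. $C^{2,1}_{loc}$ means $C^2$ with locally Lipschitz second derivatives. A function $f$ is semiconcave on $\Omega$ if it is continuous and for some $c$, $f(x+h)+f(x-h)-2f(x)\le c|h|^2$ whenever $[x-h,x+h]\subset\Omega$; it is locally semiconcave if it is semiconcave on a neighborhood of each point. For $S(n)$ the real symmetric $n\times n$ matrices, the set of subjets $J^{2,-}f(x)$ is the set of $(q,Q)\in\mathbb{R}^n\times S(n)$ such that for some $\delta>0$ and all $y\in B(x,\delta)$, $f(y)\ge f(x)+\langle q,y-x\rangle+\frac12\langle Q(y-x),y-x\rangle+o(|y-x|^2)$; $J_x^{2,-}V(t,x)$ denotes the set of subjets of $V(t,\cdot)$ at $x$. *)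

(* Defs.v *)
From HB Require Import structures.
From mathcomp Require Export all_boot all_order all_algebra.
From mathcomp Require Export all_classical all_reals all_analysis.
Export Order.TTheory GRing.Theory Num.Theory.
Export numFieldNormedType.Exports.

Set Implicit Arguments.
Unset Strict Implicit.
Unset Printing Implicit Defensive.

Local Open Scope classical_set_scope.
Local Open Scope ring_scope.

(* Points of R^n are row vectors.  The library norm on ['rV[R]_n] is the sup
   norm; the Euclidean one is [enorm].  The two induce the same topology, so
   [nbhs], [compact], [continuous], derivatives and local Lipschitz continuity
   are taken from the library. *)

Section Euclidean.
Context {R : realType} {n : nat}.
Implicit Types (x y u v : 'rV[R]_n) (e : R).

Definition dotp u v : R := \sum_(i < n) u 0 i * v 0 i.

Definition enorm u : R := Num.sqrt (dotp u u).

Definition eball x e : set 'rV[R]_n := [set y | enorm (y - x) <= e].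

End Euclidean.

Section Regularity.
Context {R : realType}.

Definition locally_lipschitz_on (U : normedModType R) (A : set U)
    (f : U -> R) : Prop :=
  forall x, A x ->
    exists2 K, nbhs x K & [lipschitz f y | y in K `&` A].

(* For U finite-dimensional and A open, C^k regularity on A expressed through
   directional derivatives. *)
Definition C1_on (U : normedModType R) (A : set U) (f : U -> R) : Prop :=
  forall x, A x ->
    differentiable f x /\ forall v, {for x, continuous (fun y => 'D_v f y)}.

Definition C2_on (U : normedModType R) (A : set U) (f : U -> R) : Prop :=
  C1_on A f /\ forall v, C1_on A (fun y => 'D_v f y).

Definition C21loc_on (U : normedModType R) (A : set U) (f : U -> R) : Prop :=
  C2_on A f /\
  forall v w, locally_lipschitz_on A (fun y => 'D_w (fun z => 'D_v f z) y).

Definition grad {n : nat} (f : 'rV[R]_n -> R) (x : 'rV[R]_n) : 'rV[R]_n :=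
  \row_(i < n) 'D_(delta_mx 0 i) f x.

(* The library's ['J g x] acts on row vectors from the right, so that its
   (i, j) entry is d g_j / d x_i; the usual Jacobian matrix is its transpose. *)
Definition jac {m n : nat} (g : 'rV[R]_m -> 'rV[R]_n) (x : 'rV[R]_m) :
  'M[R]_(n, m) := ('J g x)^T.

Definition frechet_subdiff {n : nat} (f : 'rV[R]_n -> R) (x : 'rV[R]_n) :
    set 'rV[R]_n :=
  [set p | (0%:E <= limf_einf
     (fun y => ((f y - f x - dotp p (y - x)) / enorm (y - x))%:E) x^')%E].

(* limsup as y -> x and t -> 0+ of (f (y + t v) - f y) / t *)
Definition clarke_dderiv {n : nat} (f : 'rV[R]_n -> R) (x v : 'rV[R]_n) :
    \bar R :=
  limf_esup (fun z : 'rV[R]_n * R => ((f (z.1 + z.2 *: v) - f z.1) / z.2)%:E)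
    (filter_prod (nbhs x) (0 : R)^'+).

Definition clarke_grad {n : nat} (f : 'rV[R]_n -> R) (x : 'rV[R]_n) :
    set 'rV[R]_n :=
  [set p | forall v, ((dotp p v)%:E <= clarke_dderiv f x v)%E].

Definition segment {n : nat} (x h : 'rV[R]_n) : set 'rV[R]_n :=
  [set x + l *: h | l in `[-1, 1]%classic].

Definition semiconcave_on {n : nat} (A : set 'rV[R]_n) (f : 'rV[R]_n -> R) :
    Prop :=
  {within A, continuous f} /\
  exists c : R, forall x h, segment x h `<=` A ->
    f (x + h) + f (x - h) - 2 * f x <= c * enorm h ^+ 2.

Definition locally_semiconcave {n : nat} (f : 'rV[R]_n -> R) : Prop :=
  forall x : 'rV[R]_n, exists2 K, nbhs x K & semiconcave_on K f.

Definition subjet {n : nat} (f : 'rV[R]_n -> R) (x : 'rV[R]_n) :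
    set ('rV[R]_n * 'M[R]_n) :=
  [set qQ | qQ.2^T = qQ.2 /\
    exists2 delta : R, 0 < delta &
    exists2 r : 'rV[R]_n -> R,
      r =o_x (fun y => enorm (y - x) ^+ 2) &
      forall y, eball x delta y ->
        f x + dotp qQ.1 (y - x) + 2^-1 * dotp ((y - x) *m qQ.2^T) (y - x) + r y
          <= f y].

End Regularity.

Section Mayer.
Context {R : realType} {n : nat}.
Implicit Types (T a b : R) (F : 'rV[R]_n -> set 'rV[R]_n)
  (phi : 'rV[R]_n -> R) (x p : R -> 'rV[R]_n).

Definition abs_continuous a b x : Prop :=
  forall e : R, 0 < e -> exists2 d : R, 0 < d &
    forall (m : nat) (u v : 'I_m -> R),
      (forall i, a <= u i /\ u i <= v i /\ v i <= b) ->
      trivIset setT (fun i => `]u i, v i[%classic) ->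
      \sum_(i < m) (v i - u i) < d ->
      \sum_(i < m) enorm (x (v i) - x (u i)) < e.

(* An arc on [a, b] is a total function of which only the values on [a, b]
   matter; two-sided derivatives lose nothing since {a, b} is negligible. *)
Definition trajectory F a b x : Prop :=
  abs_continuous a b x /\
  {ae (@lebesgue_measure R), forall s, a <= s <= b ->
    derivable x s 1 /\ F (x s) (derive1 x s)}.

Definition admissible T F (t0 : R) (x0 : 'rV[R]_n) : set (R -> 'rV[R]_n) :=
  [set x | trajectory F t0 T x /\ x t0 = x0].

Definition optimal T F phi (t0 : R) (x0 : 'rV[R]_n) x : Prop :=
  admissible T F t0 x0 x /\
  forall y, admissible T F t0 x0 y -> phi (x T) <= phi (y T).

(* [inf] and [sup] below are the real-valued ones, with a default value on sets
   that are empty or unbounded; under [SH] and for phi locally Lipschitz both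
   sets are nonempty and bounded. *)
Definition value T F phi (t0 : R) (x0 : 'rV[R]_n) : R :=
  inf [set phi (x T) | x in admissible T F t0 x0].

Definition hamiltonian F (y q : 'rV[R]_n) : R := sup [set dotp v q | v in F y].

Definition SH F : Prop :=
  [/\ forall x : 'rV[R]_n,
        [/\ F x !=set0,
            convex_set (F x : set (convex_lmodType 'rV[R]_n))
          & compact (F x)],
      forall x : 'rV[R]_n, exists2 K, nbhs x K & exists2 c : R, 0 < c &
        forall z y, K z -> K y ->
          F z `<=` [set w + (c * enorm (z - y)) *: b | w in F y & b in eball 0 1]
    & exists2 gamma : R, 0 < gamma &
        forall x v : 'rV[R]_n, F x v -> enorm v <= gamma * (1 + enorm x)].

Definition dual_arc T F phi (t0 : R) x p : Prop :=
  [/\ abs_continuous t0 T p,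
      {ae (@lebesgue_measure R), forall s, t0 <= s <= T ->
        [/\ derivable x s 1, derivable p s 1,
            frechet_subdiff (fun q => hamiltonian F (x s) q) (p s) (derive1 x s)
          & frechet_subdiff (fun y => hamiltonian F y (p s)) (x s)
              (- derive1 p s)]}
    & clarke_grad phi (x T) (- p T)].

Section Hessians.
Variables (F : 'rV[R]_n -> set 'rV[R]_n) (x p : 'rV[R]_n).
Let H := hamiltonian F.

Definition Hxx : 'M[R]_n := jac (fun y => grad (fun y' => H y' p) y) x.
Definition Hxp : 'M[R]_n := jac (fun y => grad (fun q => H y q) p) x.
Definition Hpx : 'M[R]_n := jac (fun q => grad (fun y => H y q) x) p.
Definition Hpp : 'M[R]_n := jac (fun q => grad (fun q' => H x q') q) p.

End Hessians.

(* The derivative at t is relative to [a, b], i.e. one-sided at the endpoints. *)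
Definition riccati_solution F (x p : R -> 'rV[R]_n) a b (R0 : 'M[R]_n)
    (Q : R -> 'M[R]_n) : Prop :=
  Q a = R0 /\
  forall t, a <= t <= b ->
    (fun s => (s - t)^-1 *: (Q s - Q t))
      @ within `[a, b]%classic t^' -->
    - (Hpx F (x t) (p t) *m Q t + Q t *m Hxp F (x t) (p t)
       + Q t *m Hpp F (x t) (p t) *m Q t + Hxx F (x t) (p t)).

End Mayer.

(* Main.v *)
Require Import Defs.
From mathcomp Require Import ring lra measurable_realfun.

Set Implicit Arguments.
Unset Strict Implicit.
Unset Printing Implicit Defensive.

Local Open Scope classical_set_scope.
Local Open Scope ring_scope.

(** The value function satisfies a dynamic programming principle: along any
   trajectory [y] of [F] on [[t0, t]] one has [V t0 (y t0) <= V t (y t)], with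
   equality along the optimal arc [xbar].  A lower quadratic bound for
   [V t0] at [xbar t0] is therefore carried forward to [V t] at [xbar t], provided
   that every point [xbar t + h] near [xbar t] is the end of a trajectory along
   which the quadratic model
     [W s = - <pbar s, d s> - 1/2 <d s * Q s, d s>],   [d = y - xbar],
   changes by at most [o(|h|^2)].

   The right trajectory is found by feedback.  Where [p <> 0] the gradient of the
   Hamiltonian in [p] is the velocity of [F x] maximizing [<., p>]
   ([ham_gradient_argmax]), so any solution of
   [y' = H_p(y, pbar + (y - xbar) Q)] is a trajectory.  It is
   obtained near [xbar] by a Picard iteration ([ode_exists],
   [ode_exists_backward]) applied to the equation for [d], truncated so as to be
   globally Lipschitz, and Gronwall's inequality gives [|d s| <= c |h|]
   ([feedback]).  Since [H = <p, H_p>] and [xbar], [pbar] solve the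
   Hamiltonian system, the derivative of [W] is, by the Riccati equation and up to
   sign, the second order Taylor remainder of [H] ([model_derivative]), hence
   [O(|h|^3)] ([model_decrease]).  This proves the first assertion
   ([subjet_propagation]).  The symmetry of [Q], which is part of the notion of a
   subjet, comes from uniqueness for the Riccati equation, whose transpose is
   itself because mixed second derivatives commute ([tube_schwarz]).

   If [phi] is locally semiconcave, then the second differences of [V t] at
   [xbar t] are bounded above by [c |h|^2], uniformly in [t]: follow from
   [xbar t + h] and [xbar t - h] the trajectories with zero feedback gain, whose
   mean differs from [xbar] by [O(|h|^2)] as [H_p] has Lipschitz derivatives
   ([value_second_difference]).  Comparing with the propagated subjets yields
   [- Q <= c] as long as [Q] exists.  In the other direction [H_pp >= 0], so that the
   trace of the nonnegative matrix [Q + c] satisfies a linear differential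
   inequality ([riccati_bound]).  Being bounded a priori, [Q] does not blow up
   ([riccati_global]).

   Arcs are merely absolutely continuous.  The estimates rest on a
   monotonicity principle for absolutely continuous functions whose increments
   are controlled almost everywhere ([absc_straddle_le]), which follows by
   Cousin's argument on tagged partitions.  Derivatives are taken relative to a
   compact interval throughout, so that endpoints need no separate treatment. *)

(** * Monotonicity from almost everywhere estimates *)

Section Cousin.
Context {R : realType}.

(** An additive property of intervals that holds for all short intervals around
   each point holds for the whole interval: the supremum of the right ends
   reached from [a] cannot be smaller than [b].  Besides monotonicity, this gives
   uniform constants along compact arcs and continuation of a priori bounds. *)
Lemma cousin (P : R -> R -> Prop) (a b : R) : a <= b ->
  (forall u v w, a <= u -> u <= v -> v <= w -> w <= b ->
     P u v -> P v w -> P u w) ->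
  (forall s, a <= s -> s <= b -> exists2 d : R, 0 < d &
     forall u v, a <= u -> u <= s -> s <= v -> v <= b -> v - u <= d -> P u v) ->
  P a b.
Proof.
move=> ab Padd Ploc.
pose S := [set x | [/\ a <= x, x <= b & P a x]].
have Sa : S a.
  have [d d0 Pd] := Ploc a (lexx _) ab.
  by split => //; apply: Pd => //; lra.
have hS : has_sup S by split; [exists a|exists b => x []].
pose c := sup S.
have lec : a <= c by apply: (ub_le_sup hS.2).
have cb : c <= b by apply: ge_sup; [exists a | move=> x []].
have [d d0 Pd] := Ploc c lec cb.
have [x [ax xb Pax] xc] := sup_adherent (divr_gt0 d0 (ltr0Sn _ 1)) hS.
have {}xc : c - d / 2 < x by [].
have xlec : x <= c by apply: (ub_le_sup hS.2).
pose v := Num.min b (c + d / 2).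
have [vb vc] : v <= b /\ v <= c + d / 2 by rewrite !ge_min !lexx ?orbT.
have cv : c <= v by rewrite le_min cb /=; lra.
have Pav : P a v.
  by apply: (Padd a x v) => //; [lra | apply: Pd => //; lra].
have : v <= c by apply: (ub_le_sup hS.2); split => //; lra.
rewrite /v; case: (leP b (c + d / 2)) => h hv; last by lra.
by have -> : b = v by rewrite /v min_l.
Qed.

End Cousin.

Section Within.
Context {R : realType} {V : normedModType R}.
Implicit Types (f g : R -> V) (a b s : R).

(** Continuity and differentiability at [s] seen from [[a, b]] only; [f] is a
   total function whose values elsewhere are irrelevant. *)
Definition contw a b f s : Prop := forall e : R, 0 < e -> exists2 d : R, 0 < d &
  forall u, a <= u -> u <= b -> `|u - s| <= d -> `|f u - f s| <= e.

Definition derivw a b f s (v : V) : Prop := forall e : R, 0 < e -> exists2 d : R, 0 < d &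
  forall u, a <= u -> u <= b -> `|u - s| <= d ->
    `|f u - f s - (u - s) *: v| <= e * `|u - s|.

(** Testing ordered families is enough, as these are the ones that come from
   partitions, and it makes concatenation immediate. *)
Definition absc a b f : Prop := forall e : R, 0 < e -> exists2 d : R, 0 < d &
  forall l : seq (R * R),
    (forall p, p \in l -> [/\ a <= p.1, p.1 <= p.2 & p.2 <= b]) ->
    pairwise (fun p q => p.2 <= q.1) l ->
    \sum_(p <- l) (p.2 - p.1) < d ->
    \sum_(p <- l) `|f p.2 - f p.1| < e.

(** The increment is taken across [s], between points on either side: such
   estimates can be summed over tagged partitions. *)
Definition straddle a b (f : R -> R) s : Prop :=
  forall e : R, 0 < e -> exists2 d : R, 0 < d &
  forall u v, a <= u -> u <= s -> s <= v -> v <= b -> v - u <= d ->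
    f v - f u <= e * (v - u).

Lemma derivw_contw a b f s v : derivw a b f s v -> contw a b f s.
Proof.
move=> h e e0; have [d d0 hd] := h 1 ltr01.
pose M := 1 + `|v|.
have M0 : 0 < M by rewrite /M; have := normr_ge0 v; lra.
exists (Num.min d (e / M)); first by rewrite lt_min d0 divr_gt0.
move=> u au ub; rewrite le_min => /andP[us us'].
have := hd u au ub us; rewrite mul1r => h1.
have : `|f u - f s| <= `|f u - f s - (u - s) *: v| + `|(u - s) *: v|.
  by apply: le_trans (ler_normD _ _); rewrite subrK.
rewrite normrZ => h2.
have : `|u - s| * M <= e by rewrite -ler_pdivlMr.
by rewrite /M; lra.
Qed.

Lemma derivw_sub a b a' b' f s v : a <= a' -> b' <= b -> derivw a b f s v -> derivw a' b' f s v.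
Proof.
move=> aa bb h e e0; have [d d0 hd] := h e e0; exists d => // u au ub.
by apply: hd; lra.
Qed.

Lemma contw_sub a b a' b' f s : a <= a' -> b' <= b -> contw a b f s -> contw a' b' f s.
Proof.
move=> aa bb h e e0; have [d d0 hd] := h e e0; exists d => // u au ub.
by apply: hd; lra.
Qed.

Lemma absc_sub a b a' b' f : a <= a' -> b' <= b -> absc a b f -> absc a' b' f.
Proof.
move=> aa bb h e e0; have [d d0 hd] := h e e0; exists d => // l hl.
by apply: hd => p /hl [] *; split => //; lra.
Qed.

Lemma absc_contw a b f s : absc a b f -> a <= s -> s <= b -> contw a b f s.
Proof.
move=> h as_ sb e e0; have [d d0 hd] := h e e0; exists (d / 2); first by lra.
move=> u au ub us; case: (leP u s) => us'.
- have := hd [:: (u, s)]; rewrite !big_seq1 /= => hh; rewrite distrC ltW//.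
  apply: hh => //; first by move=> p; rewrite inE => /eqP ->.
  by move: us; rewrite ler0_norm; lra.
- have := hd [:: (s, u)]; rewrite !big_seq1 /= => hh; rewrite ltW//.
  apply: hh => //; first by move=> p; rewrite inE => /eqP -> /=; split => //; lra.
  by move: us; rewrite gtr0_norm; lra.
Qed.

Lemma contw_bounded a b f : a <= b -> (forall s, a <= s -> s <= b -> contw a b f s) ->
  exists2 M : R, 0 < M & forall s, a <= s -> s <= b -> `|f s| <= M.
Proof.
move=> ab h.
apply: (@cousin _ (fun u v => exists2 M : R, 0 < M &
  forall s, u <= s -> s <= v -> `|f s| <= M)) => //.
- move=> u v w _ uv vw _ [M M0 hM] [N N0 hN]; exists (M + N); first by lra.
  move=> s us sw; case: (leP s v) => sv; first by have := hM s us sv; lra.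
  by have := hN s (ltW sv) sw; lra.
- move=> s as_ sb; have [d d0 hd] := h s as_ sb 1 ltr01; exists d => // u v au us sv vb vu.
  exists (1 + `|f s|) => [|t ut tv]; first by have := normr_ge0 (f s); lra.
  have : `|f t - f s| <= 1 by apply: hd; [lra|lra|rewrite ler_norml; lra].
  have : `|f t| <= `|f t - f s| + `|f s| by apply: le_trans (ler_normD _ _); rewrite subrK.
  by lra.
Qed.

End Within.

Arguments contw : simpl never.
Arguments derivw : simpl never.
Arguments absc : simpl never.
Arguments straddle : simpl never.

Section AE.
Context {R : realType}.
Implicit Types P Q : R -> Prop.
Let mu := @lebesgue_measure R.

Lemma ae_sub P Q : (forall s, P s -> Q s) -> {ae mu, forall s, P s} -> {ae mu, forall s, Q s}.
Proof. by move=> PQ; apply: negligibleS => s /= nQ hP; apply: nQ; exact: PQ. Qed.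

Lemma ae_all P : (forall s, P s) -> {ae mu, forall s, P s}.
Proof. by move=> hP; apply: negligibleS (negligible_set0 _) => s /=; apply; exact: hP. Qed.

Lemma ae_and P Q : {ae mu, forall s, P s} -> {ae mu, forall s, Q s} ->
  {ae mu, forall s, P s /\ Q s}.
Proof.
move=> hP hQ; apply: negligibleS (negligibleU hP hQ) => s /= /not_andP[h|h].
  by left.
by right.
Qed.

Lemma ae_neq (c : R) : {ae mu, forall s, s != c}.
Proof.
exists [set c]; split => //; first exact: lebesgue_measure_set1.
by move=> s /= /negP; rewrite negbK => /eqP.
Qed.

End AE.

Section Straddle.
Context {R : realType}.
Implicit Types (f g : R -> R) (a b s : R).

Lemma straddle_le a b f : a <= b -> (forall s, a <= s -> s <= b -> straddle a b f s) ->
  f b <= f a.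
Proof.
move=> ab h; apply/ler_addgt0Pl => e e0.
have ba : 0 < b - a + 1 by lra.
pose e' := e / (b - a + 1).
have e'0 : 0 < e' by rewrite divr_gt0.
have : f b - f a <= e' * (b - a).
  apply: (@cousin _ (fun u v => f v - f u <= e' * (v - u))) => //; first by move=> *; lra.
  by move=> s as_ sb; exact: h.
have : e' * (b - a + 1) = e by rewrite /e' divfK// gt_eqF.
by lra.
Qed.

Lemma negligible_cover (N : set R) (e : R) : (@lebesgue_measure R).-negligible N ->
  0 < e -> exists G : set R, [/\ open G, N `<=` G & (lebesgue_measure G < e%:E)%E].
Proof.
move=> [A [mA A0 NA]] e0.
have [|//|U [oU AU] muU] := @lebesgue_regularity_outer R A e mA.
  by rewrite [X in (X < _)%E]A0 ltry.
exists U; split => //; first by apply: subset_trans NA _.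
have mU : measurable U by exact: open_measurable.
have UE : U = A `|` (U `\` A) by rewrite setDUK.
rewrite UE; apply: le_lt_trans (measureU2 _ mA _) _; first exact: measurableD.
move: A0; rewrite /= => ->; rewrite add0e; exact: muU.
Qed.

(** Ordering makes the first interval disjoint from all the others, so that its
   measure can be split off [G]. *)
Lemma sorted_length_le (l : seq (R * R)) (G : set R) :
  (forall p, p \in l -> p.1 <= p.2) ->
  pairwise (fun p q : R * R => p.2 <= q.1) l -> measurable G ->
  (forall p, p \in l -> `]p.1, p.2[%classic `<=` G) ->
  ((\sum_(p <- l) (p.2 - p.1))%:E <= lebesgue_measure G)%E.
Proof.
elim: l G => [|p l IH] G hl; first by rewrite big_nil => *; exact: measure_ge0.
rewrite pairwise_cons => /andP[/allP hp hpw] mG hG.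
rewrite big_cons EFinD.
have p12 : p.1 <= p.2 by apply: hl; rewrite mem_head.
have mI : measurable (`]p.1, p.2[%classic : set R) by exact: measurable_itv.
have sG : `]p.1, p.2[%classic `<=` G by apply: hG; rewrite mem_head.
have GE : G = `]p.1, p.2[%classic `|` (G `\` `]p.1, p.2[%classic) by rewrite setDUK.
rewrite GE measureU//; [|exact: measurableD|by rewrite setDIK].
apply: leeD.
  rewrite [X in (_ <= X)%E](@lebesgue_measure_itv R) /= lte_fin.
  by case: ltP => h; rewrite -?EFinB ?lee_fin//; lra.
apply: IH => //.
- by move=> q ql; apply: hl; rewrite inE ql orbT.
- exact: measurableD.
move=> q ql x /= hx; split; first by apply: (hG q) => //; rewrite inE ql orbT.
move: hx; rewrite !in_itv/= => /andP[qx _] /andP[_ xp].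
by have := hp q ql; lra.
Qed.

(** Tags in the exceptional null set are given intervals inside an open set of
   small measure; by absolute continuity these contribute little, whereas at
   the other tags the straddling estimate applies. *)
Lemma absc_straddle_le a b f : a <= b -> absc a b f ->
  {ae (@lebesgue_measure R), forall s, a <= s <= b -> straddle a b f s} ->
  f b <= f a.
Proof.
move=> ab acf hae; apply/ler_addgt0Pl => e e0.
have ba : 0 < b - a + 1 by lra.
pose e' := e / 2 / (b - a + 1).
have e'0 : 0 < e' by rewrite !divr_gt0.
have [d d0 hd] := acf (e / 2) (divr_gt0 e0 (ltr0Sn _ 1)).
have [G [oG NG muG]] := negligible_cover hae d0.
have [l [hl pl lG fl]] : exists l : seq (R * R),
   [/\ (forall p, p \in l -> [/\ a <= p.1, p.1 <= p.2 & p.2 <= b]),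
       pairwise (fun p q => p.2 <= q.1) l,
       (forall p, p \in l -> `]p.1, p.2[%classic `<=` G) &
       f b - f a <= e' * (b - a) + \sum_(p <- l) `|f p.2 - f p.1|].
  apply: (@cousin _ (fun u v => exists l : seq (R * R),
   [/\ (forall p, p \in l -> [/\ u <= p.1, p.1 <= p.2 & p.2 <= v]),
       pairwise (fun p q => p.2 <= q.1) l,
       (forall p, p \in l -> `]p.1, p.2[%classic `<=` G) &
       f v - f u <= e' * (v - u) + \sum_(p <- l) `|f p.2 - f p.1|])) => //.
  - move=> u v w _ uv vw _ [l [h1 h2 h3 h4]] [m [k1 k2 k3 k4]]; exists (l ++ m); split.
    + move=> p; rewrite mem_cat => /orP[/h1|/k1] []; split => //; lra.
    + rewrite pairwise_cat h2 k2 !andbT; apply/allrelP => p q /h1[? ? pv] /k1[vq _ _].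
      by lra.
    + by move=> p; rewrite mem_cat => /orP[/h3|/k3].
    + by rewrite big_cat /=; lra.
  - move=> s as_ sb; case: (pselect (straddle a b f s)) => hs.
      have [d' d'0 h] := hs e' e'0; exists d' => // u v au us sv vb vu.
      by exists [::]; rewrite big_nil addr0; split => //; exact: h.
    have Gs : G s by apply: NG => /= h; apply: hs; apply: h; rewrite as_ sb.
    have [r /= r0 hr] : exists2 r : R, 0 < r & ball s r `<=` G.
      by have := open_nbhs_nbhs (conj oG Gs); rewrite -nbhs_ballE => -[r ? ?]; exists r.
    exists (r / 2); first by lra.
    move=> u v au us sv vb vu; exists [:: (u, v)]; rewrite big_seq1 /=; split => //.
    + by move=> p; rewrite inE => /eqP -> /=; split => //; lra.
    + move=> p; rewrite inE => /eqP -> /= t /=; rewrite in_itv/= => /andP[ut tv].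
      by apply: hr; rewrite /ball /= ltr_norml; lra.
    + have : 0 <= e' * (v - u) by apply: mulr_ge0; lra.
      by have := ler_norm (f v - f u); lra.
have : \sum_(p <- l) (p.2 - p.1) < d.
  rewrite -lte_fin; apply: le_lt_trans muG; apply: sorted_length_le => //.
  - by move=> p /hl[].
  - exact: open_measurable.
move=> /(hd l hl pl) sm.
have : e' * (b - a + 1) = e / 2 by rewrite /e' divfK// gt_eqF.
by lra.
Qed.

End Straddle.

(** * Derivatives relative to an interval, Gronwall inequalities *)

Section DwAlgebra.
Context {R : realType} {V : normedModType R}.
Implicit Types (f g : R -> V) (a b s : R).

Lemma derivw_cst a b (c : V) s : derivw a b (fun=> c) s 0.
Proof.
move=> e e0; exists 1 => // u _ _ _.
by rewrite scaler0 !subr0 subrr normr0 mulr_ge0// ltW.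
Qed.

Lemma derivw_add a b f g s v w : derivw a b f s v -> derivw a b g s w ->
  derivw a b (fun t => f t + g t) s (v + w).
Proof.
move=> hf hg e e0.
have [d d0 hd] := hf _ (divr_gt0 e0 (ltr0Sn _ 1)).
have [d' d'0 hd'] := hg _ (divr_gt0 e0 (ltr0Sn _ 1)).
exists (Num.min d d'); first by rewrite lt_min d0.
move=> u au ub; rewrite le_min => /andP[ud ud'].
have := hd u au ub ud; have := hd' u au ub ud' => h1 h2.
have -> : f u + g u - (f s + g s) - (u - s) *: (v + w) =
  (f u - f s - (u - s) *: v) + (g u - g s - (u - s) *: w).
  by rewrite scalerDr !opprD; rewrite [LHS](AC (2*2*2) ((1*3*5)*(2*4*6)))/=.
apply: le_trans (ler_normD _ _) _.
have := normr_ge0 (u - s); nra.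
Qed.

Lemma derivw_scale a b (c : R) f s v : derivw a b f s v -> derivw a b (fun t =>
  c *: f t) s (c *: v).
Proof.
move=> hf e e0.
have c0 : 0 < `|c| + 1 by have := normr_ge0 c; lra.
have [d d0 hd] := hf _ (divr_gt0 e0 c0).
exists d => // u au ub ud.
have := hd u au ub ud => h.
have -> : c *: f u - c *: f s - (u - s) *: (c *: v) = c *: (f u - f s - (u - s) *: v).
  by rewrite !scalerBr !scalerA mulrC.
rewrite normrZ.
have h1 : `|c| * `|f u - f s - (u - s) *: v| <= `|c| * (e / (`|c| + 1) * `|u - s|).
  by apply: ler_wpM2l.
apply: le_trans h1 _; rewrite mulrA ler_wpM2r// mulrCA ger_pMr//.
by rewrite ler_pdivrMr//; lra.
Qed.

Lemma derivw_opp a b f s v : derivw a b f s v -> derivw a b (fun t => - f t) s (- v).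
Proof. by move=> /(derivw_scale (-1)); rewrite scaleN1r; under eq_fun do rewrite scaleN1r. Qed.

Lemma derivw_diff a b f g s v w : derivw a b f s v -> derivw a b g s w ->
  derivw a b (fun t => f t - g t) s (v - w).
Proof. by move=> hf /derivw_opp; exact: derivw_add. Qed.

Lemma derivw_sum (I : Type) (r : seq I) (P : pred I) a b (f : I -> R -> V) s (v : I -> V) :
  (forall i, P i -> derivw a b (f i) s (v i)) ->
  derivw a b (fun t => \sum_(i <- r | P i) f i t) s (\sum_(i <- r | P i) v i).
Proof.
move=> h; elim: r => [|i r IH].
  by rewrite big_nil; under eq_fun do rewrite big_nil; exact: derivw_cst.
rewrite big_cons; under eq_fun do rewrite big_cons.
by case: ifP => // Pi; apply: derivw_add => //; exact: h.
Qed.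

Lemma derivw_eq a b f g s v : a <= s -> s <= b -> (forall t, a <= t -> t <= b -> f t = g t) ->
  derivw a b f s v -> derivw a b g s v.
Proof.
move=> as_ sb fg h e e0; have [d d0 hd] := h e e0; exists d => // u au ub us.
by rewrite -!fg//; exact: hd.
Qed.

Lemma derivw_line a b (w : V) s : derivw a b (fun t => t *: w) s w.
Proof.
move=> e e0; exists 1 => // u _ _ _.
by rewrite -scalerBl subrr normr0 mulr_ge0// ltW.
Qed.

Lemma derivable_derivw a b f s : derivable f s 1 -> derivw a b f s (derive1 f s).
Proof.
move=> df e e0; have := df; rewrite /derivable -/('D_1 f s) => /cvg_ex[l hl].
have -> : derive1 f s = l by rewrite derive1E; apply/cvg_lim.
have /cvgrPdist_le /(_ e e0) /= := hl.
rewrite near_withinE => /nbhs_ballP[d /= d0 hd].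
exists (d / 2) => [|u _ _ us]; first by rewrite divr_gt0.
have [->|us0] := eqVneq u s; first by rewrite !subrr scale0r subr0 !normr0 mulr0.
have us0' : u - s != 0 by rewrite subr_eq0.
have := hd (u - s); rewrite /ball /= sub0r normrN => hh.
have {hh} : `|l - (u - s)^-1 *: (f ((u - s) *: 1 + s) - f s)| <= e.
  by apply: hh => //; lra.
rewrite [_ *: 1]mulr1 subrK distrC.
have -> : f u - f s - (u - s) *: l = (u - s) *: ((u - s)^-1 *: (f u - f s) - l).
  by rewrite scalerBr scalerA mulfV// scale1r.
by rewrite normrZ mulrC => h; apply: ler_wpM2r.
Qed.

Lemma derivw_is_derive a b f s v : a < s -> s < b -> derivw a b f s v -> is_derive s 1 f v.
Proof.
move=> as_ sb h.
have hl : (fun t => t^-1 *: (f (t *: 1 + s) - f s)) @ 0^' --> v.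
  apply/cvgrPdist_le => e e0; have [d d0 hd] := h e e0.
  rewrite near_withinE; apply/nbhs_ballP.
  exists (Num.min d (Num.min (s - a) (b - s))) => /=; first by rewrite !lt_min d0 !subr_gt0 as_.
  move=> t; rewrite /ball /= sub0r normrN !lt_min => /andP[td /andP[ta tb]] t0.
  rewrite [_ *: 1]mulr1.
  have := hd (t + s); rewrite addrK => hh.
  have {}hh : `|f (t + s) - f s - t *: v| <= e * `|t|.
    by move: ta tb; rewrite !ltr_norml => /andP[? ?] /andP[? ?]; apply: hh; [lra|lra|exact: ltW].
  rewrite distrC.
  have -> : t^-1 *: (f (t + s) - f s) - v = t^-1 *: (f (t + s) - f s - t *: v).
    by rewrite [in RHS]scalerBr scalerA mulVf// scale1r.
  by rewrite normrZ normfV ler_pdivrMl ?normr_gt0// mulrC.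
split; first by apply/cvg_ex; exists v.
exact/cvg_lim.
Qed.

End DwAlgebra.

Section DwScalar.
Context {R : realType}.
Implicit Types (f g : R -> R) (a b s : R).

Lemma derivw_mul a b f g s v w : derivw a b f s v -> derivw a b g s w ->
  derivw a b (fun t => f t * g t) s (v * g s + f s * w).
Proof.
move=> hf hg e e0; have cf := derivw_contw hf.
pose M := `|g s| + `|w| + (`|f s| + 1) + 1.
have M0 : 0 < M by rewrite /M; have := normr_ge0 (g s); have := normr_ge0 w; have :=
  normr_ge0 (f s); lra.
have eM : 0 < e / M by rewrite divr_gt0.
have [d1 d10 h1] := hf _ eM; have [d2 d20 h2] := hg _ eM.
have [d3 d30 h3] := cf (Num.min 1 (e / M)) ltac:(by rewrite lt_min ltr01).
exists (Num.min d1 (Num.min d2 d3)); first by rewrite !lt_min d10 d20.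
move=> u au ub; rewrite !le_min => /andP[u1 /andP[u2 u3]].
have := h1 u au ub u1; have := h2 u au ub u2; have := h3 u au ub u3.
rewrite /GRing.scale /= le_min => /andP[k1 k2] k3 k4.
have -> : f u * g u - f s * g s - (u - s) * (v * g s + f s * w) =
  (f u - f s - (u - s) * v) * g s + f u * (g u - g s - (u - s) * w)
   + (u - s) * w * (f u - f s) by ring.
have fu : `|f u| <= `|f s| + 1.
  have := ler_normD (f u - f s) (f s); rewrite subrK; lra.
apply: le_trans (ler_normD _ _) _; apply: le_trans (lerD (ler_normD _ _) (lexx _)) _.
rewrite !normrM.
have a0 := normr_ge0 (u - s).
have t1 : `|f u - f s - (u - s) * v| * `|g s| <= e / M * `|u - s| * `|g s| by apply: ler_wpM2r.
have t2 : `|f u| * `|g u - g s - (u - s) * w| <= (`|f s| + 1) * (e / M * `|u - s|) by apply: ler_pM.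
have t3 : `|u - s| * `|w| * `|f u - f s| <= `|u - s| * `|w| * (e / M) by apply: ler_wpM2l => //;
  exact: mulr_ge0.
have -> : e * `|u - s| = e / M * `|u - s| * M by field; rewrite gt_eqF.
have m0 : 0 <= e / M * `|u - s| by rewrite mulr_ge0// ltW.
apply: le_trans (lerD (lerD t1 t2) t3) _.
rewrite [X in _ + X]mulrAC [X in _ + X * _]mulrC.
move: m0; set m := e / M * `|u - s| => m0.
rewrite [(_ + 1) * m]mulrC -!mulrDr; apply: ler_wpM2l => //.
by rewrite /M; lra.
Qed.

Lemma straddle_derivw a b f s v : v <= 0 -> derivw a b f s v -> straddle a b f s.
Proof.
move=> v0 h e e0; have [d d0 hd] := h e e0; exists d => // u w au us sw wb wu.
have := hd u au ltac:(lra) ltac:(rewrite ler_norml; lra).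
have := hd w ltac:(lra) wb ltac:(rewrite ler_norml; lra).
rewrite /GRing.scale /= (ler0_norm (_ : u - s <= 0)) ?subr_le0// (ger0_norm (_ : 0 <= w - s))
  ?subr_ge0//.
rewrite !ler_norml => /andP[_ h1] /andP[h2 _].
have : (w - u) * v <= 0 by apply: mulr_ge0_le0; lra.
lra.
Qed.

End DwScalar.

Section MeanValue.
Context {R : realType} {V : normedModType R}.
Implicit Types (a b s : R) (z : R -> V).

Lemma derivw_norm_straddle a b z s w : derivw a b z s w ->
  forall e : R, 0 < e -> exists2 d : R, 0 < d &
  forall u v, a <= u -> u <= s -> s <= v -> v <= b -> v - u <= d ->
    `|z v - z u| <= (`|w| + e) * (v - u).
Proof.
move=> h e e0; have [d d0 hd] := h e e0; exists d => // u v au us sv vb vu.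
have := hd u au ltac:(lra) ltac:(rewrite ler_norml; lra).
have := hd v ltac:(lra) vb ltac:(rewrite ler_norml; lra).
rewrite (ler0_norm (_ : u - s <= 0)) ?subr_le0// (ger0_norm (_ : 0 <= v - s)) ?subr_ge0// => h1 h2.
have -> : z v - z u = (z v - z s - (v - s) *: w) - (z u - z s - (u - s) *: w) + (v - u) *: w.
  have -> : v - u = (v - s) - (u - s) by ring.
  move: (v - s) (u - s) => p q; rewrite scalerBl.
  rewrite addrAC subrKA -[z v - _ - _]addrA -[z u - _ - _]addrA -!opprD.
  by rewrite opprB subrKA.
apply: le_trans (ler_normD _ _) _; apply: le_trans (lerD (ler_normB _ _) (lexx _)) _.
rewrite normrZ (ger0_norm (_ : 0 <= v - u)) ?subr_ge0//; lra.
Qed.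

(** The majorant [psi] is differentiated instead of integrating [z], so that
   no vector-valued integral is needed. *)
Lemma mean_value a b z (psi p : R -> R) : a <= b ->
  (forall s, a <= s -> s <= b -> exists2 w, derivw a b z s w & `|w| <= p s) ->
  (forall s, a <= s -> s <= b -> derivw a b psi s (p s)) ->
  `|z b - z a| <= psi b - psi a.
Proof.
move=> ab hz hpsi.
suff : `|z b - z a| - psi b <= `|z a - z a| - psi a by rewrite subrr normr0; lra.
apply: (@straddle_le _ a b (fun t => `|z t - z a| - psi t)) => // s as_ sb e e0.
have [w hw wp] := hz s as_ sb.
have [d d0 hd] := derivw_norm_straddle hw (divr_gt0 e0 (ltr0Sn _ 1)).
have [d' d'0 hd'] := hpsi s as_ sb _ (divr_gt0 e0 (ltr0Sn _ 1)).
exists (Num.min d d') => [|u v au us sv vb]; first by rewrite lt_min d0.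
rewrite le_min => /andP[vu vu'].
have h1 := hd u v au us sv vb vu.
have := hd' u au ltac:(lra) ltac:(rewrite ler_norml; lra).
have := hd' v ltac:(lra) vb ltac:(rewrite ler_norml; lra).
rewrite /GRing.scale /= (ler0_norm (_ : u - s <= 0)) ?subr_le0// (ger0_norm (_ : 0 <= v - s))
  ?subr_ge0//.
rewrite !ler_norml => /andP[h2 _] /andP[_ h3].
have : `|z v - z a| <= `|z v - z u| + `|z u - z a|.
  by apply: le_trans (ler_normD _ _); rewrite subrKA.
have : `|w| * (v - u) <= p s * (v - u) by apply: ler_wpM2r; lra.
lra.
Qed.

Lemma mean_value_cst a b z (M : R) : a <= b ->
  (forall s, a <= s -> s <= b -> exists2 w, derivw a b z s w & `|w| <= M) ->
  `|z b - z a| <= M * (b - a).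
Proof.
move=> ab h; rewrite mulrBr.
apply: (@mean_value a b z (fun t => M * t) (fun=> M)) => // s _ _ e e0.
exists 1 => // u _ _ _.
rewrite /GRing.scale /= (_ : _ - _ = 0); last by ring.
by rewrite normr0 mulr_ge0// ltW.
Qed.

Lemma derivw_lipschitz a b z (M : R) :
  (forall s, a <= s -> s <= b -> exists2 w, derivw a b z s w & `|w| <= M) ->
  forall u v, a <= u -> u <= v -> v <= b -> `|z v - z u| <= M * (v - u).
Proof.
move=> h u v au uv vb; apply: mean_value_cst => // s us sv.
have [w hw wM] := h s ltac:(lra) ltac:(lra).
by exists w => //; apply: derivw_sub hw.
Qed.

End MeanValue.

Section ACAlgebra.
Context {R : realType}.
Implicit Types (a b s : R).

(** All closure properties of absolute continuity (sums, products, norms) are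
   instances of domination of increments. *)
Lemma absc_dom2 (V1 V2 V3 : normedModType R) a b (f : R -> V1) (g : R -> V2) (h : R -> V3) (L : R) :
  (forall u v, a <= u -> u <= v -> v <= b ->
     `|h v - h u| <= L * (`|f v - f u| + `|g v - g u|)) ->
  absc a b f -> absc a b g -> absc a b h.
Proof.
move=> hL hf hg e e0.
have L0 : 0 < `|L| + 1 by have := normr_ge0 L; lra.
have eL : 0 < e / 2 / (`|L| + 1) by rewrite !divr_gt0.
have [d d0 hd] := hf _ eL; have [d' d'0 hd'] := hg _ eL.
exists (Num.min d d') => [|l hl pl]; first by rewrite lt_min d0.
rewrite lt_min => /andP[/(hd l hl pl) s1 /(hd' l hl pl) s2].
have : \sum_(p <- l) `|h p.2 - h p.1| <=
   (`|L| + 1) * (\sum_(p <- l) `|f p.2 - f p.1| + \sum_(p <- l) `|g p.2 - g p.1|).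
  rewrite -big_split /= mulr_sumr big_seq [leRHS]big_seq; apply: ler_sum => p /hl[? ? ?].
  apply: le_trans (hL _ _ _ _ _) _ => //; apply: ler_wpM2r; first by rewrite addr_ge0.
  by have := ler_norm L; lra.
move=> h1; apply: le_lt_trans h1 _.
have {1}-> : e = (`|L| + 1) * (e / 2 / (`|L| + 1) + e / 2 / (`|L| + 1)).
  by field; rewrite gt_eqF.
by rewrite ltr_pM2l//; lra.
Qed.

Lemma absc_id a b : absc a b (id : R -> R).
Proof.
move=> e e0; exists e => // l hl _; apply: le_lt_trans.
rewrite big_seq [leRHS]big_seq; apply: ler_sum => p /hl[_ ? _].
by rewrite ger0_norm// subr_ge0.
Qed.

Lemma absc_lip (V : normedModType R) a b (f : R -> V) (L : R) :
  (forall u v, a <= u -> u <= v -> v <= b -> `|f v - f u| <= L * (v - u)) -> absc a b f.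
Proof.
move=> h; apply: (@absc_dom2 _ _ _ a b id id f `|L|) (absc_id _ _) (absc_id _ _) => u v au uv vb.
apply: le_trans (h u v au uv vb) _.
rewrite (ger0_norm (_ : 0 <= v - u)) ?subr_ge0//.
have := ler_norm L; have := normr_ge0 L; nra.
Qed.

Lemma absc_cst (V : normedModType R) a b (c : V) : absc a b (fun=> c).
Proof. by apply: (@absc_lip _ _ _ _ 0) => *; rewrite subrr normr0 mul0r. Qed.

Lemma absc_add (V : normedModType R) a b (f g : R -> V) :
  absc a b f -> absc a b g -> absc a b (fun t => f t + g t).
Proof.
apply: (@absc_dom2 _ _ _ a b f g _ 1) => u v _ _ _; rewrite mul1r.
by rewrite opprD addrACA ler_normD.
Qed.

Lemma absc_scale (V : normedModType R) a b (c : R) (f : R -> V) :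
  absc a b f -> absc a b (fun t => c *: f t).
Proof.
move=> h; apply: (@absc_dom2 _ _ _ a b f f _ `|c|) (h) (h) => u v _ _ _.
by rewrite -scalerBr normrZ ler_wpM2l// lerDl.
Qed.

Lemma absc_sum (V : normedModType R) (I : Type) (r : seq I) (P : pred I) a b (f : I -> R -> V) :
  (forall i, P i -> absc a b (f i)) -> absc a b (fun t => \sum_(i <- r | P i) f i t).
Proof.
move=> h; elim: r => [|i r IH].
  by under eq_fun do rewrite big_nil; exact: absc_cst.
under eq_fun do rewrite big_cons.
by case: (P i) (h i) => [hi|//]; exact: (absc_add (hi isT) IH).
Qed.

Lemma absc_norm (V : normedModType R) a b (f : R -> V) : absc a b f -> absc a b (fun t => `|f t|).
Proof.
move=> h; apply: (@absc_dom2 _ _ _ a b f f _ 1) (h) (h) => u v _ _ _; rewrite mul1r.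
by apply: (le_trans (@ler_dist_dist _ _ (f v) (f u))); rewrite lerDl.
Qed.

Lemma absc_mul a b (f g : R -> R) : a <= b -> absc a b f -> absc a b g ->
  absc a b (fun t => f t * g t).
Proof.
move=> ab hf hg.
have [M M0 hM] := contw_bounded ab (fun s h1 h2 => absc_contw hf h1 h2).
have [N N0 hN] := contw_bounded ab (fun s h1 h2 => absc_contw hg h1 h2).
apply: (@absc_dom2 _ _ _ a b f g _ (M + N)) (hf) (hg) => u v au uv vb.
have -> : f v * g v - f u * g u = f v * (g v - g u) + (f v - f u) * g u by ring.
apply: le_trans (ler_normD _ _) _; rewrite !normrM.
have h1 : `|f v| * `|g v - g u| <= M * `|g v - g u| by apply: ler_wpM2r => //; apply: hM; lra.
have h2 : `|f v - f u| * `|g u| <= `|f v - f u| * N by apply: ler_wpM2l => //; apply: hN; lra.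
have := normr_ge0 (g v - g u); have := normr_ge0 (f v - f u); nra.
Qed.

Lemma absc_eq (V : normedModType R) a b (f g : R -> V) :
  (forall t, a <= t -> t <= b -> f t = g t) -> absc a b f -> absc a b g.
Proof.
move=> fg h; apply: (@absc_dom2 _ _ _ a b f f _ 1) (h) (h) => u v au uv vb; rewrite mul1r.
by rewrite -!fg ?lerDl//; lra.
Qed.

Lemma derivw_absc (V : normedModType R) a b (z : R -> V) (M : R) :
  (forall s, a <= s -> s <= b -> exists2 w, derivw a b z s w & `|w| <= M) -> absc a b z.
Proof. by move=> h; exact: absc_lip (derivw_lipschitz h). Qed.

End ACAlgebra.

Section Gronwall.
Context {R : realType}.
Implicit Types (a b s K eps : R).

(** The weight [E s = expR (- K (s - a))] makes [E (q + eps / K)]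
   nonincreasing.  As [E] decreases and [1 + x <= expR x], the weight enters
   only through [E v * (1 + K (v - u)) <= E u]. *)
Lemma gronwall (q : R -> R) a b K eps : a <= b -> 0 < K -> 0 <= eps ->
  (forall s, a <= s -> s <= b -> 0 <= q s) -> absc a b q ->
  {ae (@lebesgue_measure R), forall s, a <= s <= b ->
    forall e : R, 0 < e -> exists2 d : R, 0 < d &
    forall u v, a <= u -> u <= s -> s <= v -> v <= b -> v - u <= d ->
      q v - q u <= (K * q s + eps + e) * (v - u)} ->
  q b <= (q a + eps / K) * expR (K * (b - a)).
Proof.
move=> ab K0 eps0 q0 acq hae.
pose E t := expR (- (K * (t - a))).
have E0 t : 0 < E t by exact: expR_gt0.
have E1 t : a <= t -> E t <= 1 by move=> ta; rewrite -expR0 ler_expR; nra.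
have Eu u v : u <= v -> E v * (1 + K * (v - u)) <= E u.
  move=> uv; rewrite (_ : E u = E v * expR (K * (v - u))).
    by rewrite ler_pM2l//; exact: expR_ge1Dx.
  by rewrite /E -expRD; congr expR; ring.
have acE : absc a b E.
  apply: (@absc_lip _ _ _ _ _ K) => u v au uv vb.
  have : E v <= E u by rewrite ler_expR; nra.
  move=> vu; rewrite ler0_norm; last by lra.
  have : E u * (1 - K * (v - u)) <= E v.
    rewrite (_ : E v = E u * expR (- (K * (v - u)))).
      by rewrite ler_pM2l//; apply: le_trans (expR_ge1Dx _).
    by rewrite /E -expRD; congr expR; ring.
  have := E1 u au; have := E0 u; have : 0 <= K * (v - u) by apply: mulr_ge0; lra.
  nra.
suff h : E b * (q b + eps / K) <= E a * (q a + eps / K).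
  have Ea : E a = 1 by rewrite /E subrr mulr0 oppr0 expR0.
  have : q b + eps / K <= (q a + eps / K) * expR (K * (b - a)).
    rewrite -(ler_pM2l (E0 b)); apply: le_trans h _.
    rewrite Ea mul1r mulrCA -expRD (_ : - _ + _ = 0) ?expR0 ?mulr1//; ring.
  have : 0 <= eps / K by rewrite divr_ge0// ltW.
  by lra.
apply: (@absc_straddle_le _ a b (fun t => E t * (q t + eps / K))) => //.
  apply: absc_mul => //; apply: absc_add => //; exact: absc_cst.
move: hae; apply: ae_sub => s hs /andP[as_ sb] e e0.
have {hs} hs := hs ltac:(by rewrite as_ sb).
have [d d0 hd] := hs _ (divr_gt0 e0 (ltr0Sn _ 1)).
have e2 : 0 < e / 2 / K by rewrite !divr_gt0.
have [d' d'0 hd'] := absc_contw acq as_ sb e2.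
exists (Num.min d d') => [|u v au us sv vb]; first by rewrite lt_min d0.
rewrite le_min => /andP[vu vu'].
have h1 := hd u v au us sv vb vu.
have := hd' u au ltac:(lra) ltac:(rewrite ler_norml; lra).
rewrite ler_norml => /andP[h2 _].
have {h2} h2 : K * (q s - q u) <= e / 2.
  have : K * (e / 2 / K) = e / 2 by field; rewrite gt_eqF.
  have : K * (q s - q u) <= K * (e / 2 / K) by rewrite ler_pM2l//; lra.
  by lra.
have h3 := Eu u v ltac:(lra).
have q'0 : 0 <= q u + eps / K by rewrite addr_ge0 ?divr_ge0 ?q0 ?(ltW K0)//; lra.
have Kq : K * (q u + eps / K) = K * q u + eps by field; rewrite gt_eqF.
have h4 : E v * (1 + K * (v - u)) * (q u + eps / K) <= E u * (q u + eps / K) by apply: ler_wpM2r.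
have -> : E v * (q v + eps / K) - E u * (q u + eps / K) =
  E v * (q v - q u) + E v * (q u + eps / K) - E u * (q u + eps / K) by ring.
have h5 : E v * (q v - q u) <= E v * ((K * q s + eps + e / 2) * (v - u)) by rewrite ler_pM2l.
have vu0 : 0 <= v - u by lra.
have h6 : E v * (v - u) * (K * (q s - q u) + e / 2) <= e * (v - u).
  apply: (@le_trans _ _ (E v * (v - u) * e)).
    by apply: ler_wpM2l; [apply: mulr_ge0 => //; exact: ltW|lra].
  rewrite mulrAC mulrC [e * _]mulrC ler_wpM2l// ger_pMl// E1//; lra.
have h7 : E v * (1 + K * (v - u)) * (q u + eps / K) =
  E v * (q u + eps / K) + E v * (v - u) * (K * q u + eps) by rewrite -Kq; ring.
lra.
Qed.

Lemma gronwall_norm (V : normedModType R) (z : R -> V) a b K eps :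
  a <= b -> 0 < K -> 0 <= eps -> absc a b z ->
  {ae (@lebesgue_measure R), forall s, a <= s <= b ->
    exists2 w, derivw a b z s w & `|w| <= K * `|z s| + eps} ->
  `|z b| <= (`|z a| + eps / K) * expR (K * (b - a)).
Proof.
move=> ab K0 eps0 acz hae.
apply: (@gronwall (fun t => `|z t|)) => //; first exact: absc_norm.
move: hae; apply: ae_sub => s hs /hs[w hw wK] e e0.
have [d d0 hd] := derivw_norm_straddle hw e0; exists d => // u v au us sv vb vu.
apply: le_trans (lerB_dist _ _) _.
by apply: le_trans (hd u v au us sv vb vu) _; apply: ler_wpM2r; lra.
Qed.

Lemma gronwall_derivw (V : normedModType R) (z : R -> V) a b K eps :
  a <= b -> 0 < K -> 0 <= eps ->
  (forall s, a <= s -> s <= b -> exists2 w, derivw a b z s w & `|w| <= K * `|z s| + eps) ->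
  `|z b| <= (`|z a| + eps / K) * expR (K * (b - a)).
Proof.
move=> ab K0 eps0 h; apply: gronwall_norm => //; last first.
  by apply: ae_all => s /andP[]; exact: h.
have [M M0 hM] : exists2 M : R, 0 < M & forall s, a <= s -> s <= b -> `|z s| <= M.
  by apply: contw_bounded => // s as_ sb; have [w hw _] := h s as_ sb; exact: derivw_contw hw.
apply: (@derivw_absc _ _ _ _ _ (K * M + eps)) => s as_ sb.
have [w hw wK] := h s as_ sb; exists w => //; apply: le_trans wK _.
by rewrite lerD2r ler_pM2l// hM.
Qed.

End Gronwall.

(** * Matrix norm and primitives *)

Section MatrixNorm.
Context {R : realType} {m n : nat}.
Implicit Types A B : 'M[R]_(m, n).

Lemma mx_norm_le A (e : R) : 0 <= e -> (forall i j, `|A i j| <= e) -> `|A| <= e.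
Proof.
move=> e0 h; rewrite [leLHS]/Num.Def.normr/= mx_normrE (bigmax_le _ e0)//= => -[i j] _.
Qed.

Lemma mx_entry_le A i j : `|A i j| <= `|A|.
Proof.
rewrite [leRHS]/Num.Def.normr/= mx_normrE.
exact: (le_bigmax _ (fun ij : 'I_m * 'I_n => `|A ij.1 ij.2|) (i, j)).
Qed.

Lemma derivw_mx (f : R -> 'M[R]_(m, n)) (a b s : R) (v : 'M[R]_(m, n)) :
  (forall i j, derivw a b (fun t => f t i j) s (v i j)) -> derivw a b f s v.
Proof.
move=> h e e0.
pose d ij := sval (cid2 (h ij.1 ij.2 e e0)).
have dP (ij : 'I_m * 'I_n) : 0 < d ij /\ forall u, a <= u -> u <= b -> `|u - s| <= d ij ->
    `|f u ij.1 ij.2 - f s ij.1 ij.2 - (u - s) *: v ij.1 ij.2| <= e * `|u - s|.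
  by rewrite /d; case: cid2.
exists (\big[Num.min/1]_(ij : 'I_m * 'I_n) d ij).
  by apply: lt_bigmin => // ij _; have [] := dP ij.
move=> u au ub us; apply: mx_norm_le => [|i j]; first by rewrite mulr_ge0// ltW.
rewrite !mxE; have [_] := dP (i, j); apply => //; apply: le_trans us _.
exact: (bigmin_le_cond _ d).
Qed.

Lemma derivw_entry (f : R -> 'M[R]_(m, n)) (a b s : R) (v : 'M[R]_(m, n)) i j :
  derivw a b f s v -> derivw a b (fun t => f t i j) s (v i j).
Proof.
move=> h e e0; have [d d0 hd] := h e e0; exists d => // u au ub us.
apply: le_trans (hd u au ub us); have := mx_entry_le (f u - f s - (u - s) *: v) i j.
by rewrite !mxE.
Qed.

Lemma absc_entry (f : R -> 'M[R]_(m, n)) (a b : R) i j :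
  absc a b f -> absc a b (fun t => f t i j).
Proof.
move=> h; apply: (@absc_dom2 _ _ _ _ a b f f _ 1) (h) (h) => u v _ _ _; rewrite mul1r.
by have := mx_entry_le (f v - f u) i j; rewrite !mxE => h1; apply: le_trans h1 _; rewrite lerDl.
Qed.

Lemma contw_entry (f : R -> 'M[R]_(m, n)) (a b s : R) i j :
  contw a b f s -> contw a b (fun t => f t i j) s.
Proof.
move=> h e e0; have [d d0 hd] := h e e0; exists d => // u au ub us.
apply: le_trans (hd u au ub us); have := mx_entry_le (f u - f s) i j.
by rewrite !mxE.
Qed.

(** Entrywise, the intervals of radius [2 C / 2 ^+ k] around the terms are
   nested, and the limit is the supremum of their left ends. *)
Lemma geometric_limit (u : nat -> 'M[R]_(m, n)) (C : R) :
  (forall k, `|u k.+1 - u k| <= C / 2 ^+ k) ->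
  exists l, forall k, `|u k - l| <= 2 * C / 2 ^+ k.
Proof.
move=> hu.
have C0 : 0 <= C by have := hu 0%N; rewrite expr0 divr1; apply: le_trans.
suff h (v : nat -> R) : (forall k, `|v k.+1 - v k| <= C / 2 ^+ k) ->
    exists l, forall k, `|v k - l| <= 2 * C / 2 ^+ k.
  have /choice [L hL] : forall ij : 'I_m * 'I_n, exists l : R, forall k,
    `|u k ij.1 ij.2 - l| <= 2 * C / 2 ^+ k.
    move=> ij; apply: h => k; apply: le_trans (hu k).
    by have := mx_entry_le (u k.+1 - u k) ij.1 ij.2; rewrite !mxE.
  exists (\matrix_(i, j) L (i, j)) => k; apply: mx_norm_le => [|i j].
    by rewrite divr_ge0// ?mulr_ge0// exprn_ge0.
  by rewrite !mxE; exact: (hL (i, j)).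
move=> hv.
have p0 k : 0 < 2 ^+ k :> R by rewrite exprn_gt0.
pose r k := 2 * C / 2 ^+ k.
have r0 k : 0 <= r k by rewrite divr_ge0// ?mulr_ge0// ltW.
have rS k : r k = r k.+1 + C / 2 ^+ k.
  by rewrite /r exprS; field; rewrite gt_eqF.
have step k j : v k - r k <= v (k + j)%N - r (k + j)%N /\ v (k + j)%N + r (k + j)%N <= v k + r k.
  elim: j => [|j [IH1 IH2]]; first by rewrite addn0.
  by have := hv (k + j)%N; have := rS (k + j)%N; rewrite ler_norml addnS; lra.
have ab j k : v j - r j <= v k + r k.
  have [h1 _] := step j k; have [_ h2] := step k j; have := r0 (k + j)%N.
  by rewrite addnC in h1; lra.
pose S := range (fun k => v k - r k).
have hS : has_sup S.
  by split; [exists (v 0%N - r 0%N), 0%N | exists (v 0%N + r 0%N) => _ [j _ <-]].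
exists (sup S) => k.
have h1 : v k - r k <= sup S by apply: (ub_le_sup hS.2); exists k.
have h2 : sup S <= v k + r k by apply: (ge_sup hS.1) => _ [j _ <-].
by rewrite ler_norml -/(r k); lra.
Qed.

End MatrixNorm.

Section Primitive.
Context {R : realType}.

Definition clamp (a b s : R) : R := Num.min b (Num.max a s).

Lemma clamp_itv (a b s : R) : a <= b -> a <= clamp a b s /\ clamp a b s <= b.
Proof. by move=> ab; rewrite /clamp le_min ge_min lexx ab le_max lexx. Qed.

Lemma clamp_id (a b s : R) : a <= s -> s <= b -> clamp a b s = s.
Proof. by move=> as_ sb; rewrite /clamp max_r// min_r. Qed.

Lemma clamp_lip (a b s t : R) : `|clamp a b s - clamp a b t| <= `|s - t|.
Proof.
have h (x y : R) : x <= y -> `|clamp a b x - clamp a b y| <= `|x - y|.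
  move=> xy; rewrite /clamp (ler0_norm (_ : x - y <= 0)) ?subr_le0//.
  rewrite /Num.min /Num.max; repeat case: ifP; move=> *; rewrite ler_norml; lra.
case: (leP s t) => st; first exact: h.
by rewrite distrC [leRHS]distrC; apply/h/ltW.
Qed.

Lemma contw_clamp (V : normedModType R) (a b : R) (f : R -> V) : a <= b ->
  (forall s, a <= s -> s <= b -> contw a b f s) -> forall s, {for s, continuous (f \o clamp a b)}.
Proof.
move=> ab hf s; apply/cvgrPdist_le => e e0 /=.
have [c1 c2] := clamp_itv s ab.
have [d d0 hd] := hf _ c1 c2 e e0.
apply/nbhs_ballP; exists d => //= t; rewrite /ball /= => st.
have [t1 t2] := clamp_itv t ab; rewrite distrC; apply: hd => //.
by apply: le_trans (clamp_lip _ _ _ _) _; rewrite distrC ltW.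
Qed.

(** Freezing the integrand outside [[a, b]] and integrating from [a - 1] turns
   the endpoints into interior points. *)
Lemma primitive_real (f : R -> R) (a b : R) : a <= b ->
  (forall s, a <= s -> s <= b -> contw a b f s) ->
  exists F : R -> R, forall s, a <= s -> s <= b -> derivw a b F s (f s).
Proof.
move=> ab hf.
pose g := f \o clamp a b.
have cg s : {for s, continuous g} by exact: contw_clamp.
exists (fun x => \int[lebesgue_measure]_(t in `[a - 1, x]) g t)%R => s as_ sb.
have sb1 : s < b + 1 by lra.
have ig : lebesgue_measure.-integrable `[a - 1, b + 1] (EFin \o g).
  apply: continuous_compact_integrable; first exact: segment_compact.
  by apply: continuous_subspaceT => x; exact: cg.
have [df dE] := continuous_FTC1_closed sb1 ig (ltac:(lra) : a - 1 < s) (cg s).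
have -> : f s = g s by rewrite /g /= clamp_id.
by rewrite -dE; exact: derivable_derivw.
Qed.

Lemma primitive_mx m n (f : R -> 'M[R]_(m, n)) (a b : R) (y0 : 'M[R]_(m, n)) : a <= b ->
  (forall s, a <= s -> s <= b -> contw a b f s) ->
  exists F : R -> 'M[R]_(m, n), F a = y0 /\
    forall s, a <= s -> s <= b -> derivw a b F s (f s).
Proof.
move=> ab hf.
have /choice [F hF] : forall ij : 'I_m * 'I_n, exists F : R -> R,
    forall s, a <= s -> s <= b -> derivw a b F s (f s ij.1 ij.2).
  by move=> ij; apply: primitive_real => // s as_ sb; apply: contw_entry; exact: hf.
pose F' s := \matrix_(i, j) F (i, j) s.
exists (fun s => F' s + (y0 - F' a)); split; first by rewrite addrC subrK.
move=> s as_ sb; rewrite -[f s]addr0; apply: derivw_add; last exact: derivw_cst.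
apply: derivw_mx => i j; have := hF (i, j) s as_ sb; congr derivw.
by apply/funext => t; rewrite mxE.
Qed.

Lemma derivw_expR (c a b a0 s : R) :
  derivw a b (fun t => expR (c * (t - a0))) s (c * expR (c * (s - a0))).
Proof.
pose h := fun t : R => expR (c * (t - a0)).
have hd : is_derive s 1 h (c * h s).
  rewrite /h; apply: is_derive_eq.
  by rewrite /GRing.scale /=; ring.
have -> : c * expR (c * (s - a0)) = derive1 h s by rewrite derive1E derive_val.
by apply: derivable_derivw.
Qed.

End Primitive.

(** * Existence for Lipschitz differential equations *)

Section ODE.
Context {R : realType} {m n : nat}.
Let V := 'M[R]_(m, n).
Implicit Types (G : R -> V -> V) (y : R -> V) (a b K : R).

Lemma contw_comp_lip G y a b K s : 0 < K -> a <= s -> s <= b ->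
  (forall v, contw a b (G^~ v) s) ->
  (forall t u v, a <= t -> t <= b -> `|G t u - G t v| <= K * `|u - v|) ->
  contw a b y s -> contw a b (fun t => G t (y t)) s.
Proof.
move=> K0 as_ sb cG lG cy e e0.
have [d d0 hd] := cG (y s) _ (divr_gt0 e0 (ltr0Sn _ 1)).
have e2 : 0 < e / 2 / K by rewrite !divr_gt0.
have [d' d'0 hd'] := cy _ e2.
exists (Num.min d d') => [|u au ub]; first by rewrite lt_min d0.
rewrite le_min => /andP[us us'].
have h1 := hd u au ub us; have h2 := hd' u au ub us'.
have h3 := lG u (y u) (y s) au ub.
have h4 : K * `|y u - y s| <= e / 2 by rewrite mulrC -ler_pdivlMr.
have : `|G u (y u) - G s (y s)| <= `|G u (y u) - G u (y s)| + `|G u (y s) - G s (y s)|.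
  by apply: le_trans (ler_normD _ _); rewrite subrKA.
lra.
Qed.

(** Picard iteration converges geometrically in the norm weighted by
   [expR (2 K (s - a))], so the whole interval is reached at once. *)
Lemma ode_exists G a b K (y0 : V) : a <= b -> 0 < K ->
  (forall v s, a <= s -> s <= b -> contw a b (G^~ v) s) ->
  (forall t u v, a <= t -> t <= b -> `|G t u - G t v| <= K * `|u - v|) ->
  exists y, y a = y0 /\ forall s, a <= s -> s <= b -> derivw a b y s (G s (y s)).
Proof.
move=> ab K0 cG lG.
have /choice [Phi hPhi] : forall y, exists Y : R -> V,
    (forall s, a <= s -> s <= b -> contw a b y s) ->
    Y a = y0 /\ forall s, a <= s -> s <= b -> derivw a b Y s (G s (y s)).
  move=> y; have [cy|ncy] := pselect (forall s, a <= s -> s <= b -> contw a b y s);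
    last by exists y.
  have [|F hF] := @primitive_mx R m n (fun t => G t (y t)) a b y0 ab; last by exists F.
  by move=> s as_ sb; apply: (@contw_comp_lip G y a b K) => //; [move=> v; exact: cG|exact: cy].
pose Y k := iter k Phi (fun=> y0).
have cY k : forall s, a <= s -> s <= b -> contw a b (Y k) s.
  elim: k => [|k IH] s as_ sb.
    by apply: (@derivw_contw _ _ _ _ _ _ 0); exact: derivw_cst.
  by have [_ h] := hPhi _ IH; apply: derivw_contw (h s as_ sb).
have hY k : Y k.+1 a = y0 /\ forall s, a <= s -> s <= b -> derivw a b (Y k.+1) s (G s (Y k s)).
  exact: (hPhi (Y k) (cY k)).
pose E s := expR (2 * K * (s - a)).
have E0 s : 0 < E s by exact: expR_gt0.
have E1 s : a <= s -> 1 <= E s by move=> as_; rewrite -expR0 ler_expR; nra.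
have Eb s : s <= b -> E s <= E b by move=> sb; rewrite ler_expR; nra.
have p0 k : 0 < 2 ^+ k :> R by rewrite exprn_gt0.
have [c c0 hc] : exists2 c : R, 0 < c & forall s, a <= s -> s <= b -> `|Y 1%N s - Y 0%N s| <= c.
  apply: contw_bounded => // s as_ sb; have [_ h] := hY 0%N.
  by apply: derivw_contw (derivw_diff (h s as_ sb) (derivw_cst _ _ _ _)).
have step k : forall s, a <= s -> s <= b -> `|Y k.+1 s - Y k s| <= c / 2 ^+ k * E s.
  elim: k => [|k IH] s as_ sb.
    by rewrite expr0 divr1; apply: le_trans (hc s as_ sb) _; apply: ler_peMr;
      [exact: ltW|exact: E1].
  pose z t := Y k.+2 t - Y k.+1 t.
  have za : z a = 0 by rewrite /z (hY k.+1).1 (hY k).1 subrr.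
  have h : `|z s - z a| <= c / 2 ^+ k.+1 * E s - c / 2 ^+ k.+1 * E a.
    apply: (@mean_value _ _ a s z (fun t => c / 2 ^+ k.+1 * E t)
       (fun t => c / 2 ^+ k.+1 * (2 * K * E t))) => //.
    - move=> t at_ ts; have tb : t <= b by lra.
      exists (G t (Y k.+1 t) - G t (Y k t)).
        by apply: (@derivw_sub _ _ a b) => //; apply: derivw_diff;
          [exact: (hY k.+1).2|exact: (hY k).2].
      apply: le_trans (lG _ _ _ at_ tb) _.
      have -> : c / 2 ^+ k.+1 * (2 * K * E t) = K * (c / 2 ^+ k * E t).
        by rewrite exprS; field; rewrite gt_eqF.
      by rewrite ler_pM2l//; exact: IH.
    - move=> t at_ ts; apply: derivw_scale; exact: derivw_expR.
  rewrite za subr0 in h; apply: le_trans h _; rewrite gerBl.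
  by rewrite mulr_ge0 ?divr_ge0// ltW.
pose C := c * E b.
have C0 : 0 <= C by rewrite mulr_ge0// ltW.
have stepC k s : a <= s -> s <= b -> `|Y k.+1 s - Y k s| <= C / 2 ^+ k.
  move=> as_ sb; apply: le_trans (step k s as_ sb) _.
  by rewrite /C mulrAC ler_pM2r ?invr_gt0// ler_pM2l// Eb.
have /choice [y hy] : forall s, exists l, a <= s -> s <= b ->
    forall k, `|Y k s - l| <= 2 * C / 2 ^+ k.
  move=> s; have [/andP[as_ sb]|n_] := pselect (a <= s <= b).
    by have [l hl] := @geometric_limit R m n (Y^~ s) C (fun k => stepC k s as_ sb); exists l.
  by exists 0 => as_ sb; exfalso; apply: n_; rewrite as_ sb.
have small e : 0 < e -> exists k, 2 * C / 2 ^+ k <= e.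
  move=> e0; have [k hk] : exists k, 2 * C / e <= 2 ^+ k.
    pose N := Num.bound (2 * C / e); exists N.
    have N1 : 2 * C / e < N%:R by apply: archi_boundP; rewrite divr_ge0 ?mulr_ge0// ltW.
    apply: le_trans (ltW N1) _; rewrite -natrX ler_nat.
    exact/ltnW/ltn_expl.
  by exists k; rewrite ler_pdivrMr// [e * _]mulrC -ler_pdivrMr.
have cy s : a <= s -> s <= b -> contw a b y s.
  move=> as_ sb e e0; have e3 : 0 < e / 3 by rewrite divr_gt0.
  have [k hk] := small _ e3; have [d d0 hd] := cY k s as_ sb _ e3.
  exists d => // u au ub us.
  have h1 := hd u au ub us; have h2 := hy u au ub k; have h3 := hy s as_ sb k.
  have : `|y u - y s| <= `|Y k u - y u| + `|Y k u - y s|.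
    by rewrite [`|Y k u - y u|]distrC; apply: le_trans (ler_normD _ _); rewrite subrKA.
  have : `|Y k u - y s| <= `|Y k u - Y k s| + `|Y k s - y s|.
    by apply: le_trans (ler_normD _ _); rewrite subrKA.
  lra.
have [Pa hP] := hPhi y cy.
have Py s : a <= s -> s <= b -> Phi y s = y s.
  move=> as_ sb; apply/eqP; rewrite -subr_eq0 -normr_le0; apply/ler_addgt0Pl => e e0.
  pose e' := e / (K * (b - a) + 1).
  have ba : 0 < K * (b - a) + 1 by (have : 0 <= K * (b - a) by apply: mulr_ge0; lra); lra.
  have e'0 : 0 < e' by rewrite divr_gt0.
  have [k hk] := small _ e'0.
  have h1 : `|(Phi y s - Y k.+1 s) - (Phi y a - Y k.+1 a)| <= K * e' * (s - a).
    apply: (@mean_value_cst _ _ a s (fun t => Phi y t - Y k.+1 t)) => // t at_ ts.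
    have tb : t <= b by lra.
    exists (G t (y t) - G t (Y k t)).
      by apply: (@derivw_sub _ _ a b) => //; apply: derivw_diff; [exact: hP|exact: (hY k).2].
    apply: le_trans (lG _ _ _ at_ tb) _; rewrite ler_pM2l// distrC.
    exact: le_trans (hy t at_ tb k) _.
  rewrite Pa (hY k).1 subrr subr0 in h1.
  have h2 := hy s as_ sb k.+1.
  have h3 : 2 * C / 2 ^+ k.+1 <= e'.
    have -> : 2 * C / 2 ^+ k.+1 = 2 * C / 2 ^+ k / 2 by rewrite exprS; field; rewrite gt_eqF.
    have : 0 <= 2 * C / 2 ^+ k by rewrite divr_ge0 ?mulr_ge0// ltW.
    lra.
  have h4 : K * e' * (s - a) <= K * e' * (b - a) by apply: ler_wpM2l; [rewrite mulr_ge0 ?ltW|lra].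
  have -> : e + 0 = e' * (K * (b - a) + 1) by rewrite addr0 /e' divfK// gt_eqF.
  have : `|Phi y s - y s| <= `|Phi y s - Y k.+1 s| + `|Y k.+1 s - y s|.
    by apply: le_trans (ler_normD _ _); rewrite subrKA.
  lra.
exists (Phi y); split => // s as_ sb; rewrite Py//; exact: hP.
Qed.

Lemma derivw_reflect (y : R -> V) a b s v :
  derivw (- b) (- a) y (- s) v -> derivw a b (fun t => y (- t)) s (- v).
Proof.
move=> h e e0; have [d d0 hd] := h e e0; exists d => // u au ub us.
have := hd (- u) ltac:(lra) ltac:(lra).
rewrite -opprD normrN => /(_ us).
by rewrite scalerN scaleNr.
Qed.

Lemma ode_exists_backward G a b K (y0 : V) : a <= b -> 0 < K ->
  (forall v s, a <= s -> s <= b -> contw a b (G^~ v) s) ->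
  (forall t u v, a <= t -> t <= b -> `|G t u - G t v| <= K * `|u - v|) ->
  exists y, y b = y0 /\ forall s, a <= s -> s <= b -> derivw a b y s (G s (y s)).
Proof.
move=> ab K0 cG lG.
have [||||y [y1 y2]] := @ode_exists (fun s v => - G (- s) v) (- b) (- a) K y0 => //.
- lra.
- move=> v s bs sa e e0; have [d d0 hd] := cG v (- s) ltac:(lra) ltac:(lra) e e0.
  exists d => // u bu ua us; rewrite -opprD normrN; apply: hd; [lra|lra|].
  by rewrite -opprD normrN.
- by move=> t u v bt ta; rewrite -opprD normrN; apply: lG; lra.
exists (fun t => y (- t)); split => // s as_ sb.
have := y2 (- s) ltac:(lra) ltac:(lra); rewrite opprK => h.
by rewrite -[G _ _]opprK; exact: derivw_reflect.
Qed.

End ODE.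

(** * Taylor estimates in coordinates *)

Section Taylor.
Context {R : realType} {U : normedModType R} {I : finType}.
Variable c : I -> U -> R.
Hypothesis cZ : forall k (t : R) v, c k (t *: v) = t * c k v.
Hypothesis c_le : forall k v, `|c k v| <= `|v|.
Implicit Types (f : U -> R) (g : I -> U -> R) (z d : U).

(** Frechet differentiability at [z], the derivative being given by its values
   [a k] in the directions dual to the coordinates [c k]. *)
Definition frechet_coord f (z : U) (a : I -> R) : Prop :=
  forall e : R, 0 < e -> exists2 r : R, 0 < r &
    forall h, `|h| <= r -> `|f (z + h) - f z - \sum_k c k h * a k| <= e * `|h|.

Lemma sum_coord_le (h : U) (a : I -> R) (M : R) : (forall k, `|a k| <= M) ->
  `|\sum_k c k h * a k| <= #|I|%:R * M * `|h|.
Proof.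
move=> hM; apply: le_trans (ler_norm_sum _ _ _) _.
apply: (@le_trans _ _ (\sum_(k : I) (M * `|h|))).
  by apply: ler_sum => k _; rewrite normrM mulrC; apply: ler_pM.
by rewrite sumr_const -mulrA mulr_natl.
Qed.

Lemma derivw_segment f (a : I -> R) z d (th : R) :
  frechet_coord f (z + th *: d) a ->
  derivw 0 1 (fun t => f (z + t *: d)) th (\sum_k c k d * a k).
Proof.
move=> h e e0.
have d1 : 0 < `|d| + 1 by have := normr_ge0 d; lra.
have [r r0 hr] := h _ (divr_gt0 e0 d1).
exists (r / (`|d| + 1)) => [|u _ _ us]; first by rewrite divr_gt0.
have ud : `|(u - th) *: d| <= `|u - th| * (`|d| + 1).
  by rewrite normrZ ler_wpM2l// lerDl.
have := hr ((u - th) *: d).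
have -> : z + th *: d + (u - th) *: d = z + u *: d.
  by rewrite -addrA -scalerDl [th + _]addrC subrK.
have -> : \sum_k c k ((u - th) *: d) * a k = (u - th) *: \sum_k c k d * a k.
  by rewrite scaler_sumr; apply: eq_bigr => k _; rewrite cZ /GRing.scale /= mulrA.
move=> hh; apply: le_trans (hh _) _.
  by apply: le_trans ud _; rewrite -ler_pdivlMr.
have -> : e * `|u - th| = e / (`|d| + 1) * (`|u - th| * (`|d| + 1)).
  by field; rewrite gt_eqF.
by rewrite ler_wpM2l// ltW// divr_gt0.
Qed.

(** The reference slopes [A] are arbitrary: with [A = 0] this is a Lipschitz
   estimate, with the derivatives at [z] a first order Taylor estimate. *)
Lemma taylor1 f g (A : I -> R) z d (M : R) :
  (forall th : R, 0 <= th -> th <= 1 -> frechet_coord f (z + th *: d) (g^~ (z + th *: d))) ->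
  (forall th : R, 0 <= th -> th <= 1 -> forall k, `|g k (z + th *: d) - A k| <= M) ->
  `|f (z + d) - f z - \sum_k c k d * A k| <= #|I|%:R * M * `|d|.
Proof.
move=> hf hg.
pose S := \sum_k c k d * A k.
pose phi t := f (z + t *: d) - t *: S.
have : `|phi 1 - phi 0| <= #|I|%:R * M * `|d| * (1 - 0).
  apply: mean_value_cst => // th th0 th1.
  exists (\sum_k c k d * g k (z + th *: d) - S).
    by apply: derivw_diff; [apply: derivw_segment; exact: hf | exact: derivw_line].
  rewrite /S -sumrB; under eq_bigr do rewrite -mulrBr.
  by apply: sum_coord_le => k; exact: hg.
by rewrite /phi scale1r !scale0r addr0 !subr0 mulr1 scale1r addrAC.
Qed.

(** After subtraction of the quadratic model, the derivative along the segment
   is the first order remainder of the gradient, to which [taylor1] applies. *)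
Lemma taylor2 f g (h : I -> I -> U -> R) z d (M : R) :
  (forall th : R, 0 <= th -> th <= 1 -> frechet_coord f (z + th *: d) (g^~ (z + th *: d))) ->
  (forall k (th : R), 0 <= th -> th <= 1 ->
     frechet_coord (g k) (z + th *: d) ((h k)^~ (z + th *: d))) ->
  (forall th : R, 0 <= th -> th <= 1 -> forall k l, `|h k l (z + th *: d) - h k l z| <= M) ->
  `|f (z + d) - f z - \sum_k c k d * g k z
     - 2^-1 * \sum_k c k d * \sum_l c l d * h k l z| <= #|I|%:R ^+ 2 * M * `|d| ^+ 2.
Proof.
move=> hf hg hh.
have M0 : 0 <= #|I|%:R * M.
  case: (pickP (mem I)) => [k _|e].
    have := hh 0 (lexx _) ler01 k k; rewrite scale0r addr0 subrr normr0 => M0.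
    by rewrite mulr_ge0.
  by rewrite (eq_card0 e) mul0r.
pose S := \sum_k c k d * g k z.
pose Q := \sum_k c k d * \sum_l c l d * h k l z.
pose phi t := f (z + t *: d) - t *: S - t * t * (2^-1 * Q).
have : `|phi 1 - phi 0| <= #|I|%:R ^+ 2 * M * `|d| ^+ 2 * (1 - 0).
  apply: mean_value_cst => // th th0 th1.
  exists (\sum_k c k d * g k (z + th *: d) - S - ((1 * th + th * 1) * (2^-1 * Q) + th * th * 0)).
    apply: derivw_diff; first by apply: derivw_diff; [apply: derivw_segment;
      exact: hf | exact: derivw_line].
    apply: derivw_mul; last exact: derivw_cst.
    have Did : derivw 0 1 (fun t : R => t) th 1.
      by have := @derivw_line R R^o 0 1 1 th; congr derivw; apply/funext => t;
        rewrite /GRing.scale /= mulr1.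
    exact: (derivw_mul Did Did).
  have -> : \sum_k c k d * g k (z + th *: d) - S - ((1 * th + th * 1) * (2^-1 * Q) + th * th * 0)
    = \sum_k c k d * (g k (z + th *: d) - g k z - \sum_l c l (th *: d) * h k l z).
    have -> : (1 * th + th * 1) * (2^-1 * Q) + th * th * 0 = th * Q by field.
    rewrite /S /Q mulr_sumr -!sumrB; apply: eq_bigr => k _.
    rewrite !mulrBr; congr (_ - _ - _); rewrite mulrCA; congr (_ * _).
    by rewrite mulr_sumr; apply: eq_bigr => l _; rewrite cZ mulrA.
  apply: le_trans (@sum_coord_le d _ (#|I|%:R * M * `|d|) _) _; last first.
    by rewrite le_eqVlt; apply/orP; left; apply/eqP; ring.
  move=> k; apply: le_trans (@taylor1 (g k) (h k) ((h k)^~ z) z (th *: d) M _ _) _.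
  - move=> t t0 t1; rewrite scalerA; apply: hg; first exact: mulr_ge0.
    exact: mulr_ile1.
  - move=> t t0 t1 l; rewrite scalerA; apply: hh; first exact: mulr_ge0.
    exact: mulr_ile1.
  - by rewrite ler_wpM2l// normrZ ger0_norm// ler_piMl.
by rewrite /phi !scale1r !scale0r addr0 !mul0r !mul1r !subr0 mulr1 [X in X <= _ -> _](_ : _ = `|f
  (z + d) - f z - S - 2^-1 * Q|)//; congr (`|_|); ring.
Qed.

End Taylor.

Section FiniteUniform.
Context {R : realType}.

Lemma fin_uniform (I : finType) (P : I -> R -> R -> Prop) :
  (forall i r C r' C', 0 < r' -> r' <= r -> C <= C' -> P i r C -> P i r' C') ->
  (forall i, exists r C : R, [/\ 0 < r, 0 < C & P i r C]) ->
  exists r C : R, [/\ 0 < r, 0 < C & forall i, P i r C].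
Proof.
move=> mono h.
suff [r [C [r0 C0 hP]]] : exists r C : R, [/\ 0 < r, 0 < C & forall i, i \in enum I -> P i r C].
  by exists r, C; split => // i; apply: hP; rewrite mem_enum.
elim: (enum I) => [|i s [r [C [r0 C0 IH]]]]; first by exists 1, 1; split.
have [r' [C' [r'0 C'0 hi]]] := h i.
exists (Num.min r r'), (C + C'); split; [by rewrite lt_min r0|lra|].
have m0 : 0 < Num.min r r' by rewrite lt_min r0.
move=> j; rewrite inE => /orP[/eqP->|/IH hj].
  by apply: mono hi => //; [rewrite ge_min lexx orbT|lra].
by apply: mono hj => //; [rewrite ge_min lexx|lra].
Qed.

End FiniteUniform.

(** * Partial derivatives of the Hamiltonian on phase space *)

Section PhaseSpace.
Context {R : realType} {n : nat}.
Notation U := ('rV[R]_n * 'rV[R]_n)%type.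
Notation I := ('I_n + 'I_n)%type.

(** Positions and costates are indexed by the two summands of ['I_n + 'I_n], so
   that the four Hessian blocks are values of one family [partial2]. *)
Definition coordU (k : I) (z : U) : R :=
  match k with inl i => z.1 0 i | inr i => z.2 0 i end.

Definition basisU (k : I) : U :=
  match k with inl i => (delta_mx 0 i, 0) | inr i => (0, delta_mx 0 i) end.

Definition partial1 (f : U -> R) (k : I) (z : U) : R := 'D_(basisU k) f z.

Definition partial2 (f : U -> R) (k l : I) (z : U) : R := partial1 (partial1 f k) l z.

Lemma coordUZ k (t : R) v : coordU k (t *: v) = t * coordU k v.
Proof. by case: k => i /=; rewrite mxE. Qed.

Lemma coordUD k u v : coordU k (u + v) = coordU k u + coordU k v.
Proof. by case: k => i /=; rewrite mxE. Qed.

Lemma coordU_le k v : `|coordU k v| <= `|v|.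
Proof.
rewrite prod_normE le_max.
by case: k => i /=; rewrite mx_entry_le ?orbT.
Qed.

Lemma basisU_decomp (z : U) : z = \sum_k coordU k z *: basisU k.
Proof.
rewrite big_sumType /=; case: z => x p /=.
pose in1 (v : 'rV[R]_n) : U := (v, 0); pose in2 (v : 'rV[R]_n) : U := (0, v).
have in1D : {morph in1 : u v / u + v} by move=> u v; rewrite /in1 -[RHS]/(_, 0 + 0) addr0.
have in2D : {morph in2 : u v / u + v} by move=> u v; rewrite /in2 -[RHS]/(0 + 0, _) addr0.
have h1 : \sum_(i < n) x 0 i *: ((delta_mx 0 i, 0) : U) = (x, 0).
  rewrite [in RHS](row_sum_delta x) -[RHS]/(in1 _) (big_morph in1 in1D (erefl _)).
  by apply: eq_bigr => i _; rewrite /in1 -[LHS]/(_, _ *: 0) scaler0.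
have h2 : \sum_(i < n) p 0 i *: ((0, delta_mx 0 i) : U) = (0, p).
  rewrite [in RHS](row_sum_delta p) -[RHS]/(in2 _) (big_morph in2 in2D (erefl _)).
  by apply: eq_bigr => i _; rewrite /in2 -[LHS]/(_ *: 0, _) scaler0.
by rewrite h1 h2 -[RHS]/(x + 0, 0 + p) addr0 add0r.
Qed.

Lemma differentiable_frechet_coord (f : U -> R) z : differentiable f z ->
  frechet_coord coordU f z (fun k => partial1 f k z).
Proof.
move=> df e e0; have /eqaddoP /(_ e e0) /nbhs_ballP[r /= r0 hr] := diff_locally df.
exists (r / 2) => [|h hr2]; first by rewrite divr_gt0.
have := hr h; rewrite -ball_normE /= sub0r normrN => hh.
have {hh} : `|f (h + z) - (f z + 'd f z h)| <= e * `|h| by apply: hh; lra.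
rewrite [h + z]addrC opprD addrA; congr (`|_ - _| <= _).
rewrite [in LHS](basisU_decomp h) linear_sum; apply: eq_bigr => k _.
by rewrite linearZ /= /partial1 deriveE.
Qed.

Lemma derive_partial1 (g : U -> R) y p (v : 'rV[R]_n) :
  'D_v (fun x => g (x, p)) y = 'D_((v, 0)) g (y, p).
Proof.
have E : (fun t : R => t^-1 *: (((fun x => g (x, p)) \o shift y) (t *: v) - g (y, p))) =
  (fun t : R => t^-1 *: ((g \o shift (y, p)) (t *: (v, 0)) - g (y, p))).
  apply/funext => t /=; congr (_ *: (g _ - _)).
  by rewrite -[RHS]/(_ + _, _ *: 0 + _) scaler0 add0r.
by rewrite /derive E.
Qed.

Lemma derive_partial2 (g : U -> R) y p (v : 'rV[R]_n) :
  'D_v (fun q => g (y, q)) p = 'D_((0, v)) g (y, p).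
Proof.
have E : (fun t : R => t^-1 *: (((fun q => g (y, q)) \o shift p) (t *: v) - g (y, p))) =
  (fun t : R => t^-1 *: ((g \o shift (y, p)) (t *: (0, v)) - g (y, p))).
  apply/funext => t /=; congr (_ *: (g _ - _)).
  by rewrite -[RHS]/(_ *: 0 + _, _ + _) scaler0 add0r.
by rewrite /derive E.
Qed.

(** The Jacobian is defined through the differential, so that differentiability
   of the whole row must first be recovered from that of its entries. *)
Lemma jac_entry (G : 'rV[R]_n -> 'rV[R]_n) x i j :
  (forall k, differentiable (fun y => G y 0 k) x) ->
  jac G x i j = 'D_(delta_mx 0 j) (fun y => G y 0 i) x.
Proof.
move=> dG.
have GE : G = fun y => \sum_(k < n) G y 0 k *: delta_mx 0 k.
  by apply/funext => y; exact: row_sum_delta.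
have dGx : differentiable G x.
  rewrite GE (_ : (fun y => _) = \sum_(k < n) (fun y => G y 0 k *: (delta_mx 0 k : 'rV[R]_n))).
    by apply: differentiable_sum => k; exact: differentiableZl.
  by apply/funext => y; rewrite fct_sumE.
rewrite /jac mxE /jacobian /lin1_mx mxE -deriveE// derive_mx; first by rewrite mxE.
exact: diff_derivable.
Qed.

End PhaseSpace.

Section HamiltonianSmooth.
Context {R : realType} {n : nat}.
Notation U := ('rV[R]_n * 'rV[R]_n)%type.
Notation I := ('I_n + 'I_n)%type.
Variable F : 'rV[R]_n -> set 'rV[R]_n.
Let f (z : U) := hamiltonian F z.1 z.2.
Hypothesis Hreg : C21loc_on [set z : U | z.2 != 0] f.

Lemma ham_frechet z : z.2 != 0 -> frechet_coord coordU f z (fun k => partial1 f k z).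
Proof. by move=> z2; apply: differentiable_frechet_coord; exact: (Hreg.1.1 z z2).1. Qed.

Lemma partial1_differentiable k z : z.2 != 0 -> differentiable (partial1 f k) z.
Proof. by move=> z2; exact: (Hreg.1.2 (basisU k) z z2).1. Qed.

Lemma partial1_frechet k z : z.2 != 0 ->
  frechet_coord coordU (partial1 f k) z (fun l => partial2 f k l z).
Proof. by move=> z2; apply: differentiable_frechet_coord; exact: partial1_differentiable. Qed.

Lemma differentiable_slice1 (g : U -> R) y p :
  differentiable g (y, p) -> differentiable (fun x => g (x, p)) y.
Proof.
move=> dg; apply: (@differentiable_comp _ _ _ _ (fun x => (x, p)) g) => //.
Qed.

Lemma differentiable_slice2 (g : U -> R) y p :
  differentiable g (y, p) -> differentiable (fun q => g (y, q)) p.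
Proof.
move=> dg; apply: (@differentiable_comp _ _ _ _ (fun q => (y, q)) g) => //.
Qed.

Lemma grad_x_entry y p i : grad (fun y' => hamiltonian F y' p) y 0 i = partial1 f (inl i) (y, p).
Proof. by rewrite mxE; exact: (@derive_partial1 _ _ f). Qed.

Lemma grad_p_entry y p i : grad (fun q => hamiltonian F y q) p 0 i = partial1 f (inr i) (y, p).
Proof. by rewrite mxE; exact: (@derive_partial2 _ _ f). Qed.

Lemma Hxx_entry y p i j : p != 0 -> Hxx F y p i j = partial2 f (inl i) (inl j) (y, p).
Proof.
move=> p0; rewrite /Hxx jac_entry.
  under eq_fun do rewrite grad_x_entry.
  by rewrite (@derive_partial1 _ _ (partial1 f (inl i))).
move=> k; under eq_fun do rewrite grad_x_entry.
by apply: (@differentiable_slice1 (partial1 f (inl k))); exact: partial1_differentiable.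
Qed.

Lemma Hxp_entry y p i j : p != 0 -> Hxp F y p i j = partial2 f (inr i) (inl j) (y, p).
Proof.
move=> p0; rewrite /Hxp jac_entry.
  under eq_fun do rewrite grad_p_entry.
  by rewrite (@derive_partial1 _ _ (partial1 f (inr i))).
move=> k; under eq_fun do rewrite grad_p_entry.
by apply: (@differentiable_slice1 (partial1 f (inr k))); exact: partial1_differentiable.
Qed.

Lemma Hpx_entry y p i j : p != 0 -> Hpx F y p i j = partial2 f (inl i) (inr j) (y, p).
Proof.
move=> p0; rewrite /Hpx jac_entry.
  under eq_fun do rewrite grad_x_entry.
  by rewrite (@derive_partial2 _ _ (partial1 f (inl i))).
move=> k; under eq_fun do rewrite grad_x_entry.
by apply: (@differentiable_slice2 (partial1 f (inl k))); exact: partial1_differentiable.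
Qed.

Lemma Hpp_entry y p i j : p != 0 -> Hpp F y p i j = partial2 f (inr i) (inr j) (y, p).
Proof.
move=> p0; rewrite /Hpp jac_entry.
  under eq_fun do rewrite grad_p_entry.
  by rewrite (@derive_partial2 _ _ (partial1 f (inr i))).
move=> k; under eq_fun do rewrite grad_p_entry.
by apply: (@differentiable_slice2 (partial1 f (inr k))); exact: partial1_differentiable.
Qed.

(** A single constant bounds the derivatives and serves as a Lipschitz
   constant, so that it may be increased freely when balls are merged. *)
Definition tube_bounds (z0 : U) (r C : R) : Prop :=
  forall k l z, `|z - z0| <= r ->
    [/\ z.2 != 0, `|partial1 f k z| <= C, `|partial2 f k l z| <= C &
        forall z', `|z' - z0| <= r ->
          `|partial2 f k l z - partial2 f k l z'| <= C * `|z - z'|].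

Lemma tube_local (z0 : U) : z0.2 != 0 ->
  exists r C : R, [/\ 0 < r, 0 < C & tube_bounds z0 r C].
Proof.
move=> z02.
have [r [C [r0 C0 h]]] : exists r C : R, [/\ 0 < r, 0 < C & forall kl : I * I,
   forall z, `|z - z0| <= r ->
    [/\ z.2 != 0, `|partial1 f kl.1 z| <= C, `|partial2 f kl.1 kl.2 z| <= C &
        forall z', `|z' - z0| <= r ->
          `|partial2 f kl.1 kl.2 z - partial2 f kl.1 kl.2 z'| <= C * `|z - z'|]].
  apply: (@fin_uniform R (I * I)%type (fun kl r C => forall z, `|z - z0| <= r ->
    [/\ z.2 != 0, `|partial1 f kl.1 z| <= C, `|partial2 f kl.1 kl.2 z| <= C &
        forall z', `|z' - z0| <= r ->
          `|partial2 f kl.1 kl.2 z - partial2 f kl.1 kl.2 z'| <= C * `|z - z'|])).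
    move=> kl r C r' C' r'0 rr CC h z zr.
    have [h1 h2 h3 h4] := h z (le_trans zr rr); split => //; [lra|lra|].
    move=> z' z'r; apply: le_trans (h4 z' (le_trans z'r rr)) _.
    by rewrite ler_wpM2r.
  move=> [k l] /=.
  have z2r : 0 < `|z0.2| / 2 by rewrite divr_gt0 ?normr_gt0.
  have [_ c1] := Hreg.1.1 z0 z02.
  have /cvgrPdist_le /(_ 1 ltr01) /nbhs_ballP [r1 /= r10 h1] := c1 (basisU k).
  have [K nK] := Hreg.2 (basisU k) (basisU l) z0 z02.
  move=> [M0 [Mr hM]].
  have {hM} := hM (`|M0| + 1) ltac:(by have := ler_norm M0; lra).
  have M1 : 0 < `|M0| + 1 by have := normr_ge0 M0; lra.
  move: (`|M0| + 1) M1 => {M0 Mr} M M0 hM.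
  have /nbhs_ballP [r2 /= r20 h2] := nK.
  pose r := Num.min (`|z0.2| / 2) (Num.min (r1 / 2) (r2 / 2)).
  have r0 : 0 < r by rewrite /r !lt_min z2r !divr_gt0.
  have [ra [rb rc]] : r <= `|z0.2| / 2 /\ r <= r1 / 2 /\ r <= r2 / 2.
    by rewrite /r; have := lexx r; rewrite {2}/r !le_min => /and3P[].
  pose C := `|partial1 f k z0| + 1 + M + (`|partial2 f k l z0| + M * r).
  have g1 := normr_ge0 (partial1 f k z0); have g2 := normr_ge0 (partial2 f k l z0).
  have g3 : 0 <= M * r by rewrite mulr_ge0// ltW.
  exists r, C; split => //; first by rewrite /C; lra.
  have z2n z : `|z - z0| <= r -> z.2 != 0.
    move=> zr; rewrite -normr_gt0.
    have : `|z.2 - z0.2| <= `|z - z0| by rewrite prod_normE le_max lexx orbT.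
    have : `|z0.2| <= `|z0.2 - z.2| + `|z.2|.
      by apply: le_trans (ler_normD _ _); rewrite subrK.
    by rewrite distrC; move: z2r; lra.
  have Kz z : `|z - z0| <= r -> (K `&` [set z : U | z.2 != 0]) z.
    move=> zr; split; last exact: z2n.
    by apply: h2; rewrite -ball_normE /= distrC; lra.
  have lip z z' : `|z - z0| <= r -> `|z' - z0| <= r ->
      `|partial2 f k l z - partial2 f k l z'| <= M * `|z - z'|.
    by move=> zr z'r; apply: (hM (z, z')); split; exact: Kz.
  move=> z zr; split.
  - exact: z2n.
  - have := h1 z; rewrite -ball_normE /= distrC => /(_ ltac:(lra)).
    have : `|partial1 f k z| <= `|partial1 f k z0| + `|partial1 f k z0 - partial1 f k z|.
      by rewrite distrC -[leLHS](subrKC (`|partial1 f k z0|)) lerD2l lerB_dist.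
    by rewrite /partial1 /C; lra.
  - have k1 : `|partial2 f k l z - partial2 f k l z0| <= M * `|z - z0|.
      by apply: lip => //; rewrite subrr normr0 ltW.
    have k2 : `|partial2 f k l z| <= `|partial2 f k l z0| + `|partial2 f k l z - partial2 f k l z0|.
      by rewrite -[leLHS](subrKC (`|partial2 f k l z0|)) lerD2l lerB_dist.
    have k3 : M * `|z - z0| <= M * r by rewrite ler_pM2l.
    apply: le_trans (le_trans k2 (lerD (lexx _) (le_trans k1 k3))) _.
    by rewrite /C lerDr !addr_ge0// ltW.
  - move=> z' z'r; apply: le_trans (lip z z' zr z'r) _.
    by rewrite ler_wpM2r// /C; lra.
by exists r, C; split => // k l; exact: (h (k, l)).
Qed.

Lemma tube_shrink z0 z1 r C r' C' : C <= C' -> `|z1 - z0| + r' <= r ->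
  tube_bounds z0 r C -> tube_bounds z1 r' C'.
Proof.
move=> CC zz h k l z zr.
have sub w : `|w - z1| <= r' -> `|w - z0| <= r.
  by move=> wr; have := ler_normD (w - z1) (z1 - z0); rewrite subrKA; lra.
have [h1 h2 h3 h4] := h k l z (sub z zr); split => //; [lra|lra|].
move=> z' /sub z'r; apply: le_trans (h4 z' z'r) _.
by rewrite ler_wpM2r.
Qed.

(** Uniformity along the compact arc, by Cousin's principle rather than by
   extraction of a finite subcover. *)
Lemma tube_uniform (zb : R -> U) a b : a <= b ->
  (forall s, a <= s -> s <= b -> contw a b zb s) ->
  (forall s, a <= s -> s <= b -> (zb s).2 != 0) ->
  exists r C : R, [/\ 0 < r, 0 < C & forall s, a <= s -> s <= b -> tube_bounds (zb s) r C].
Proof.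
move=> ab czb zb0.
apply: (@cousin _ (fun u v => exists r C : R, [/\ 0 < r, 0 < C &
   forall s, u <= s -> s <= v -> tube_bounds (zb s) r C])) => //.
- move=> u v w _ uv vw _ [r [C [r0 C0 h]]] [r' [C' [r'0 C'0 h']]].
  exists (Num.min r r'), (C + C'); split; [by rewrite lt_min r0|lra|].
  move=> s us sw; case: (leP s v) => sv.
    by apply: tube_shrink (h s us sv); [lra|rewrite subrr normr0 add0r ge_min lexx].
  by apply: tube_shrink (h' s (ltW sv) sw); [lra|rewrite subrr normr0 add0r ge_min lexx orbT].
- move=> s as_ sb; have [r [C [r0 C0 h]]] := tube_local (zb0 s as_ sb).
  have r2 : 0 < r / 2 by rewrite divr_gt0.
  have [d d0 hd] := czb s as_ sb _ r2; exists d => // u v au us sv vb vu.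
  exists (r / 2), C; split => // t ut tv; apply: tube_shrink h => //.
  have : `|zb t - zb s| <= r / 2 by apply: hd; [lra|lra|rewrite ler_norml; lra].
  lra.
Qed.

End HamiltonianSmooth.

(** * Euclidean norm, subgradients and maximizing velocities *)

Section Dotp.
Context {R : realType} {n : nat}.
Implicit Types u v w : 'rV[R]_n.

Lemma dotpC u v : dotp u v = dotp v u.
Proof. by apply: eq_bigr => i _; rewrite mulrC. Qed.

Lemma dotpDl u v w : dotp (u + v) w = dotp u w + dotp v w.
Proof. by rewrite /dotp -big_split /=; apply: eq_bigr => i _; rewrite mxE mulrDl. Qed.

Lemma dotpNl u w : dotp (- u) w = - dotp u w.
Proof. by rewrite /dotp -sumrN; apply: eq_bigr => i _; rewrite mxE mulNr. Qed.

Lemma dotpBl u v w : dotp (u - v) w = dotp u w - dotp v w.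
Proof. by rewrite dotpDl dotpNl. Qed.

Lemma dotpZl t u w : dotp (t *: u) w = t * dotp u w.
Proof. by rewrite /dotp mulr_sumr; apply: eq_bigr => i _; rewrite mxE mulrA. Qed.

Lemma dotpDr u v w : dotp w (u + v) = dotp w u + dotp w v.
Proof. by rewrite ![dotp w _]dotpC dotpDl. Qed.

Lemma dotpNr u w : dotp w (- u) = - dotp w u.
Proof. by rewrite ![dotp w _]dotpC dotpNl. Qed.

Lemma dotpBr u v w : dotp w (u - v) = dotp w u - dotp w v.
Proof. by rewrite dotpDr dotpNr. Qed.

Lemma dotpZr t u w : dotp w (t *: u) = t * dotp w u.
Proof. by rewrite ![dotp w _]dotpC dotpZl. Qed.

Lemma dotp0r u : dotp u 0 = 0.
Proof. by rewrite -(scale0r 0) dotpZr mul0r. Qed.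

Lemma dotp_delta u i : dotp u (delta_mx 0 i) = u 0 i.
Proof.
rewrite /dotp (bigD1 i)//= mxE !eqxx mulr1 big1 ?addr0// => j ji.
by rewrite mxE (negbTE ji) mulr0.
Qed.

Lemma dotp_le u v : `|dotp u v| <= n%:R * `|u| * `|v|.
Proof.
apply: le_trans (ler_norm_sum _ _ _) _.
apply: (@le_trans _ _ (\sum_(i < n) (`|u| * `|v|))).
  by apply: ler_sum => i _; rewrite normrM; apply: ler_pM => //; exact: mx_entry_le.
by rewrite sumr_const card_ord -mulrA mulr_natl.
Qed.

Lemma dotp_ge0 u : 0 <= dotp u u.
Proof. by apply: sumr_ge0 => i _; rewrite -expr2 sqr_ge0. Qed.

Lemma enorm_ge0 u : 0 <= enorm u.
Proof. exact: sqrtr_ge0. Qed.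

Lemma enorm_sqr u : enorm u ^+ 2 = dotp u u.
Proof. by rewrite sqr_sqrtr// dotp_ge0. Qed.

Lemma enorm_le u : enorm u <= n%:R * `|u|.
Proof.
have h : 0 <= n%:R * `|u| by rewrite mulr_ge0.
rewrite -(ler_pXn2r (_ : (0 < 2)%N)) ?nnegrE ?enorm_ge0// enorm_sqr.
apply: le_trans (ler_norm _) _; apply: le_trans (dotp_le u u) _.
rewrite expr2 !mulrA ler_wpM2r// [leRHS]mulrAC ler_wpM2r//.
by rewrite -natrM ler_nat; case: n => // k; rewrite leq_pmulr.
Qed.

Lemma norm_le_enorm u : `|u| <= enorm u.
Proof.
apply: mx_norm_le => [|i j]; first exact: enorm_ge0.
rewrite ord1 -(ler_pXn2r (_ : (0 < 2)%N)) ?nnegrE ?enorm_ge0// enorm_sqr real_normK ?num_real//.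
rewrite /dotp (bigD1 j)//= -expr2 lerDl.
by apply: sumr_ge0 => k _; rewrite -expr2 sqr_ge0.
Qed.

Lemma enormZ (t : R) u : 0 <= t -> enorm (t *: u) = t * enorm u.
Proof.
move=> t0; rewrite /enorm dotpZl dotpZr mulrA -expr2 sqrtrM ?sqr_ge0//.
by rewrite sqrtr_sqr ger0_norm.
Qed.

Lemma enorm_eq0 u : (enorm u == 0) = (u == 0).
Proof.
apply/eqP/eqP => [h|->]; last by rewrite /enorm dotp0r sqrtr0.
by apply/eqP; rewrite -normr_le0 -h norm_le_enorm.
Qed.

(** Unfolds the lower limit; at [h = 0], excluded there, the inequality is
   trivial. *)
Lemma frechet_subdiff_bound (f : 'rV[R]_n -> R) x p : frechet_subdiff f x p ->
  forall e : R, 0 < e -> exists2 r : R, 0 < r &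
    forall h, `|h| <= r -> dotp p h - e * enorm h <= f (x + h) - f x.
Proof.
rewrite /frechet_subdiff /= limf_einfE => hp e e0.
have : ((- e)%:E < ereal_sup [set ereal_inf ((fun y => ((f y - f x - dotp p (y - x)) / enorm (y -
  x))%:E) @` V) | V in x^'])%E.
  by apply: lt_le_trans hp; rewrite lte_fin; lra.
move=> /ereal_sup_gt[_ [W xW <-] hW].
move: xW => /nbhs_ballP[r /= r0 hr].
exists (r / 2) => [|h hh]; first by rewrite divr_gt0.
have [->|h0] := eqVneq h 0.
  by rewrite addr0 dotp0r subrr (eqP (_ : enorm 0 == 0)) ?enorm_eq0// mulr0 subrr.
have Wx : W (x + h).
  apply: hr; last by rewrite -subr_eq0 addrAC subrr add0r.
  by rewrite -ball_normE /= opprD addNKr normrN; lra.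
have : ((- e)%:E < ((f (x + h) - f x - dotp p (x + h - x)) / enorm (x + h - x))%:E)%E.
  by apply: lt_le_trans hW _; apply: ereal_inf_lbound; exists (x + h).
have eh : 0 < enorm h by rewrite lt_neqAle enorm_ge0 eq_sym enorm_eq0 h0.
have -> : x + h - x = h by rewrite addrAC subrr add0r.
by rewrite lte_fin ltr_pdivlMr//; lra.
Qed.

End Dotp.

Lemma div_succ_le {R : realType} (e D : R) : 0 <= e -> 0 <= D -> e / (D + 1) * D <= e.
Proof. by move=> e0 D0; rewrite mulrAC ler_pdivrMr; [nra|lra]. Qed.

Section Directional.
Context {R : realType} {n : nat}.
Notation U := ('rV[R]_n * 'rV[R]_n)%type.
Notation I := ('I_n + 'I_n)%type.

(** Divide the increment along the ray [t *: d] by [t] and let [t] tend to 0. *)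
Lemma directional_ge (f : U -> R) z a (d : U) (beta : R) :
  frechet_coord coordU f z a ->
  (forall e : R, 0 < e -> exists2 r : R, 0 < r &
     forall t, 0 < t -> t <= r -> t * (beta - e) <= f (z + t *: d) - f z) ->
  beta <= \sum_k coordU k d * a k.
Proof.
move=> hf hb; apply/ler_addgt0Pl => e e0.
have d1 : 0 < `|d| + 1 by have := normr_ge0 d; lra.
have e2 : 0 < e / 2 by lra.
have [r r0 hr] := hf _ (divr_gt0 e2 d1).
have [r' r'0 hr'] := hb _ e2.
pose t := Num.min (r / (`|d| + 1)) r'.
have t0 : 0 < t by rewrite lt_min divr_gt0.
have [t1 t2] : t <= r / (`|d| + 1) /\ t <= r' by split; rewrite ge_min lexx ?orbT.
have nt : `|t *: d| = t * `|d| by rewrite normrZ gtr0_norm.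
have td : t * (`|d| + 1) <= r by rewrite -ler_pdivlMr.
have := hr (t *: d) ltac:(rewrite nt; nra).
rewrite nt (_ : \sum_k _ = t * \sum_k coordU k d * a k); last first.
  by rewrite mulr_sumr; apply: eq_bigr => k _; rewrite coordUZ mulrA.
have := hr' t t0 t2; move: (\sum_k _) (f _ - f _) => S D h1 h2.
have h3 : e / 2 / (`|d| + 1) * (t * `|d|) <= t * (e / 2).
  by rewrite mulrCA ler_pM2l// (div_succ_le (ltW e2)).
rewrite ler_norml in h2.
have : t * beta <= t * (e + S) by lra.
by rewrite ler_pM2l.
Qed.

Lemma sum_coord_delta1 i (a : I -> R) :
  \sum_k coordU k ((delta_mx 0 i, 0) : U) * a k = a (inl i).
Proof.
rewrite big_sumType /= [X in _ + X]big1 ?addr0; last by move=> j _; rewrite mxE mul0r.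
rewrite (bigD1 i)//= mxE !eqxx mul1r big1 ?addr0// => j ji.
by rewrite mxE (negbTE ji) mul0r.
Qed.

Lemma sum_coord_delta2 i (a : I -> R) :
  \sum_k coordU k ((0, delta_mx 0 i) : U) * a k = a (inr i).
Proof.
rewrite big_sumType /= [X in X + _]big1 ?add0r; last by move=> j _; rewrite mxE mul0r.
rewrite (bigD1 i)//= mxE !eqxx mul1r big1 ?addr0// => j ji.
by rewrite mxE (negbTE ji) mul0r.
Qed.

Lemma sum_coord_basis k (a : I -> R) : \sum_l coordU l (basisU k) * a l = a k.
Proof. by case: k => i; [exact: sum_coord_delta1|exact: sum_coord_delta2]. Qed.

Lemma sum_coordD u v (a : I -> R) :
  \sum_l coordU l (u + v) * a l = \sum_l coordU l u * a l + \sum_l coordU l v * a l.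
Proof. by rewrite -big_split; apply: eq_bigr => l _; rewrite coordUD mulrDl. Qed.

Lemma sum_coordZ t u (a : I -> R) :
  \sum_l coordU l (t *: u) * a l = t * \sum_l coordU l u * a l.
Proof. by rewrite mulr_sumr; apply: eq_bigr => l _; rewrite coordUZ mulrA. Qed.

(** A linear minorant of the increments, tested in the directions [d] and
   [- d], must be the derivative.  Both Frechet subgradients and maximizing
   velocities provide such minorants. *)
Lemma gradient_p_unique (f : U -> R) x p a (v : 'rV[R]_n) :
  frechet_coord coordU f (x, p) a ->
  (forall e : R, 0 < e -> exists2 r : R, 0 < r &
     forall h, `|h| <= r -> dotp v h - e * enorm h <= f (x, p + h) - f (x, p)) ->
  forall i, a (inr i) = v 0 i.
Proof.
move=> hf hv.
have dir (d : 'rV[R]_n) : dotp v d <= \sum_k coordU k ((0, d) : U) * a k.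
  apply: (directional_ge hf) => e e0.
  have E0 : 0 < enorm d + 1 by have := enorm_ge0 d; lra.
  have d1 : 0 < `|d| + 1 by have := normr_ge0 d; lra.
  have [r r0 hr] := hv _ (divr_gt0 e0 E0).
  exists (r / (`|d| + 1)) => [|t t0 tr]; first by rewrite divr_gt0.
  have := hr (t *: d); rewrite normrZ gtr0_norm// (enormZ _ (ltW t0)) dotpZr => hh.
  have -> : (x, p) + t *: ((0, d) : U) = (x, p + t *: d).
    by rewrite -[LHS]/(x + t *: 0, p + t *: d) scaler0 addr0.
  apply: le_trans (hh _); last first.
    have : t * (`|d| + 1) <= r by rewrite -ler_pdivlMr.
    nra.
  by rewrite mulrBr lerD2l lerN2 mulrCA ler_pM2l// (div_succ_le (ltW e0)) ?enorm_ge0.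
move=> i; apply/eqP; rewrite eq_le; apply/andP; split.
  have := dir (- delta_mx 0 i); rewrite dotpNr dotp_delta.
  have -> : ((0, - delta_mx 0 i) : U) = (-1) *: ((0, delta_mx 0 i) : U).
    by rewrite -[RHS]/(_ *: 0, _ *: _) scaler0 scaleN1r.
  by rewrite sum_coordZ sum_coord_delta2; lra.
by have := dir (delta_mx 0 i); rewrite dotp_delta sum_coord_delta2.
Qed.

Lemma gradient_x_unique (f : U -> R) x p a (v : 'rV[R]_n) :
  frechet_coord coordU f (x, p) a ->
  (forall e : R, 0 < e -> exists2 r : R, 0 < r &
     forall h, `|h| <= r -> dotp v h - e * enorm h <= f (x + h, p) - f (x, p)) ->
  forall i, a (inl i) = v 0 i.
Proof.
move=> hf hv.
have dir (d : 'rV[R]_n) : dotp v d <= \sum_k coordU k ((d, 0) : U) * a k.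
  apply: (directional_ge hf) => e e0.
  have E0 : 0 < enorm d + 1 by have := enorm_ge0 d; lra.
  have d1 : 0 < `|d| + 1 by have := normr_ge0 d; lra.
  have [r r0 hr] := hv _ (divr_gt0 e0 E0).
  exists (r / (`|d| + 1)) => [|t t0 tr]; first by rewrite divr_gt0.
  have := hr (t *: d); rewrite normrZ gtr0_norm// (enormZ _ (ltW t0)) dotpZr => hh.
  have -> : (x, p) + t *: ((d, 0) : U) = (x + t *: d, p).
    by rewrite -[LHS]/(x + t *: d, p + t *: 0) scaler0 addr0.
  apply: le_trans (hh _); last first.
    have : t * (`|d| + 1) <= r by rewrite -ler_pdivlMr.
    nra.
  by rewrite mulrBr lerD2l lerN2 mulrCA ler_pM2l// (div_succ_le (ltW e0)) ?enorm_ge0.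
move=> i; apply/eqP; rewrite eq_le; apply/andP; split.
  have := dir (- delta_mx 0 i); rewrite dotpNr dotp_delta.
  have -> : ((- delta_mx 0 i, 0) : U) = (-1) *: ((delta_mx 0 i, 0) : U).
    by rewrite -[RHS]/(_ *: _, _ *: 0) scaler0 scaleN1r.
  by rewrite sum_coordZ sum_coord_delta1; lra.
by have := dir (delta_mx 0 i); rewrite dotp_delta sum_coord_delta1.
Qed.

End Directional.

Section Hamiltonian.
Context {R : realType} {n : nat}.
Notation U := ('rV[R]_n * 'rV[R]_n)%type.
Notation I := ('I_n + 'I_n)%type.
Variable F : 'rV[R]_n -> set 'rV[R]_n.
Let f (z : U) := hamiltonian F z.1 z.2.
Hypothesis HSH : SH F.
Hypothesis Hreg : C21loc_on [set z : U | z.2 != 0] f.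

Lemma ham_argmax y q : exists v, [/\ F y v, hamiltonian F y q = dotp v q &
  forall q', dotp v q' <= hamiltonian F y q'].
Proof.
have [hF _ [gam g0 hg]] := HSH; have [F0 _ cF] := hF y.
have cd (v : 'rV[R]_n) : (fun w : 'rV[R]_n => dotp w q) @ nbhs v --> dotp v q.
  apply/cvgrPdist_le => e e0 /=.
  have q1 : 0 < n%:R * `|q| + 1 by have := mulr_ge0 (ler0n R n) (normr_ge0 q); lra.
  apply/nbhs_ballP; exists (e / (n%:R * `|q| + 1)) => /= [|w]; first by rewrite divr_gt0.
  rewrite -ball_normE /= ltr_pdivlMr// => hw.
  rewrite -dotpBl; apply: le_trans (dotp_le _ _) _; rewrite mulrAC.
  by have := normr_ge0 (v - w); lra.
have [v vF hv] := @compact_EVT_max _ R _ _ F0 cF (continuous_subspaceT cd).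
rewrite inE in vF.
have bound q' : has_ubound [set dotp w q' | w in F y].
  exists (n%:R * (gam * (1 + enorm y)) * `|q'|) => _ [w wF <-].
  apply: le_trans (ler_norm _) _; apply: le_trans (dotp_le _ _) _.
  rewrite ler_wpM2r// ler_wpM2l//; apply: le_trans (norm_le_enorm _) _.
  exact: hg.
exists v; split => // [|q']; last by apply: ub_le_sup (bound q') _ _; exists v.
apply/eqP; rewrite eq_le; apply/andP; split.
  apply: ge_sup => [|_ [w wF <-]]; first by exists (dotp v q), v.
  by apply: hv; rewrite inE.
by apply: ub_le_sup (bound q) _ _; exists v.
Qed.

(** The function [hamiltonian F y q' - dotp v q'] is nonnegative and vanishes at
   [q], so that its gradient at [q] is zero. *)
Lemma ham_gradient_argmax y q : q != 0 ->
  exists v, [/\ F y v, forall i, partial1 f (inr i) (y, q) = v 0 i,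
     hamiltonian F y q = dotp v q & forall q', dotp v q' <= hamiltonian F y q'].
Proof.
move=> q0; have [v [vF vq vmax]] := ham_argmax y q.
exists v; split => //.
apply: (@gradient_p_unique _ _ f y q (fun k => partial1 f k (y, q))).
  exact: (ham_frechet Hreg).
move=> e e0; exists 1 => // h _; rewrite /f /= vq.
have := vmax (q + h); rewrite dotpDr.
have := mulr_ge0 (ltW e0) (enorm_ge0 h); lra.
Qed.

Definition gradp (z : U) : 'rV[R]_n := \row_i partial1 f (inr i) z.

Lemma gradp_in z : z.2 != 0 -> F z.1 (gradp z).
Proof.
case: z => y q /= /(ham_gradient_argmax y)[v [vF vi _ _]].
by have -> : gradp (y, q) = v by apply/rowP => i; rewrite mxE vi.
Qed.

(** Euler's identity for the positively homogeneous function
   [hamiltonian F y]; it is read off the maximizing velocity. *)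
Lemma ham_euler z : z.2 != 0 -> f z = dotp z.2 (gradp z).
Proof.
case: z => y q /= /(ham_gradient_argmax y)[v [vF vi vq _]].
have -> : gradp (y, q) = v by apply/rowP => i; rewrite mxE vi.
by rewrite dotpC.
Qed.

Lemma subdiff_p x q w : q != 0 ->
  frechet_subdiff (fun q' => hamiltonian F x q') q w -> w = gradp (x, q).
Proof.
move=> q0 /frechet_subdiff_bound h; apply/rowP => i; rewrite mxE; apply/esym.
exact: (gradient_p_unique (ham_frechet Hreg (z := (x, q)) q0)).
Qed.

Lemma subdiff_x x q w : q != 0 ->
  frechet_subdiff (fun y => hamiltonian F y q) x w -> forall i, w 0 i = partial1 f (inl i) (x, q).
Proof.
move=> q0 /frechet_subdiff_bound h i; apply/esym.
exact: (gradient_x_unique (ham_frechet Hreg (z := (x, q)) q0)).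
Qed.

End Hamiltonian.

Section TubeTaylor.
Context {R : realType} {n : nat}.
Notation U := ('rV[R]_n * 'rV[R]_n)%type.
Notation I := ('I_n + 'I_n)%type.
Variable F : 'rV[R]_n -> set 'rV[R]_n.
Let f (z : U) := hamiltonian F z.1 z.2.
Hypothesis Hreg : C21loc_on [set z : U | z.2 != 0] f.
Let N : R := #|{: I}|%:R.

Lemma ball_segment (V : normedModType R) (z0 z d : V) (r th : R) : `|z - z0| <= r ->
  `|z + d - z0| <= r -> 0 <= th -> th <= 1 -> `|z + th *: d - z0| <= r.
Proof.
move=> h0 h1 t0 t1.
have -> : z + th *: d - z0 = (1 - th) *: (z - z0) + th *: (z + d - z0).
  rewrite addrAC [z + d - z0]addrAC; move: (z - z0) => w.
  by rewrite scalerDr addrA -scalerDl subrK scale1r.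
apply: le_trans (ler_normD _ _) _; rewrite !normrZ (ger0_norm t0) ger0_norm; last by lra.
have : (1 - th) * `|z - z0| <= (1 - th) * r by apply: ler_wpM2l; lra.
have : th * `|z + d - z0| <= th * r by apply: ler_wpM2l; lra.
lra.
Qed.

Variables (z0 : U) (r C : R).
Hypothesis tb : tube_bounds F z0 r C.
Hypothesis C0 : 0 <= C.

Lemma tube_p0 (z : U) : (0 < n)%N -> `|z - z0| <= r -> z.2 != 0.
Proof. by move=> n0 zr; have [] := tb (inl (Ordinal n0)) (inl (Ordinal n0)) zr. Qed.

Lemma tube_taylor2 z d : (0 < n)%N -> `|z - z0| <= r -> `|z + d - z0| <= r ->
  `|f (z + d) - f z - \sum_k coordU k d * partial1 f k z
     - 2^-1 * \sum_k coordU k d * \sum_l coordU l d * partial2 f k l z|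
  <= N ^+ 2 * C * `|d| ^+ 3.
Proof.
move=> n0 h0 h1.
have -> : N ^+ 2 * C * `|d| ^+ 3 = N ^+ 2 * (C * `|d|) * `|d| ^+ 2 by ring.
apply: (@taylor2 _ _ _ coordU) => [||th t0 t1|k th t0 t1|th t0 t1 k l].
- exact: coordUZ.
- exact: coordU_le.
- by apply: (ham_frechet Hreg); apply: tube_p0 => //; exact: ball_segment.
- by apply: (partial1_frechet Hreg); apply: tube_p0 => //; exact: ball_segment.
have [_ _ _ h] := tb k l (ball_segment h0 h1 t0 t1).
apply: le_trans (h z h0) _; rewrite addrAC subrr add0r normrZ ger0_norm//.
by rewrite ler_wpM2l// ler_piMl.
Qed.

Lemma tube_taylor1 k z d : (0 < n)%N -> `|z - z0| <= r -> `|z + d - z0| <= r ->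
  `|partial1 f k (z + d) - partial1 f k z - \sum_l coordU l d * partial2 f k l z|
  <= N * C * `|d| ^+ 2.
Proof.
move=> n0 h0 h1.
have -> : N * C * `|d| ^+ 2 = N * (C * `|d|) * `|d| by ring.
apply: (@taylor1 _ _ _ coordU coordUZ coordU_le (partial1 f k) (partial2 f k)
  (fun l => partial2 f k l z)) => [th t0 t1|th t0 t1 l].
- by apply: (partial1_frechet Hreg); apply: tube_p0 => //; exact: ball_segment.
have [_ _ _ h] := tb k l (ball_segment h0 h1 t0 t1).
apply: le_trans (h z h0) _; rewrite addrAC subrr add0r normrZ ger0_norm//.
by rewrite ler_wpM2l// ler_piMl.
Qed.

Lemma tube_lip k z z' : (0 < n)%N -> `|z - z0| <= r -> `|z' - z0| <= r ->
  `|partial1 f k z' - partial1 f k z| <= N * C * `|z' - z|.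
Proof.
move=> n0 h0 h1; pose d := z' - z.
have zd : z' = z + d by rewrite /d subrKC.
rewrite zd in h1 *; rewrite addrAC subrr add0r.
have := @taylor1 _ _ _ coordU coordUZ coordU_le (partial1 f k) (partial2 f k) (fun=> 0) z d C.
under eq_bigr do rewrite mulr0.
rewrite big1// subr0; apply => [th t0 t1|th t0 t1 l].
- by apply: (partial1_frechet Hreg); apply: tube_p0 => //; exact: ball_segment.
by have [_ _ h _] := tb k l (ball_segment h0 h1 t0 t1); rewrite subr0.
Qed.

End TubeTaylor.

(** * Symmetry and partial convexity of the Hessian *)

Section SecondOrder.
Context {R : realType} {n : nat}.
Notation U := ('rV[R]_n * 'rV[R]_n)%type.
Notation I := ('I_n + 'I_n)%type.
Variable F : 'rV[R]_n -> set 'rV[R]_n.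
Let f (z : U) := hamiltonian F z.1 z.2.
Hypothesis HSH : SH F.
Hypothesis Hreg : C21loc_on [set z : U | z.2 != 0] f.
Let N : R := #|{: I}|%:R.

Lemma le0_of_small (x K r : R) : 0 < r -> (forall t, 0 < t -> t <= r -> x <= K * t) -> x <= 0.
Proof.
move=> r0 h; apply/ler_addgt0Pl => e e0; rewrite addr0.
have K1 : 0 < `|K| + 1 by have := normr_ge0 K; lra.
pose t := Num.min r (e / (`|K| + 1)).
have t0 : 0 < t by rewrite lt_min r0 divr_gt0.
have tr : t <= r by rewrite ge_min lexx.
apply: le_trans (h t t0 tr) _.
have : t * (`|K| + 1) <= e by rewrite -ler_pdivlMr// ge_min lexx orbT.
have := ler_norm K; nra.
Qed.

Lemma basisU_norm k : `|basisU k : U| <= 1.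
Proof.
rewrite prod_normE ge_max; case: k => i /=; rewrite normr0 ler01 ?andbT /=;
by apply: mx_norm_le => // a b; rewrite mxE; case: (_ && _); rewrite ?normr1 ?normr0.
Qed.

Lemma quad_coordZ t (u : U) (H : I -> I -> R) :
  \sum_k coordU k (t *: u) * \sum_l coordU l (t *: u) * H k l =
  t * (t * \sum_k coordU k u * \sum_l coordU l u * H k l).
Proof.
rewrite (sum_coordZ t u (fun k => \sum_l coordU l (t *: u) * H k l)); congr (_ * _).
by rewrite mulr_sumr; apply: eq_bigr => k _; rewrite (sum_coordZ t u (H k)) mulrCA.
Qed.

(** Expand at [z0 + t (e_k + e_l)] in one step, and in two steps through
   [z0 + t e_l]: the terms of order [t ^+ 2] differ by half the commutator of
   the mixed derivatives, the error being [O(t ^+ 3)]. *)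
Lemma tube_schwarz z0 (r C : R) k l : (0 < n)%N -> 0 < r -> 0 <= C ->
  tube_bounds F z0 r C -> partial2 f k l z0 = partial2 f l k z0.
Proof.
move=> n0 r0 C0 tb.
pose K := 2 * (10 * (N ^+ 2 * C) + N * C + C).
have tr : `|z0 - z0| <= r by rewrite subrr normr0 ltW.
have NC : 0 <= N ^+ 2 * C by rewrite mulr_ge0// sqr_ge0.
have NC1 : 0 <= N * C by rewrite mulr_ge0.
have p3 (x a : R) : 0 <= x -> x <= a -> N ^+ 2 * C * x ^+ 3 <= N ^+ 2 * C * a ^+ 3.
  by move=> x0 xa; rewrite ler_wpM2l// lerXn2r// nnegrE//; lra.
have zE (u : U) : z0 + u - z0 = u by rewrite addrAC subrr add0r.
have main t : 0 < t -> t <= r / 2 -> `|partial2 f l k z0 - partial2 f k l z0| <= K * t.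
  move=> t0 t2; pose u : U := t *: basisU l; pose v : U := t *: basisU k.
  have nu i : `|t *: basisU i : U| <= t.
    by rewrite normrZ gtr0_norm//; apply: ler_piMr; [exact: ltW|exact: basisU_norm].
  have nu' := nu l; have nv' := nu k; rewrite -/u in nu'; rewrite -/v in nv'.
  have nuv := ler_normD u v.
  have su (a : I -> R) : \sum_i coordU i u * a i = t * a l by rewrite sum_coordZ sum_coord_basis.
  have sv (a : I -> R) : \sum_i coordU i v * a i = t * a k by rewrite sum_coordZ sum_coord_basis.
  clearbody u v.
  pose q (w : U) (H : I -> I -> R) := \sum_i coordU i w * \sum_j coordU j w * H i j.
  have qu H : q u H = t * (t * H l l).
    by rewrite /q (su (fun i => \sum_j coordU j u * H i j)) (su (H l)).
  have qv H : q v H = t * (t * H k k).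
    by rewrite /q (sv (fun i => \sum_j coordU j v * H i j)) (sv (H k)).
  have suv (a : I -> R) : \sum_i coordU i (u + v) * a i = t * a l + t * a k.
    by rewrite sum_coordD su sv.
  have quv H : q (u + v) H = t * (t * H l l + t * H l k) + t * (t * H k l + t * H k k).
    by rewrite /q (suv (fun i => \sum_j coordU j (u + v) * H i j)) (suv (H l)) (suv (H k)).
  have nuv2 : `|u + v| <= 2 * t by lra.
  have bu : `|z0 + u - z0| <= r by rewrite zE; lra.
  have buv : `|z0 + (u + v) - z0| <= r by rewrite zE; lra.
  have buv' : `|z0 + u + v - z0| <= r by rewrite -(addrA z0).
  have := tube_taylor2 Hreg tb C0 n0 tr buv.
  rewrite -/(q _ _) quv (suv (fun k => partial1 f k z0)) => E1.
  have := tube_taylor2 Hreg tb C0 n0 tr bu.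
  rewrite -/(q _ _) qu (su (fun k => partial1 f k z0)) => E2.
  have := tube_taylor2 Hreg tb C0 n0 bu buv'.
  rewrite -/(q _ _) qv (sv (fun k => partial1 f k (z0 + u))) => E3.
  have := tube_taylor1 Hreg tb C0 k n0 tr bu; rewrite (su (fun l => partial2 f k l z0)) => E4.
  have [_ _ _ E5] := tb k k _ bu.
  have {E5} := E5 z0 tr; rewrite zE => E5.
  have {}E1 := le_trans E1 (p3 _ (2 * t) (normr_ge0 _) nuv2).
  have {}E2 := le_trans E2 (p3 _ t (normr_ge0 _) nu').
  have {}E3 := le_trans E3 (p3 _ t (normr_ge0 _) nv').
  have {}E4 : t * `|partial1 f k (z0 + u) - partial1 f k z0 - t * partial2 f k l z0| <= t * (N *
    C * t ^+ 2).
    by rewrite ler_pM2l//; apply: le_trans E4 _; rewrite ler_wpM2l// lerXn2r// nnegrE// ltW.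
  have {}E5 : t ^+ 2 * `|partial2 f k k (z0 + u) - partial2 f k k z0| <= t ^+ 2 * (C * t).
    by rewrite ler_pM2l ?exprn_gt0//; apply: le_trans E5 _; rewrite ler_wpM2l.
  rewrite -addrA in E3.
  rewrite addrA in E1; rewrite addrA in E3.
  suff : t ^+ 2 * `|partial2 f l k z0 - partial2 f k l z0| <= t ^+ 2 * (K * t) by rewrite
    ler_pM2l ?exprn_gt0.
  rewrite -[X in X * `|_|](ger0_norm (sqr_ge0 t)) -normrM.
  rewrite -{1}(gtr0_norm t0) -normrM in E4.
  rewrite -[X in X * `|_|](ger0_norm (sqr_ge0 t)) -normrM in E5.
  move: E1 E2 E3 E4 E5; rewrite /K.
  move: (hamiltonian F (z0 + u + v).1 _) (hamiltonian F (z0 + u).1 _) (hamiltonian F z0.1 _) =>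
    f1 f2 f3.
  move: (partial1 f k (z0 + u)) (partial1 f k z0) (partial1 f l z0) => g1 g2 g3.
  move: (partial2 f k k (z0 + u)) (partial2 f k k z0) (partial2 f k l z0) (partial2 f l k z0)
    (partial2 f l l z0) => h1 h2 h3 h4 h5.
  move: (N ^+ 2 * C) NC (N * C) NC1 => P P0 Q Q0; clear -C0 t0 P0 Q0; rewrite !ler_norml =>
    E1 E2 E3 E4 E5.
  have t3 : 0 <= t ^+ 3 by rewrite exprn_ge0// ltW.
  have e1 : 0 <= C * t ^+ 3 by rewrite mulr_ge0.
  have e2 : 0 <= Q * t ^+ 3 by rewrite mulr_ge0.
  rewrite exprS in t3 e1 e2; rewrite !(exprS _ 2) in E1 E2 E3; lra.
apply/eqP; rewrite eq_sym -subr_eq0 -normr_le0; exact: (le0_of_small (divr_gt0 r0 (ltr0Sn _ 1))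
  main).
Qed.

(** A velocity maximizing at the center bounds [H] from below at both
   [p + t h] and [p - t h], so that second differences are nonnegative. *)
Lemma tube_convex z0 (r C : R) (h : 'rV[R]_n) : (0 < n)%N -> 0 < r -> 0 <= C ->
  tube_bounds F z0 r C ->
  0 <= \sum_i h 0 i * \sum_j h 0 j * partial2 f (inr i) (inr j) z0.
Proof.
move=> n0 r0 C0 tb.
have tr : `|z0 - z0| <= r by rewrite subrr normr0 ltW.
have z02 : z0.2 != 0 by exact: (tube_p0 tb).
pose d : U := (0, h).
have QE : \sum_k coordU k d * \sum_l coordU l d * partial2 f k l z0 =
    \sum_i h 0 i * \sum_j h 0 j * partial2 f (inr i) (inr j) z0.
  rewrite big_sumType /= [X in X + _]big1 ?add0r; last by move=> i _; rewrite mxE mul0r.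
  apply: eq_bigr => i _; congr (_ * _).
  by rewrite big_sumType /= [X in X + _]big1 ?add0r// => j _; rewrite mxE mul0r.
rewrite -QE -oppr_le0.
have d1 : 0 < `|d| + 1 by have := normr_ge0 d; lra.
apply: (@le0_of_small _ (2 * (N ^+ 2 * C * `|d| ^+ 3)) (r / (`|d| + 1))); first exact: divr_gt0.
move=> t t0 ht.
have td : t * `|d| <= r.
  have : t * (`|d| + 1) <= r by rewrite -ler_pdivlMr.
  lra.
have b1 : `|z0 + t *: d - z0| <= r by rewrite addrAC subrr add0r normrZ gtr0_norm.
have b2 : `|z0 + (- t) *: d - z0| <= r by rewrite addrAC subrr add0r normrZ normrN gtr0_norm.
have := tube_taylor2 Hreg tb C0 n0 tr b1; have := tube_taylor2 Hreg tb C0 n0 tr b2.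
rewrite !(quad_coordZ _ _ (fun k l => partial2 f k l z0)).
rewrite !(sum_coordZ _ _ (fun k => partial1 f k z0)) !normrZ normrN (gtr0_norm t0) !exprMn.
have [v [_ v0 vmax]] := ham_argmax HSH z0.1 z0.2.
have m1 := vmax (z0.2 + t *: h); have m2 := vmax (z0.2 - t *: h).
have fv s : hamiltonian F (z0 + s *: d).1 (z0 + s *: d).2 = hamiltonian F z0.1 (z0.2 + s *: h).
  by rewrite -[z0 + _]/(z0.1 + s *: 0, z0.2 + s *: h) scaler0 addr0.
rewrite dotpDr dotpZr in m1; rewrite dotpBr dotpZr in m2.
rewrite !fv v0 scaleNr; move: m1 m2.
move: (\sum_k _) (\sum_k _) (hamiltonian F z0.1 _) (hamiltonian F z0.1 _) => S1 S2 A B.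
move: (N ^+ 2 * C) (`|d| ^+ 3) (dotp v z0.2) (dotp v h) => P D a b.
clear -t0; rewrite !ler_norml => m1 m2 /andP[E1 E1'] /andP[E2 E2'].
have t2 : 0 < t ^+ 2 by rewrite exprn_gt0.
rewrite -(ler_pM2l t2).
rewrite !exprS expr0 in E1 E1' E2 E2' *; lra.
Qed.

End SecondOrder.

(** * Absolutely continuous arcs *)

Section AbsContinuous.
Context {R : realType} {n : nat}.
Implicit Types (x y z h : R -> 'rV[R]_n) (a b t : R).

Lemma abs_continuous_absc a b x : abs_continuous a b x -> absc a b x.
Proof.
move=> h e e0; have [d d0 hd] := h e e0; exists d => // l hl pl sl.
pose u (i : 'I_(size l)) := (nth (0, 0) l i).1.
pose v (i : 'I_(size l)) := (nth (0, 0) l i).2.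
have big (g : R * R -> R) : \sum_(p <- l) g p = \sum_(i < size l) g (nth (0, 0) l i).
  by rewrite (big_nth (0, 0)) big_mkord.
rewrite big; rewrite big in sl.
apply: le_lt_trans (hd (size l) u v _ _ sl).
- by apply: ler_sum => i _; exact: norm_le_enorm.
- by move=> i; have [] := hl _ (mem_nth (0, 0) (ltn_ord i)).
have disj (i j : 'I_(size l)) : (i < j)%N -> v i <= u j.
  move=> ij; move/(pairwiseP (0, 0)): pl => /(_ i j); apply => //; rewrite inE //.
apply/trivIsetP => i j _ _ ij; apply/seteqP; split => // c /=.
rewrite !in_itv /= => -[/andP[c1 c2] /andP[c3 c4]].
have := ij; rewrite -val_eqE neq_ltn => /orP[/disj|/disj]; lra.
Qed.

(** The reparametrizations allow for concatenation of arcs at [t], where they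
   are the minimum and the maximum with [t].  They may collapse intervals
   but preserve order, hence disjointness. *)
Lemma abs_continuous_dom a b a1 b1 a2 b2 x1 x2 h (al1 al2 : R -> R) (L : R) :
  (forall u v, a <= u -> u <= v -> v <= b ->
     [/\ a1 <= al1 u, al1 u <= al1 v, al1 v <= b1 & al1 v - al1 u <= v - u]) ->
  (forall u v, a <= u -> u <= v -> v <= b ->
     [/\ a2 <= al2 u, al2 u <= al2 v, al2 v <= b2 & al2 v - al2 u <= v - u]) ->
  (forall u v, a <= u -> u <= v -> v <= b ->
     `|h v - h u| <= L * (`|x1 (al1 v) - x1 (al1 u)| + `|x2 (al2 v) - x2 (al2 u)| + (v - u))) ->
  abs_continuous a1 b1 x1 -> abs_continuous a2 b2 x2 -> abs_continuous a b h.
Proof.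
move=> hal1 hal2 hh h1 h2 e e0.
pose M := n%:R * `|L| + 1.
have M0 : 0 < M by rewrite /M; have := mulr_ge0 (ler0n R n) (normr_ge0 L); lra.
have e3 : 0 < e / 3 / M by rewrite !divr_gt0.
have [d1 d10 hd1] := h1 _ e3; have [d2 d20 hd2] := h2 _ e3.
exists (Num.min (e / 3 / M) (Num.min d1 d2)); first by rewrite !lt_min e3 d10.
move=> m u v uv tr; rewrite !lt_min => /and3P[s0 s1 s2].
have disj (al : R -> R) (a' b' : R) : (forall u v, a <= u -> u <= v -> v <= b ->
     [/\ a' <= al u, al u <= al v, al v <= b' & al v - al u <= v - u]) ->
   trivIset setT (fun i => `]al (u i), al (v i)[%classic).
  move=> hal; apply/trivIsetP => i j _ _ ij; apply/seteqP; split => // c /=.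
  rewrite !in_itv /= => -[/andP[c1 c2] /andP[c3 c4]].
  have [u1 [u2 u3]] := uv i; have [v1 [v2 v3]] := uv j.
  have mono s t : a <= s -> s <= b -> a <= t -> t <= b -> al s < al t -> s < t.
    by move=> as_ sb at_ tb st; rewrite ltNge; apply/negP => ts; have [_ hm _ _] :=
      hal t s at_ ts sb; lra.
  have l1 : u i < v i by apply: mono; lra.
  have l2 : u j < v j by apply: mono; lra.
  have l3 : u i < v j by apply: mono; lra.
  have l4 : u j < v i by apply: mono; lra.
  move/trivIsetP: tr => /(_ i j I I ij) /seteqP[/(_ ((Num.max (u i) (u j) + Num.min (v i) (v j))
    / 2)) + _].
  apply; rewrite /= !in_itv /=.
  by rewrite /Num.max /Num.min; case: ifP; case: ifP; lra.
have len (al : R -> R) (a' b' : R) d : (forall u v, a <= u -> u <= v -> v <= b ->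
     [/\ a' <= al u, al u <= al v, al v <= b' & al v - al u <= v - u]) ->
   \sum_(i < m) (v i - u i) < d -> \sum_(i < m) (al (v i) - al (u i)) < d.
  move=> hal; apply: le_lt_trans; apply: ler_sum => i _.
  by have [u1 [u2 u3]] := uv i; have [] := hal (u i) (v i) u1 u2 u3.
have t1 := hd1 m (al1 \o u) (al1 \o v) ltac:(by move=> i; have [u1 [u2 u3]] := uv i; have [] :=
  hal1 (u i) (v i) u1 u2 u3) (disj _ _ _ hal1) (len _ _ _ _ hal1 s1).
have t2 := hd2 m (al2 \o u) (al2 \o v) ltac:(by move=> i; have [u1 [u2 u3]] := uv i; have [] :=
  hal2 (u i) (v i) u1 u2 u3) (disj _ _ _ hal2) (len _ _ _ _ hal2 s2).
apply: (@le_lt_trans _ _ (M * (\sum_(i < m) enorm (x1 (al1 (v i)) - x1 (al1 (u i))) +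
   \sum_(i < m) enorm (x2 (al2 (v i)) - x2 (al2 (u i))) + \sum_(i < m) (v i - u i)))).
  rewrite -!big_split mulr_sumr /=; apply: ler_sum => i _.
  have [u1 [u2 u3]] := uv i.
  apply: le_trans (enorm_le _) _.
  have hi := hh (u i) (v i) u1 u2 u3.
  have n1 := norm_le_enorm (x1 (al1 (v i)) - x1 (al1 (u i))).
  have n2 := norm_le_enorm (x2 (al2 (v i)) - x2 (al2 (u i))).
  have p1 := normr_ge0 (x1 (al1 (v i)) - x1 (al1 (u i))).
  have p2 := normr_ge0 (x2 (al2 (v i)) - x2 (al2 (u i))).
  move: (enorm (x1 _ - _)) (enorm (x2 _ - _)) n1 n2 => E1 E2.
  move: `|x1 _ - _| `|x2 _ - _| p1 p2 hi => X1 X2 p1 p2 hi n1 n2.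
  apply: (@le_trans _ _ (n%:R * (`|L| * (X1 + X2 + (v i - u i))))).
    rewrite ler_wpM2l//; apply: le_trans hi _; apply: ler_wpM2r; [lra|exact: ler_norm].
  rewrite mulrA; apply: ler_pM; [exact: mulr_ge0|lra|rewrite /M; lra|lra].
rewrite -ltr_pdivlMl// mulrC.
have -> : e / M = e / 3 / M + e / 3 / M + e / 3 / M by field; rewrite gt_eqF.
by move: t1 t2 s0 => /=; lra.
Qed.

Lemma abs_continuous_sub a b a' b' x : a <= a' -> b' <= b ->
  abs_continuous a b x -> abs_continuous a' b' x.
Proof.
move=> aa bb h; apply: (@abs_continuous_dom a' b' a b a b x x x id id 1) (h) (h) => u v au uv vb.
- by split => //; lra.
- by split => //; lra.
by have := normr_ge0 (x v - x u); lra.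
Qed.

Lemma abs_continuous_add_lip a b x h (M : R) :
  (forall u v, a <= u -> u <= v -> v <= b -> `|h v - h u| <= M * (v - u)) ->
  abs_continuous a b x -> abs_continuous a b (fun t => x t + h t).
Proof.
move=> hM hx.
apply: (@abs_continuous_dom a b a b a b x x _ id id (`|M| + 1)) (hx) (hx) => u v au uv vb.
- by split => //; lra.
- by split => //; lra.
rewrite opprD addrACA; apply: le_trans (ler_normD _ _) _.
have := hM u v au uv vb; have := normr_ge0 (x v - x u); have := ler_norm M; have := normr_ge0 M;
  nra.
Qed.

Definition glue t y z : R -> 'rV[R]_n := fun s => if s <= t then y s else z s.

Lemma abs_continuous_glue a t b y z : a <= t -> t <= b -> y t = z t ->
  abs_continuous a t y -> abs_continuous t b z -> abs_continuous a b (glue t y z).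
Proof.
move=> at_ tb yz.
apply: (@abs_continuous_dom a b a t t b y z _ (Num.min t) (Num.max t) 1).
- by move=> u v au uv vb; rewrite /Num.min; split; repeat case: ifP; lra.
- by move=> u v au uv vb; rewrite /Num.max; split; repeat case: ifP; lra.
have E s : glue t y z s = y (Num.min t s) + z (Num.max t s) - y t.
  rewrite /glue; case: ifPn => [st|]; first by rewrite (min_r st) (max_l st) yz addrK.
  by rewrite -ltNge => /ltW st; rewrite (min_l st) (max_r st) addrAC subrr add0r.
move=> u v au uv vb; rewrite !E mul1r.
rewrite opprB addrA subrK opprD addrACA.
by apply: le_trans (ler_normD _ _) _; rewrite lerDl; lra.
Qed.

End AbsContinuous.

(** * Trajectories and the value function *)

Section LocallyLipschitz.
Context {R : realType} {U : normedModType R}.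

Lemma locally_lipschitz_ball (A : set U) (f : U -> R) x : locally_lipschitz_on A f -> A x ->
  exists r M : R, [/\ 0 < r, 0 < M & forall y z, A y -> A z -> `|y - x| <= r -> `|z - x| <= r ->
    `|f y - f z| <= M * `|y - z|].
Proof.
move=> hf Ax; have [K nK [M0 [Mr hM]]] := hf x Ax.
have M1 : 0 < `|M0| + 1 by have := normr_ge0 M0; lra.
have {}hM := hM (`|M0| + 1) ltac:(by have := ler_norm M0; lra).
have /nbhs_ballP [r /= r0 hr] := nK.
exists (r / 2), (`|M0| + 1); split => //; first by rewrite divr_gt0.
move=> y z Ay Az yr zr; apply: (hM (y, z)); split; split => //; apply: hr;
  by rewrite -ball_normE /= distrC; lra.
Qed.

End LocallyLipschitz.

Section Trajectories.
Context {R : realType} {n : nat}.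
Implicit Types (F : 'rV[R]_n -> set 'rV[R]_n) (phi : 'rV[R]_n -> R) (x y z : R -> 'rV[R]_n) (a b
  t T : R).

Lemma lipschitz_bounded_below phi (rho : R) : locally_lipschitz_on setT phi ->
  exists m, forall v : 'rV[R]_n, `|v| <= rho -> m <= phi v.
Proof.
move=> hphi; have [r0|r0] := leP 0 rho; last by exists 0 => v; have := normr_ge0 v; lra.
pose A := [set v : 'rV[R]_n | forall i, `[- rho, rho]%classic (v ord0 i)].
have cA : compact A by apply: (@rV_compact R n (fun=> `[- rho, rho]%classic)) => i;
  exact: segment_compact.
have A0 : A !=set0 by exists 0 => i /=; rewrite in_itv /= mxE; lra.
have cphi (v : 'rV[R]_n) : phi @ nbhs v --> phi v.
  apply/cvgrPdist_le => e e0 /=.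
  have [r [M [rp M0 hM]]] := locally_lipschitz_ball hphi (I : setT v).
  apply/nbhs_ballP; exists (Num.min r (e / M)) => /=; first by rewrite lt_min rp divr_gt0.
  move=> w; rewrite -ball_normE /= lt_min => /andP[wr we].
  apply: le_trans (hM v w I I _ _) _; [by rewrite subrr normr0 ltW|by rewrite distrC ltW|].
  by rewrite mulrC -ler_pdivlMr// ltW.
have [v _ hv] := @compact_EVT_min _ R _ _ A0 cA (continuous_subspaceT cphi).
exists (phi v) => w wr; apply: hv; rewrite inE => i /=; rewrite in_itv /=.
by have := mx_entry_le w ord0 i; rewrite ler_norml; lra.
Qed.

Lemma trajectory_sub F a b a' b' x : a <= a' -> b' <= b -> trajectory F a b x -> trajectory F a'
  b' x.
Proof.
move=> aa bb [h1 h2]; split; first exact: abs_continuous_sub h1.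
by move: h2; apply: ae_sub => s hs /andP[as_ sb]; apply: hs; rewrite (le_trans aa) ?(le_trans sb).
Qed.

Lemma glue_derive t y z s : s != t ->
  (s < t -> derivable y s 1 -> derivable (glue t y z) s 1 /\ derive1 (glue t y z) s = derive1 y
    s) /\
  (t < s -> derivable z s 1 -> derivable (glue t y z) s 1 /\ derive1 (glue t y z) s = derive1 z s).
Proof.
move=> st; split => hst dy.
- have D : derivw (s - 1) t (glue t y z) s (derive1 y s).
    apply: (@derivw_eq _ _ _ _ y) (derivable_derivw _ _ dy) => [|//|u _ ut]; [lra|exact: ltW|].
    by rewrite /glue ut.
  have D' : is_derive s 1 (glue t y z) (derive1 y s) by apply: derivw_is_derive D => //; lra.
  by rewrite derive1E; split; [exact: ex_derive|rewrite derive_val].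
- have [m [tm ms]] : exists m, t < m /\ m < s by exists ((t + s) / 2); lra.
  have D : derivw m (s + 1) (glue t y z) s (derive1 z s).
    apply: (@derivw_eq _ _ _ _ z) (derivable_derivw _ _ dy) => [||u mu _]; [exact: ltW|lra|].
    by rewrite /glue leNgt (lt_le_trans tm mu).
  have D' : is_derive s 1 (glue t y z) (derive1 z s) by apply: derivw_is_derive D => //; lra.
  by rewrite derive1E; split; [exact: ex_derive|rewrite derive_val].
Qed.

Lemma trajectory_glue F a t b y z : a <= t -> t <= b -> y t = z t ->
  trajectory F a t y -> trajectory F t b z -> trajectory F a b (glue t y z).
Proof.
move=> at_ tb yz [y1 y2] [z1 z2]; split; first exact: abs_continuous_glue.
have := ae_and (ae_and y2 z2) (ae_neq t); apply: ae_sub => s [[hy hz] st] /andP[as_ sb].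
have [g1 g2] := glue_derive y z st.
case: (ltgtP s t) st => // hst _.
- have [dy Fy] := hy ltac:(lra); have [d ->] := g1 hst dy; split => //.
  by rewrite /glue ltW.
- have [dz Fz] := hz ltac:(lra); have [d ->] := g2 hst dz; split => //.
  by rewrite /glue leNgt hst.
Qed.

(** Gronwall's inequality and the linear growth of [F]. *)
Lemma trajectory_bound F : SH F -> exists2 K : R, 0 < K &
  forall a b z, a <= b -> trajectory F a b z -> `|z b| <= (`|z a| + 1) * expR (K * (b - a)).
Proof.
move=> [_ _ [gam g0 hg]]; pose K := gam * (n%:R + 1).
have n0 : 0 <= n%:R :> R by exact: ler0n.
have K0 : 0 < K by rewrite mulr_gt0//; lra.
exists K => // a b z ab [acz hz].
apply: le_trans (@gronwall_norm _ _ z a b K gam ab K0 (ltW g0) (abs_continuous_absc acz) _) _.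
  move: hz; apply: ae_sub => s hs /hs[dz Fz].
  exists (derive1 z s); first exact: derivable_derivw.
  apply: le_trans (norm_le_enorm _) _; apply: le_trans (hg _ _ Fz) _.
  have := enorm_le (z s); have := normr_ge0 (z s); rewrite /K; move: (enorm _) `|_| => E M M0 EM.
  have : gam * E <= gam * (n%:R * M) by rewrite ler_pM2l.
  have : 0 <= gam * M by apply: mulr_ge0; lra.
  lra.
apply: ler_wpM2r; first exact: expR_ge0.
by rewrite lerD2l ler_pdivrMr// mul1r /K; nra.
Qed.

Section Value.
Variables (F : 'rV[R]_n -> set 'rV[R]_n) (phi : 'rV[R]_n -> R) (T : R).
Hypothesis HSH : SH F.
Hypothesis Hphi : locally_lipschitz_on setT phi.

(** The real-valued infimum is meaningful because the terminal points of all
   competitors lie in one ball, where [phi] is bounded below. *)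
Lemma value_le t v z : t <= T -> admissible T F t v z -> value T F phi t v <= phi (z T).
Proof.
move=> tT az; apply: ge_inf; last by exists z.
have [K K0 hK] := trajectory_bound HSH.
have [m hm] := lipschitz_bounded_below ((`|v| + 1) * expR (K * (T - t))) Hphi.
exists m => _ [w [tw wt] <-]; apply: hm; rewrite -wt; exact: hK.
Qed.

Lemma value_ge t v m : admissible T F t v !=set0 ->
  (forall z, admissible T F t v z -> m <= phi (z T)) -> m <= value T F phi t v.
Proof.
move=> [z az] h; apply: lb_le_inf; first by exists (phi (z T)), z.
by move=> _ [w aw <-]; exact: h.
Qed.

(** A competitor from [(t, y t)] preceded by [y] is a competitor from
   [(t0, y t0)].  Nonemptiness is required, as the infimum over the empty set has a
   default value. *)
Lemma value_nondecreasing t0 t y : t0 <= t -> t <= T -> trajectory F t0 t y ->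
  admissible T F t (y t) !=set0 -> value T F phi t0 (y t0) <= value T F phi t (y t).
Proof.
move=> t0t tT ty ne; apply: value_ge ne _ => z [tz zt].
have -> : phi (z T) = phi (glue t y z T).
  rewrite /glue; case: ifP => // Tt; have -> : T = t by apply/eqP; rewrite eq_le Tt.
  by rewrite zt.
apply: value_le; first lra.
split; first exact: trajectory_glue.
by rewrite /glue t0t.
Qed.

Lemma value_optimal t0 v x : t0 <= T -> optimal T F phi t0 v x -> value T F phi t0 v = phi (x T).
Proof.
move=> tT [ax ox]; apply/eqP; rewrite eq_le value_le//=.
by apply: value_ge => //; exists x.
Qed.

Lemma value_along_optimal t0 v x t : t0 <= t -> t <= T -> optimal T F phi t0 v x ->
  value T F phi t (x t) = phi (x T).
Proof.
move=> t0t tT ox; have [[tx x0] _] := ox.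
have ax : admissible T F t (x t) x by split => //; exact: trajectory_sub tx.
apply/eqP; rewrite eq_le value_le//= -(value_optimal _ ox) -?x0; last lra.
by apply: value_nondecreasing => //; [exact: trajectory_sub tx|exists x].
Qed.

End Value.
End Trajectories.

(** * Feedback trajectories near the reference arc *)

Section MoreGronwall.
Context {R : realType}.

Lemma gronwall_derivw_backward m n (z : R -> 'M[R]_(m, n)) (a b K eps : R) :
  a <= b -> 0 < K -> 0 <= eps ->
  (forall s, a <= s -> s <= b -> exists2 w, derivw a b z s w & `|w| <= K * `|z s| + eps) ->
  `|z a| <= (`|z b| + eps / K) * expR (K * (b - a)).
Proof.
move=> ab K0 eps0 h.
have := @gronwall_derivw R _ (fun t => z (- t)) (- b) (- a) K eps ltac:(lra) K0 eps0.
rewrite !opprK [- a + b]addrC; apply=> s bs sa.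
have [w hw wK] := h (- s) ltac:(lra) ltac:(lra); exists (- w); last by rewrite normrN.
by apply: derivw_reflect; rewrite !opprK.
Qed.

Lemma mulmx_norm_le m n p (A : 'M[R]_(m, n)) (B : 'M[R]_(n, p)) :
  `|A *m B| <= n%:R * `|A| * `|B|.
Proof.
apply: mx_norm_le => [|i j]; first by rewrite !mulr_ge0.
rewrite mxE; apply: le_trans (ler_norm_sum _ _ _) _.
apply: (@le_trans _ _ (\sum_(k < n) (`|A| * `|B|))).
  by apply: ler_sum => k _; rewrite normrM; apply: ler_pM => //; exact: mx_entry_le.
by rewrite sumr_const card_ord -mulrA mulr_natl.
Qed.

Lemma contw_pair (V W : normedModType R) (f : R -> V) (g : R -> W) a b s :
  contw a b f s -> contw a b g s -> contw a b (fun t => (f t, g t)) s.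
Proof.
move=> hf hg e e0; have [d d0 hd] := hf e e0; have [d' d'0 hd'] := hg e e0.
exists (Num.min d d') => [|u au ub]; first by rewrite lt_min d0.
rewrite le_min => /andP[us us']; rewrite prod_normE ge_max /=.
by rewrite hd// hd'.
Qed.

Lemma contw_add (V : normedModType R) (f g : R -> V) a b s :
  contw a b f s -> contw a b g s -> contw a b (fun t => f t + g t) s.
Proof.
move=> hf hg e e0; have e2 : 0 < e / 2 by rewrite divr_gt0.
have [d d0 hd] := hf _ e2; have [d' d'0 hd'] := hg _ e2.
exists (Num.min d d') => [|u au ub]; first by rewrite lt_min d0.
rewrite le_min => /andP[us us']; rewrite opprD addrACA.
by have := ler_normD (f u - f s) (g u - g s); have := hd u au ub us; have := hd' u au ub us'; lra.
Qed.

Lemma contw_lip (V W : normedModType R) (f : R -> V) (g : R -> W) a b s (L : R) :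
  (forall u v, `|g u - g v| <= L * `|f u - f v|) -> contw a b f s -> contw a b g s.
Proof.
move=> hL hf e e0; have L1 : 0 < `|L| + 1 by have := normr_ge0 L; lra.
have [d d0 hd] := hf _ (divr_gt0 e0 L1); exists d => // u au ub us.
apply: le_trans (hL _ _) _; have := hd u au ub us; rewrite ler_pdivlMr//.
by have := ler_norm L; have := normr_ge0 (f u - f s); nra.
Qed.

Lemma contw_cst (V : normedModType R) (c : V) a b (s : R) : contw a b (fun=> c) s.
Proof. exact: (derivw_contw (derivw_cst _ _ _ _)). Qed.

Lemma contw_mx m n (f : R -> 'M[R]_(m, n)) a b s :
  (forall i j, contw a b (fun t => f t i j) s) -> contw a b f s.
Proof.
move=> h e e0.
have /choice [d hd] : forall ij : 'I_m * 'I_n, exists d : R, 0 < d /\ forall u, a <= u -> u <= b ->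
    `|u - s| <= d -> `|f u ij.1 ij.2 - f s ij.1 ij.2| <= e.
  by move=> ij; have [d d0 hd] := h ij.1 ij.2 e e0; exists d.
exists (\big[Num.min/1]_(ij : 'I_m * 'I_n) d ij).
  by apply: lt_bigmin => // ij _; have [] := hd ij.
move=> u au ub us; apply: mx_norm_le => [|i j]; first exact: ltW.
rewrite !mxE; have [_] := hd (i, j); apply => //; apply: le_trans us _.
exact: (bigmin_le_cond _ d).
Qed.

(** Coordinatewise truncation is nonexpansive for the sup norm, unlike radial
   retraction. *)
Definition clip m n (rho : R) (A : 'M[R]_(m, n)) : 'M[R]_(m, n) :=
  \matrix_(i, j) clamp (- rho) rho (A i j).

Lemma clip_lip m n rho (A B : 'M[R]_(m, n)) : `|clip rho A - clip rho B| <= `|A - B|.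
Proof.
apply: mx_norm_le => // i j; rewrite !mxE; apply: le_trans (clamp_lip _ _ _ _) _.
by have := mx_entry_le (A - B) i j; rewrite !mxE.
Qed.

Lemma clip_le m n rho (A : 'M[R]_(m, n)) : 0 <= rho -> `|clip rho A| <= rho.
Proof.
move=> r0; apply: mx_norm_le => // i j; rewrite !mxE ler_norml.
by have [h1 h2] := @clamp_itv R (- rho) rho (A i j) ltac:(lra); rewrite h1 h2.
Qed.

Lemma clip_id m n rho (A : 'M[R]_(m, n)) : `|A| <= rho -> clip rho A = A.
Proof.
move=> h; apply/matrixP => i j; rewrite mxE.
by have := le_trans (mx_entry_le A i j) h; rewrite ler_norml => /andP[? ?]; exact: clamp_id.
Qed.

End MoreGronwall.

Section Feedback.
Context {R : realType} {n : nat}.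
Notation U := ('rV[R]_n * 'rV[R]_n)%type.
Notation I := ('I_n + 'I_n)%type.
Variables (F : 'rV[R]_n -> set 'rV[R]_n) (t0 T : R) (xbar pbar : R -> 'rV[R]_n).
Let f (z : U) := hamiltonian F z.1 z.2.
Let zb s : U := (xbar s, pbar s).
Hypothesis n0 : (0 < n)%N.
Hypothesis HSH : SH F.
Hypothesis Hreg : C21loc_on [set z : U | z.2 != 0] f.
Hypothesis acx : abs_continuous t0 T xbar.
Hypothesis cp : forall s, t0 <= s -> s <= T -> contw t0 T pbar s.
Hypothesis hx : {ae (@lebesgue_measure R), forall s, t0 <= s <= T ->
  derivable xbar s 1 /\ derive1 xbar s = gradp F (zb s)}.
Variables (r C : R).
Hypothesis r0 : 0 < r.
Hypothesis C0 : 0 < C.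
Hypothesis tb : forall s, t0 <= s -> s <= T -> tube_bounds F (zb s) r C.

Let N : R := #|{: I}|%:R.

Lemma zb_contw s : t0 <= s -> s <= T -> contw t0 T zb s.
Proof.
by move=> s0 sT; apply: contw_pair; [exact: absc_contw (abs_continuous_absc acx) _ _ | exact: cp].
Qed.

Lemma partial1_contw k (zf : R -> U) a b s : contw a b zf s -> (zf s).2 != 0 ->
  contw a b (fun t => partial1 f k (zf t)) s.
Proof.
move=> cz z0 e e0.
have [_ c1] := Hreg.1.1 _ z0.
have /cvgrPdist_le /(_ e e0) /nbhs_ballP [d /= d0 hd] := c1 (basisU k).
have [d' d'0 hd'] := cz (d / 2) (divr_gt0 d0 (ltr0Sn _ 1)).
exists d' => // u au ub us; rewrite distrC; apply: hd; rewrite -ball_normE /= distrC.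
by have := hd' u au ub us; lra.
Qed.

Lemma gradp_contw (zf : R -> U) a b s : contw a b zf s -> (zf s).2 != 0 ->
  contw a b (fun t => gradp F (zf t)) s.
Proof.
move=> cz z0; apply: contw_mx => i j.
have := partial1_contw (inr j) cz z0; congr contw; apply/funext => t; by rewrite mxE.
Qed.

Lemma gradp_lip s z z' : t0 <= s -> s <= T -> `|z - zb s| <= r -> `|z' - zb s| <= r ->
  `|gradp F z' - gradp F z| <= N * C * `|z' - z|.
Proof.
move=> s0 sT h h'; apply: mx_norm_le => [|i j]; first by rewrite !mulr_ge0// ltW.
by rewrite !mxE; exact: (tube_lip Hreg (tb s0 sT) (inr j) n0 h h').
Qed.

(** Points of the graph of the linear map [S]: the perturbation of the costate
   that accompanies the perturbation [d] of the state. *)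
Definition graphU (S : 'M[R]_n) (d : 'rV[R]_n) : U := (d, d *m S).

Lemma graphU_le (B : R) S d : `|S| <= B -> `|graphU S d| <= (1 + n%:R * B) * `|d|.
Proof.
move=> SB; rewrite prod_normE ge_max /= mulrDl mul1r.
have h : `|d *m S| <= n%:R * B * `|d|.
  apply: le_trans (mulmx_norm_le _ _) _; rewrite mulrAC; apply: ler_wpM2r => //; exact: ler_wpM2l.
have : 0 <= n%:R * B * `|d| by apply: le_trans h.
by have := normr_ge0 d; lra.
Qed.

Lemma graphUB S d d' : graphU S d - graphU S d' = graphU S (d - d').
Proof. by rewrite /graphU mulmxBl. Qed.

(** The equation is solved for the deviation [d] rather than for the
   trajectory itself: then the field vanishes at [d = 0], which bounds [d] by
   Gronwall's inequality, and no regularity of [xbar] beyond absolute continuity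
   is needed.  Truncation of [d] makes the field globally Lipschitz and is
   inactive for small [h].  The constants do not depend on the subinterval
   [[a, b]] nor on the end [e] at which the deviation is prescribed. *)
Lemma feedback (B : R) : 0 <= B -> exists rho c : R, [/\ 0 < rho, 0 < c &
  forall a b e (S : R -> 'M[R]_n) (h : 'rV[R]_n), t0 <= a -> a <= b -> b <= T ->
    e = a \/ e = b ->
    (forall s, a <= s -> s <= b -> contw a b S s) ->
    (forall s, a <= s -> s <= b -> `|S s| <= B) -> `|h| <= rho ->
    exists d : R -> 'rV[R]_n, [/\ d e = h,
      forall s, a <= s -> s <= b -> `|d s| <= c * `|h|,
      forall s, a <= s -> s <= b -> `|graphU (S s) (d s)| <= r,
      absc a b d /\ forall s, a <= s -> s <= b -> derivw a b d s (gradp F (zb s + graphU (S s) (d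
        s)) - gradp F (zb s)) &
      trajectory F a b (fun s => xbar s + d s)]].
Proof.
move=> B0; pose D := 1 + n%:R * B.
have D0 : 0 < D by rewrite /D; have := mulr_ge0 (ler0n R n) B0; lra.
(* [D] bounds the norm of the graph map, so that deviations of size at most [rh]
   stay in the tube of radius [r]. *)
pose rh := r / D; have rh0 : 0 < rh by rewrite divr_gt0.
have rhD : D * rh = r by rewrite mulrC divfK// gt_eqF.
have NC0 : 0 <= N * C by rewrite mulr_ge0// ltW.
pose K := N * C * D + 1.
have K0 : 0 < K by rewrite /K; have := mulr_ge0 NC0 (ltW D0); lra.
pose E := expR (K * (T - t0)); have E0 : 0 < E by exact: expR_gt0.
exists (rh / E), E; split => //; first exact: divr_gt0.
move=> a b e S h t0a ab bT eab cS SB hrho.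
have hE : E * `|h| <= rh by rewrite mulrC -ler_pdivlMr.
pose G s d := gradp F (zb s + graphU (S s) (clip rh d)) - gradp F (zb s).
have inball s d : a <= s -> s <= b -> `|zb s + graphU (S s) (clip rh d) - zb s| <= r.
  move=> as_ sb; rewrite addrAC subrr add0r; apply: le_trans (graphU_le _ (SB s as_ sb)) _.
  by rewrite -rhD ler_pM2l// clip_le// ltW.
have center s : a <= s -> s <= b -> `|zb s - zb s| <= r by move=> _ _; rewrite subrr normr0 ltW.
have lG s u v : a <= s -> s <= b -> `|G s u - G s v| <= K * `|u - v|.
  move=> as_ sb; have sT : s <= T by lra. have t0s : t0 <= s by lra.
  rewrite /G opprB addrA subrK.
  apply: le_trans (gradp_lip t0s sT (inball s v as_ sb) (inball s u as_ sb)) _.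
  rewrite opprD addrACA subrr add0r graphUB.
  have h1 := le_trans (graphU_le (clip rh u - clip rh v) (SB s as_ sb)) (ler_wpM2l (ltW D0)
    (clip_lip rh u v)).
  apply: le_trans (ler_wpM2l NC0 h1) _; rewrite mulrA ler_wpM2r// /K; lra.
have cG v s : a <= s -> s <= b -> contw a b (G^~ v) s.
  move=> as_ sb; have sT : s <= T by lra. have t0s : t0 <= s by lra.
  have cz : contw a b zb s by apply: contw_sub (zb_contw t0s sT).
  rewrite /G; apply: contw_add.
    apply: gradp_contw; last by apply: (tube_p0 (tb t0s sT) n0); exact: inball.
    apply: contw_add => //; apply: contw_pair; first exact: contw_cst.
    apply: (@contw_lip _ _ _ S _ _ _ _ (n%:R * `|clip rh v|)) (cS s as_ sb) => u w.
    by rewrite -mulmxBr; exact: mulmx_norm_le.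
  apply: (@contw_lip _ _ _ (fun t => gradp F (zb t)) _ _ _ _ 1).
    by move=> u w; rewrite mul1r -opprD normrN.
  by apply: gradp_contw => //; apply: (tube_p0 (tb t0s sT) n0); exact: center.
have G0 s : G s 0 = 0.
  have -> : G s 0 = gradp F (zb s + graphU (S s) 0) - gradp F (zb s).
    by rewrite /G clip_id// normr0 ltW.
  have -> : zb s + graphU (S s) 0 = zb s.
    by rewrite /graphU mul0mx -[LHS]/(xbar s + 0, pbar s + 0) !addr0.
  by rewrite subrr.
have [d [de hd]] : exists d, d e = h /\ forall s, a <= s -> s <= b -> derivw a b d s (G s (d s)).
  by case: eab => ->; [exact: (ode_exists h ab K0 cG lG)|exact: (ode_exists_backward h ab K0 cG
    lG)].
have growth s : a <= s -> s <= b -> exists2 w, derivw a b d s w & `|w| <= K * `|d s| + 0.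
  move=> as_ sb; exists (G s (d s)); first exact: hd.
  by rewrite addr0; have := lG s (d s) 0 as_ sb; rewrite G0 !subr0.
have dle s : a <= s -> s <= b -> `|d s| <= E * `|h|.
  move=> as_ sb.
  have Ele x : 0 <= x -> x <= T - t0 -> (`|h| + 0 / K) * expR (K * x) <= E * `|h|.
    by move=> x0 xT; rewrite mul0r addr0 mulrC ler_wpM2r// ler_expR ler_pM2l.
  case: eab de => -> dh.
    apply: le_trans (@gronwall_derivw R _ d a s K 0 as_ K0 (lexx _) _) _.
      by move=> u au us; have [w hw wK] := growth u au ltac:(lra); exists w => //;
        apply: derivw_sub hw.
    by rewrite dh; apply: Ele; lra.
  apply: le_trans (@gronwall_derivw_backward R _ _ d s b K 0 sb K0 (lexx _) _) _.
    by move=> u su ub; have [w hw wK] := growth u ltac:(lra) ub; exists w => //;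
      apply: derivw_sub hw.
  by rewrite dh; apply: Ele; lra.
have cd s : a <= s -> s <= b -> clip rh (d s) = d s.
  by move=> as_ sb; apply: clip_id; apply: le_trans (dle s as_ sb) hE.
have hd' s : a <= s -> s <= b -> derivw a b d s (gradp F (zb s + graphU (S s) (d s)) - gradp F
  (zb s)).
  by move=> as_ sb; have := hd s as_ sb; rewrite /G cd.
have dr s : a <= s -> s <= b -> `|graphU (S s) (d s)| <= r.
  move=> as_ sb; apply: le_trans (graphU_le _ (SB s as_ sb)) _.
  by rewrite -rhD ler_pM2l//; apply: le_trans (dle s as_ sb) hE.
have dlip u v : a <= u -> u <= v -> v <= b -> `|d v - d u| <= K * (E * `|h|) * (v - u).
  apply: (@derivw_lipschitz _ _ a b) => s as_ sb; have [w hw wK] := growth s as_ sb; exists w => //.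
  by apply: le_trans wK _; rewrite addr0 ler_pM2l// dle.
exists d; split => //; first by split => //; exact: absc_lip dlip.
split; first by apply: (abs_continuous_add_lip dlip); exact: abs_continuous_sub acx.
have := ae_and hx (ae_and (ae_neq a) (ae_neq b)).
apply: ae_sub => s [hs [sa sb']] /andP[as_ sb].
have [dx xE] := hs ltac:(lra).
have as' : a < s by rewrite lt_neqAle eq_sym sa.
have sb'' : s < b by rewrite lt_neqAle sb'.
have D1 := derivw_add (derivable_derivw a b dx) (hd' s as_ sb).
have D2 := derivw_is_derive as' sb'' D1.
split; first exact: ex_derive.
rewrite derive1E derive_val xE subrKC.
have z2 : (zb s + graphU (S s) (d s)).2 != 0.
  apply: (tube_p0 (tb (s := s) _ _) n0); [lra|lra|].
  by rewrite addrAC subrr add0r; exact: dr.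
exact: (gradp_in HSH Hreg z2).
Qed.

End Feedback.

(** * Subjets and the Riccati field *)

Section Subjet.
Context {R : realType} {n : nat}.
Implicit Types (V : 'rV[R]_n -> R) (x q h : 'rV[R]_n) (Q : 'M[R]_n).

Lemma enorm_sqr_le h : enorm h ^+ 2 <= n%:R ^+ 2 * `|h| ^+ 2.
Proof. by rewrite -exprMn lerXn2r ?nnegrE ?enorm_ge0 ?mulr_ge0// enorm_le. Qed.

Lemma norm_sqr_le h : `|h| ^+ 2 <= enorm h ^+ 2.
Proof. by rewrite lerXn2r ?nnegrE ?enorm_ge0// norm_le_enorm. Qed.

(** The remainder in the definition may be taken to be the minimum of 0 and the
   difference between [V] and its quadratic model. *)
Lemma subjetP V x q Q : subjet V x (q, Q) <-> Q^T = Q /\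
  forall e : R, 0 < e -> exists2 d : R, 0 < d & forall h, `|h| <= d ->
    V x + dotp q h + 2^-1 * dotp (h *m Q^T) h - e * `|h| ^+ 2 <= V (x + h).
Proof.
rewrite /subjet /=; split=> [[QT [dl dl0 [rr hr hV]]]|[QT hV]]; split => //.
- move=> e e0.
  have N1 : 0 < n%:R ^+ 2 + 1 :> R by have := sqr_ge0 (n%:R : R); lra.
  have /eqoP /(_ _ (divr_gt0 e0 N1)) /nbhs_ballP[d /= d0 hd] := hr.
  have n1 : 0 < n%:R + 1 :> R by have := ler0n R n; lra.
  exists (Num.min (d / 2) (dl / (n%:R + 1))) => [|h]; first by rewrite lt_min !divr_gt0.
  rewrite le_min => /andP[h1 h2].
  have xh : x + h - x = h by rewrite addrAC subrr add0r.
  have he : enorm h <= dl.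
    apply: le_trans (enorm_le h) _.
    have : `|h| * (n%:R + 1) <= dl by rewrite -ler_pdivlMr.
    by have := normr_ge0 h; lra.
  have hh := hV (x + h); rewrite /eball /= xh in hh.
  have {}hh := hh he.
  have := hd (x + h); rewrite -ball_normE /= opprD addNKr normrN xh => hr'.
  have {hr'} : `|rr (x + h)| <= e / (n%:R ^+ 2 + 1) * `|enorm h ^+ 2| by apply: hr'; lra.
  rewrite (ger0_norm (sqr_ge0 _)) ler_norml => /andP[hr1 _].
  have : e / (n%:R ^+ 2 + 1) * enorm h ^+ 2 <= e * `|h| ^+ 2.
    rewrite mulrAC ler_pdivrMr// -mulrA ler_pM2l//.
    by have := enorm_sqr_le h; have := sqr_ge0 `|h|; lra.
  lra.
- pose rr y := Num.min 0 (V y - (V x + dotp q (y - x) + 2^-1 * dotp ((y - x) *m Q^T) (y - x))).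
  exists 1 => //; exists rr; last first.
    move=> y _.
    have : rr y <= V y - (V x + dotp q (y - x) + 2^-1 * dotp ((y - x) *m Q^T) (y - x)).
      by rewrite /rr ge_min lexx orbT.
    by lra.
  apply/eqoP => e e0; have [d d0 hd] := hV e e0.
  apply/nbhs_ballP; exists d => //= y; rewrite -ball_normE /= distrC => yd.
  rewrite (ger0_norm (sqr_ge0 _)).
  have := hd (y - x) (ltW yd); rewrite subrKC => h1.
  have h2 : e * `|y - x| ^+ 2 <= e * enorm (y - x) ^+ 2 by rewrite ler_pM2l// norm_sqr_le.
  have h3 : 0 <= e * enorm (y - x) ^+ 2 by rewrite mulr_ge0 ?sqr_ge0// ltW.
  have h4 : rr y <= 0 by rewrite /rr ge_min lexx.
  have h5 : - (e * enorm (y - x) ^+ 2) <= rr y by rewrite /rr le_min; apply/andP; split; lra.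
  by rewrite ler_norml h5; lra.
Qed.

End Subjet.

Section RiccatiDw.
Context {R : realType} {V : normedModType R}.

Lemma quotient_cvg_derivw (Q : R -> V) (a b t : R) (l : V) :
  ((fun s => (s - t)^-1 *: (Q s - Q t)) @ within `[a, b]%classic t^' --> l) <-> derivw a b Q t l.
Proof.
split=> [hl e e0|h].
- have /cvgrPdist_le /(_ e e0) := hl.
  move=> /nbhs_ballP[d /= d0 hd]; exists (d / 2) => [|u au ub ut]; first by rewrite divr_gt0.
  have [->|us0] := eqVneq u t; first by rewrite !subrr scale0r subr0 !normr0 mulr0.
  have us0' : u - t != 0 by rewrite subr_eq0.
  have := hd u; rewrite /ball /= distrC => hh.
  have {hh} : `|l - (u - t)^-1 *: (Q u - Q t)| <= e.
    by apply: hh => //; [lra | rewrite in_itv /= au].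
  have -> : Q u - Q t - (u - t) *: l = (u - t) *: ((u - t)^-1 *: (Q u - Q t) - l).
    by rewrite scalerBr scalerA mulfV// scale1r.
  by rewrite distrC normrZ mulrC => h; apply: ler_wpM2r.
- apply/cvgrPdist_le => e e0; have [d d0 hd] := h e e0.
  apply/nbhs_ballP; exists d => //= u; rewrite /ball /= distrC => ut us0.
  rewrite in_itv /= => /andP[au ub].
  have us0' : u - t != 0 by rewrite subr_eq0.
  rewrite distrC.
  have -> : (u - t)^-1 *: (Q u - Q t) - l = (u - t)^-1 *: (Q u - Q t - (u - t) *: l).
    by rewrite [in RHS]scalerBr scalerA mulVf// scale1r.
  by rewrite normrZ normfV ler_pdivrMl ?normr_gt0// mulrC; apply: hd => //; exact: ltW.
Qed.

End RiccatiDw.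

Section DotpMx.
Context {R : realType} {n : nat}.
Implicit Types (u v : 'rV[R]_n) (M : 'M[R]_n).

Lemma dotp_mulmx u v M : dotp (u *m M) v = \sum_i u 0 i * \sum_j v 0 j * M i j.
Proof.
rewrite /dotp; under eq_bigr do rewrite mxE mulr_suml.
rewrite exchange_big /=; apply: eq_bigr => i _; rewrite mulr_sumr; apply: eq_bigr => j _.
by rewrite -mulrA [M i j * _]mulrC.
Qed.

Lemma dotp_mulmxT u v M : dotp (u *m M) v = dotp u (v *m M^T).
Proof.
rewrite dotp_mulmx /dotp; apply: eq_bigr => i _; rewrite mxE; congr (_ * _).
by apply: eq_bigr => j _; rewrite mxE.
Qed.

(** The Hessian form is only ever evaluated at points of a graph
   [(d, d *m S)], where it becomes the sum of four bilinear terms. *)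
Lemma quad_blocks (H : 'I_n + 'I_n -> 'I_n + 'I_n -> R) (A B C D : 'M[R]_n) S (d : 'rV[R]_n) :
  (forall i j, A i j = H (inl i) (inl j)) -> (forall i j, B i j = H (inl i) (inr j)) ->
  (forall i j, C i j = H (inr i) (inl j)) -> (forall i j, D i j = H (inr i) (inr j)) ->
  \sum_k coordU k (graphU S d) * \sum_l coordU l (graphU S d) * H k l =
  dotp (d *m A) d + dotp (d *m B) (d *m S)
  + (dotp (d *m S *m C) d + dotp (d *m S *m D) (d *m S)).
Proof.
move=> hA hB hC hD.
have entry (M : 'M[R]_n) (G : 'I_n -> 'I_n -> R) (u v : 'rV[R]_n) :
    (forall i j, M i j = G i j) -> dotp (u *m M) v = \sum_i u 0 i * \sum_j v 0 j * G i j.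
  move=> MH; rewrite dotp_mulmx; apply: eq_bigr => i _; congr (_ * _).
  by apply: eq_bigr => j _; rewrite MH.
rewrite (entry A _ d d hA) (entry B _ d _ hB) (entry C _ _ d hC) (entry D _ _ _ hD).
rewrite -2!big_split [LHS]big_sumType; congr (_ + _); apply: eq_bigr => i _;
  by rewrite /= -mulrDr big_sumType.
Qed.

End DotpMx.

Section RiccatiFacts.
Context {R : realType} {n : nat}.
Notation U := ('rV[R]_n * 'rV[R]_n)%type.
Notation I := ('I_n + 'I_n)%type.
Variables (F : 'rV[R]_n -> set 'rV[R]_n) (xbar pbar : R -> 'rV[R]_n).
Let f (z : U) := hamiltonian F z.1 z.2.
Hypothesis Hreg : C21loc_on [set z : U | z.2 != 0] f.

Definition riccati_rhs (s : R) (Q : 'M[R]_n) : 'M[R]_n :=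
  - (Hpx F (xbar s) (pbar s) *m Q + Q *m Hxp F (xbar s) (pbar s)
       + Q *m Hpp F (xbar s) (pbar s) *m Q + Hxx F (xbar s) (pbar s)).

Lemma riccati_solutionP a b R0 Q : riccati_solution F xbar pbar a b R0 Q <->
  Q a = R0 /\ forall s, a <= s -> s <= b -> derivw a b Q s (riccati_rhs s (Q s)).
Proof.
split=> -[Qa h]; split => // s.
  by move=> as_ sb; apply/quotient_cvg_derivw; apply: h; rewrite as_.
by move=> /andP[as_ sb]; apply/quotient_cvg_derivw; exact: h.
Qed.

Section Pointwise.
Variables (x p : 'rV[R]_n) (r C : R).
Hypothesis n0 : (0 < n)%N.
Hypothesis r0 : 0 < r.
Hypothesis C0 : 0 < C.
Hypothesis tb : tube_bounds F (x, p) r C.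

Let ctr : `|(x, p) - (x, p)| <= r.
Proof. by rewrite subrr normr0 ltW. Qed.

Let p0 : p != 0.
Proof. exact: (tube_p0 tb n0 ctr). Qed.

Lemma HxpT : (Hxp F x p)^T = Hpx F x p.
Proof.
apply/matrixP => i j; rewrite [LHS]mxE.
exact: (etrans (Hxp_entry Hreg x j i p0)
  (etrans (tube_schwarz Hreg (inr j) (inl i) n0 r0 (ltW C0) tb) (esym (Hpx_entry Hreg x i j p0)))).
Qed.

Lemma HppT : (Hpp F x p)^T = Hpp F x p.
Proof.
apply/matrixP => i j; rewrite [LHS]mxE.
exact: (etrans (Hpp_entry Hreg x j i p0)
  (etrans (tube_schwarz Hreg (inr j) (inr i) n0 r0 (ltW C0) tb) (esym (Hpp_entry Hreg x i j p0)))).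
Qed.

Lemma HxxT : (Hxx F x p)^T = Hxx F x p.
Proof.
apply/matrixP => i j; rewrite [LHS]mxE.
exact: (etrans (Hxx_entry Hreg x j i p0)
  (etrans (tube_schwarz Hreg (inl j) (inl i) n0 r0 (ltW C0) tb) (esym (Hxx_entry Hreg x i j p0)))).
Qed.

Lemma hess_le : [/\ `|Hxx F x p| <= C, `|Hxp F x p| <= C, `|Hpx F x p| <= C & `|Hpp F x p| <= C].
Proof.
split; apply: mx_norm_le; rewrite ?ltW// => i j.
- by rewrite (Hxx_entry Hreg x _ _ p0); have [_ _ ->] := tb (inl i) (inl j) ctr.
- by rewrite (Hxp_entry Hreg x _ _ p0); have [_ _ ->] := tb (inr i) (inl j) ctr.
- by rewrite (Hpx_entry Hreg x _ _ p0); have [_ _ ->] := tb (inl i) (inr j) ctr.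
- by rewrite (Hpp_entry Hreg x _ _ p0); have [_ _ ->] := tb (inr i) (inr j) ctr.
Qed.

Lemma Hpp_ge0 (h : 'rV[R]_n) : SH F -> 0 <= dotp (h *m Hpp F x p) h.
Proof.
move=> HSH; rewrite dotp_mulmx.
under eq_bigr do under eq_bigr do rewrite (Hpp_entry Hreg x _ _ p0).
exact: (tube_convex HSH Hreg h n0 r0 (ltW C0) tb).
Qed.

Lemma quad_graphU S (d : 'rV[R]_n) :
  \sum_k coordU k (graphU S d) * \sum_l coordU l (graphU S d) * partial2 f k l (x, p) =
  dotp (d *m Hxx F x p) d + dotp (d *m Hpx F x p) (d *m S)
  + (dotp (d *m S *m Hxp F x p) d + dotp (d *m S *m Hpp F x p) (d *m S)).
Proof.
by apply: quad_blocks => i j; [exact: Hxx_entry|exact: Hpx_entry|exact: Hxp_entry|exact: Hpp_entry].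
Qed.

End Pointwise.
End RiccatiFacts.

(** * The quadratic model along the reference arc *)

Section MatrixCalculus.
Context {R : realType} {n : nat}.
Implicit Types (u v d p g : 'rV[R]_n) (A B D Q S X : 'M[R]_n).

Lemma trmx_norm_le m k (A : 'M[R]_(m, k)) : `|A^T| <= `|A|.
Proof. by apply: mx_norm_le => // i j; rewrite mxE mx_entry_le. Qed.

Lemma derivw_trmx (f : R -> 'M[R]_n) a b s V : derivw a b f s V -> derivw a b (fun t =>
  (f t)^T) s V^T.
Proof.
move=> h; apply: derivw_mx => i j; rewrite mxE.
have := derivw_entry j i h; congr derivw; apply/funext => t; by rewrite mxE.
Qed.

Lemma derivw_dotp (u v : R -> 'rV[R]_n) a b s u' v' : derivw a b u s u' -> derivw a b v s v' ->
  derivw a b (fun t => dotp (u t) (v t)) s (dotp u' (v s) + dotp (u s) v').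
Proof.
move=> hu hv; rewrite /dotp -big_split /=; apply: derivw_sum => i _.
exact: (derivw_mul (derivw_entry 0 i hu) (derivw_entry 0 i hv)).
Qed.

Lemma derivw_mulmx (u : R -> 'rV[R]_n) (S : R -> 'M[R]_n) a b s u' S' :
  derivw a b u s u' -> derivw a b S s S' ->
  derivw a b (fun t => u t *m S t) s (u' *m S s + u s *m S').
Proof.
move=> hu hS; apply: derivw_mx => i j.
have E : (fun t => (u t *m S t) i j) = (fun t => \sum_k u t i k * S t k j).
  by apply/funext => t; rewrite mxE.
rewrite E !mxE -big_split /=; apply: derivw_sum => k _.
exact: (derivw_mul (derivw_entry i k hu) (derivw_entry k j hS)).
Qed.

Lemma absc_dotp (u v : R -> 'rV[R]_n) a b : a <= b -> absc a b u -> absc a b v ->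
  absc a b (fun t => dotp (u t) (v t)).
Proof.
by move=> ab hu hv; rewrite /dotp; apply: absc_sum => i _; apply: absc_mul => //; exact: absc_entry.
Qed.

Lemma absc_dotp_mulmx (u : R -> 'rV[R]_n) (S : R -> 'M[R]_n) a b : a <= b ->
  absc a b u -> absc a b S -> absc a b (fun t => dotp (u t *m S t) (u t)).
Proof.
move=> ab hu hS.
apply: (@absc_eq _ _ _ _ (fun t => \sum_i u t 0 i * \sum_j u t 0 j * S t i j)).
  by move=> t _ _; rewrite dotp_mulmx.
apply: absc_sum => i _; apply: absc_mul => //; first exact: absc_entry.
by apply: absc_sum => j _; apply: absc_mul => //; exact: absc_entry.
Qed.

(** Both the uniqueness and the Lipschitz estimates for the quadratic field
   come from this factorization of its increments. *)
Lemma riccati_diff A B D X Q Q' :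
  - (A *m Q + Q *m B + Q *m D *m Q + X) - - (A *m Q' + Q' *m B + Q' *m D *m Q' + X) =
  - (A *m (Q - Q') + (Q - Q') *m B + ((Q - Q') *m D *m Q + Q' *m D *m (Q - Q'))).
Proof.
rewrite !mulmxBl !mulmxBr.
move: (A *m Q) (Q *m B) (Q *m D *m Q) (Q' *m B) (A *m Q') (Q' *m D *m Q') (Q' *m D *m Q).
by move=> M1 M2 M3 M4 M5 M6 M7; apply/matrixP => i j; rewrite !mxE; ring.
Qed.

Lemma riccati_diff_le A B D X Q Q' (C M : R) : `|A| <= C -> `|B| <= C -> `|D| <= C ->
  `|Q| <= M -> `|Q'| <= M ->
  `|- (A *m Q + Q *m B + Q *m D *m Q + X) - - (A *m Q' + Q' *m B + Q' *m D *m Q' + X)| <=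
  (2 * n%:R * C + 2 * n%:R ^+ 2 * C * M) * `|Q - Q'|.
Proof.
move=> AC BC DC QM QM'; rewrite riccati_diff normrN.
have prod (P1 P2 : 'M[R]_n) (b1 b2 : R) :
    `|P1| <= b1 -> `|P2| <= b2 -> `|P1 *m P2| <= n%:R * b1 * b2.
  move=> h1 h2; apply: le_trans (mulmx_norm_le _ _) _.
  by rewrite -!mulrA ler_wpM2l//; apply: ler_pM.
have h1 := prod _ _ _ _ AC (lexx `|Q - Q'|).
have h2 := prod _ _ _ _ (lexx `|Q - Q'|) BC.
have h3 := prod _ _ _ _ (prod _ _ _ _ (lexx `|Q - Q'|) DC) QM.
have h4 := prod _ _ _ _ (prod _ _ _ _ QM' DC) (lexx `|Q - Q'|).
apply: le_trans (ler_normD _ _) _.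
have h5 := ler_normD (A *m (Q - Q')) ((Q - Q') *m B).
have h6 := ler_normD ((Q - Q') *m D *m Q) (Q' *m D *m (Q - Q')).
apply: le_trans (lerD (le_trans h5 (lerD h1 h2)) (le_trans h6 (lerD h3 h4))) _.
by rewrite le_eqVlt; apply/orP; left; apply/eqP; ring.
Qed.

Lemma riccati_trmx A B D X Q : B^T = A -> D^T = D -> X^T = X ->
  (- (A *m Q + Q *m B + Q *m D *m Q + X))^T =
  - (A *m Q^T + Q^T *m B + Q^T *m D *m Q^T + X).
Proof.
move=> BA DT XT; have AB : A^T = B by rewrite -BA trmxK.
rewrite [LHS]linearN /=; congr (- _).
rewrite !linearD /= !trmx_mul AB BA DT XT mulmxA; congr (_ + _ + _); exact: addrC.
Qed.

(** The Riccati field is made to cancel the Hessian form, and the hypotheses on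
   [fz] and [f0] are Euler's identity at the two points; what is left is a second
   order Taylor remainder. *)
Lemma model_derivative A B D X S p d g g0 p' (fz f0 : R) : S^T = S ->
  fz = dotp (p + d *m S) g -> f0 = dotp p g0 ->
  - (dotp p' d + dotp p (g - g0))
   - 2^-1 * (dotp ((g - g0) *m S + d *m - (A *m S + S *m B + S *m D *m S + X)) d
             + dotp (d *m S) (g - g0))
  = - (fz - f0 - (dotp d (- p') + dotp (d *m S) g0)
       - 2^-1 * (dotp (d *m X) d + dotp (d *m A) (d *m S)
                 + (dotp (d *m S *m B) d + dotp (d *m S *m D) (d *m S)))).
Proof.
move=> ST -> ->.
rewrite (dotpDl ((g - g0) *m S)) (dotp_mulmxT (g - g0)) ST mulmxN dotpNl !mulmxDr !mulmxA !dotpDl.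
rewrite (dotp_mulmxT (d *m A)) (dotp_mulmxT (d *m S *m D)) ST.
rewrite dotpNr !dotpBr !dotpNl (dotpC p' d) (dotpC g (d *m S)) (dotpC g0 (d *m S)).
by field.
Qed.

End MatrixCalculus.

Section RiccatiAlongArc.
Context {R : realType} {n : nat}.
Notation U := ('rV[R]_n * 'rV[R]_n)%type.
Notation I := ('I_n + 'I_n)%type.
Variables (F : 'rV[R]_n -> set 'rV[R]_n) (t0 T : R) (xbar pbar : R -> 'rV[R]_n).
Let f (z : U) := hamiltonian F z.1 z.2.
Let zb s : U := (xbar s, pbar s).
Hypothesis n0 : (0 < n)%N.
Hypothesis HSH : SH F.
Hypothesis Hreg : C21loc_on [set z : U | z.2 != 0] f.
Hypothesis acp : abs_continuous t0 T pbar.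
Hypothesis hp : {ae (@lebesgue_measure R), forall s, t0 <= s <= T ->
  derivable pbar s 1 /\ forall i, (- derive1 pbar s) 0 i = partial1 f (inl i) (zb s)}.
Variables (r C : R).
Hypothesis r0 : 0 < r.
Hypothesis C0 : 0 < C.
Hypothesis tb : forall s, t0 <= s -> s <= T -> tube_bounds F (zb s) r C.
Let N : R := #|{: I}|%:R.

(** The transpose solves the same equation because the Hessian is symmetric;
   uniqueness is Gronwall's inequality for the difference. *)
Lemma riccati_symmetric a (Q : R -> 'M[R]_n) : t0 <= a -> a <= T -> (Q t0)^T = Q t0 ->
  (forall s, t0 <= s -> s <= a -> derivw t0 a Q s (riccati_rhs F xbar pbar s (Q s))) ->
  forall s, t0 <= s -> s <= a -> (Q s)^T = Q s.
Proof.
move=> t0a aT Q0 hQ s t0s sa.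
have [M M0 hM] := contw_bounded t0a (fun t h1 h2 => derivw_contw (hQ t h1 h2)).
pose E t := Q t - (Q t)^T.
pose K := 2 * n%:R * C + 2 * n%:R ^+ 2 * C * M + 1.
have N0 : 0 <= n%:R :> R by [].
have K0 : 0 < K.
  have : 0 <= n%:R * C by rewrite mulr_ge0// ltW.
  have : 0 <= n%:R ^+ 2 * C * M by rewrite !mulr_ge0// ltW.
  rewrite /K; lra.
have := @gronwall_derivw R _ E t0 s K 0 t0s K0 (lexx _).
rewrite /E Q0 subrr normr0 mul0r addr0 mul0r normr_le0 => h.
suff : Q s - (Q s)^T == 0 by rewrite subr_eq0 eq_sym => /eqP.
apply: h => u t0u us; have ua : u <= a by lra. have uT : u <= T by lra.
have hu := hQ u t0u ua.
exists (riccati_rhs F xbar pbar u (Q u) - (riccati_rhs F xbar pbar u (Q u))^T).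
  by apply: (@derivw_sub _ _ t0 a) => //; apply: derivw_diff => //; exact: derivw_trmx.
rewrite addr0 (riccati_trmx _ (HxpT Hreg n0 r0 C0 (tb t0u uT)) (HppT Hreg n0 r0 C0 (tb t0u uT))
  (HxxT Hreg n0 r0 C0 (tb t0u uT))).
have [_ h1 h2 h3] := hess_le Hreg n0 r0 C0 (tb t0u uT).
have QM := hM u t0u ua.
apply: le_trans (riccati_diff_le _ h2 h1 h3 QM (le_trans (trmx_norm_le _) QM)) _.
by apply: ler_wpM2r => //; rewrite /K lerDl ler01.
Qed.

Lemma riccati_absc a (Q : R -> 'M[R]_n) : t0 <= a -> a <= T ->
  (forall s, t0 <= s -> s <= a -> derivw t0 a Q s (riccati_rhs F xbar pbar s (Q s))) -> absc t0 a Q.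
Proof.
move=> t0a aT hQ.
have [BQ BQ0 hBQ] : exists2 K : R, 0 < K & forall s, t0 <= s -> s <= a -> `|riccati_rhs F xbar
  pbar s (Q s)| <= K.
  have [M' M'0 hM'] := contw_bounded t0a (fun t h1 h2 => derivw_contw (hQ t h1 h2)).
  have N0 : 0 <= n%:R :> R by [].
  pose K := n%:R * C * M' + n%:R * M' * C + n%:R * (n%:R * M' * C) * M' + C.
  exists (K + 1).
    by apply: ltr_wpDl => //; rewrite /K !(addr_ge0, mulr_ge0)// ltW.
  move=> s t0s sa; have sT : s <= T by lra.
  have [h0 h1 h2 h3] := hess_le Hreg n0 r0 C0 (tb t0s sT).
  have hQs := hM' s t0s sa.
  rewrite /riccati_rhs normrN.
  move: (Hpx _ _ _) (Hxp _ _ _) (Hpp _ _ _) (Hxx _ _ _) h2 h1 h3 h0 => A B D X hA hB hD hX.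
  have prod (P1 P2 : 'M[R]_n) (b1 b2 : R) :
      `|P1| <= b1 -> `|P2| <= b2 -> `|P1 *m P2| <= n%:R * b1 * b2.
    move=> k1 k2; apply: le_trans (mulmx_norm_le _ _) _.
    by rewrite -!mulrA ler_wpM2l//; apply: ler_pM.
  have g1 := prod _ _ _ _ hA hQs; have g2 := prod _ _ _ _ hQs hB.
  have g3 := prod _ _ _ _ (prod _ _ _ _ hQs hD) hQs.
  have k1 := ler_normD (A *m Q s + Q s *m B + Q s *m D *m Q s) X.
  have k2 := ler_normD (A *m Q s + Q s *m B) (Q s *m D *m Q s).
  have k3 := ler_normD (A *m Q s) (Q s *m B).
  rewrite /K; lra.
apply: (@derivw_absc _ _ _ _ _ BQ) => s t0s sa.
by exists (riccati_rhs F xbar pbar s (Q s)); [exact: hQ|exact: hBQ].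
Qed.

Lemma sum_graphU (S : 'M[R]_n) (d : 'rV[R]_n) (a : I -> R) :
  \sum_k coordU k (graphU S d) * a k =
  dotp d (\row_i a (inl i)) + dotp (d *m S) (\row_i a (inr i)).
Proof.
rewrite big_sumType; congr (_ + _); apply: eq_bigr => i _; by rewrite mxE.
Qed.

(** The derivative of [W] is minus a second order Taylor remainder, which is
   cubic in the size of the perturbation. *)
Lemma model_decrease a t (Q : R -> 'M[R]_n) (d : R -> 'rV[R]_n) (eta : R) :
  t0 <= t -> t <= a -> a <= T ->
  (forall s, t0 <= s -> s <= a -> derivw t0 a Q s (riccati_rhs F xbar pbar s (Q s))) ->
  (forall s, t0 <= s -> s <= a -> (Q s)^T = Q s) ->
  absc t0 t d ->
  (forall s, t0 <= s -> s <= t -> derivw t0 t d s (gradp F (zb s + graphU (Q s) (d s)) - gradp F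
    (zb s))) ->
  (forall s, t0 <= s -> s <= t -> `|graphU (Q s) (d s)| <= r) ->
  (forall s, t0 <= s -> s <= t -> `|graphU (Q s) (d s)| <= eta) ->
  forall W, W = (fun s => - dotp (pbar s) (d s) - 2^-1 * dotp (d s *m Q s) (d s)) ->
  W t <= W t0 + N ^+ 2 * C * eta ^+ 3 * (t - t0).
Proof.
move=> t0t ta aT hQ QT acd hd dr de.
have t0a : t0 <= a := le_trans t0t ta.
move=> W WE.
pose M := N ^+ 2 * C * eta ^+ 3.
suff : W t - t *: M <= W t0 - t0 *: M by rewrite /GRing.scale /= -/M; lra.
have acQ : absc t0 t Q := absc_sub (lexx t0) ta (riccati_absc t0a aT hQ).
have acp' : absc t0 t pbar by apply: (@absc_sub _ _ t0 T) => //; [lra|exact: abs_continuous_absc].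
rewrite {}WE.
apply: (@absc_straddle_le _ t0 t (fun s => - dotp (pbar s) (d s) - 2^-1 * dotp (d s *m Q s) (d s)
  - s *: M)) => //.
  have N1 (g : R -> R) : absc t0 t g -> absc t0 t (fun s => - g s).
    by move=> /(absc_scale (-1)) hg; apply: absc_eq hg => s _ _; rewrite scaleN1r.
  apply: absc_add; last by apply: N1; apply: (@derivw_absc _ _ _ _ _ `|M|) => s _ _; exists M =>
    //; exact: derivw_line.
  apply: absc_add; apply: N1; first exact: absc_dotp.
  by apply: (@absc_scale _ R^o); exact: absc_dotp_mulmx.
move: hp; apply: ae_sub => s hs /andP[t0s st].
have sT : s <= T by lra. have sa : s <= a by lra.
have [dp hpi] := hs ltac:(by rewrite t0s).
have Dp := derivable_derivw t0 t dp.
have DQ := derivw_sub (lexx t0) ta (hQ s t0s sa).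
have Dd := hd s t0s st.
have DW := derivw_diff (derivw_diff (derivw_opp (derivw_dotp Dp Dd))
  (derivw_scale (V := R^o) 2^-1 (derivw_dotp (derivw_mulmx Dd DQ) Dd))) (derivw_line t0 t (M :
    R^o) s).
apply: straddle_derivw DW.
have zz : `|zb s - zb s| <= r by rewrite subrr normr0 ltW.
have zd : `|zb s + graphU (Q s) (d s) - zb s| <= r by rewrite addrAC subrr add0r dr.
have sumE : \sum_k coordU k (graphU (Q s) (d s)) * partial1 f k (zb s) =
    dotp (d s) (- derive1 pbar s) + dotp (d s *m Q s) (gradp F (zb s)).
  rewrite (sum_graphU _ _ (fun k => partial1 f k (zb s))); congr (dotp _ _ + _).
  by apply/rowP => i; rewrite mxE hpi.
have tay := tube_taylor2 Hreg (tb t0s sT) (ltW C0) n0 zz zd.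
rewrite sumE (quad_graphU Hreg n0 r0 (tb t0s sT)) in tay.
have z2 := tube_p0 (tb t0s sT) n0 zd.
have z02 := tube_p0 (tb t0s sT) n0 zz.
have E1 := ham_euler HSH Hreg z2.
have E2 := ham_euler HSH Hreg z02.
have MD := model_derivative (Hpx F (xbar s) (pbar s)) (Hxp F (xbar s) (pbar s)) (Hpp F (xbar s)
  (pbar s)) (Hxx F (xbar s) (pbar s)) (derive1 pbar s) (QT s t0s sa) E1 E2.
have eta0 : 0 <= eta := le_trans (normr_ge0 _) (de s t0s st).
have l3 : N ^+ 2 * C * `|graphU (Q s) (d s)| ^+ 3 <= M.
  by rewrite /M ler_wpM2l ?mulr_ge0 ?sqr_ge0 ?(ltW C0)// lerXn2r ?nnegrE// de.
have := le_trans tay l3; rewrite ler_norml => /andP[h1 _].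
rewrite lerNl in h1.
have h2 := eq_ind_r (fun v => v <= M) h1 MD.
by rewrite subr_le0; exact: h2.
Qed.

End RiccatiAlongArc.

(** * Forward propagation of subjets *)

Section Propagation.
Context {R : realType} {n : nat}.
Notation U := ('rV[R]_n * 'rV[R]_n)%type.
Notation I := ('I_n + 'I_n)%type.
Variables (F : 'rV[R]_n -> set 'rV[R]_n) (phi : 'rV[R]_n -> R) (t0 T : R)
  (x0 : 'rV[R]_n) (xbar pbar : R -> 'rV[R]_n).
Let f (z : U) := hamiltonian F z.1 z.2.
Let zb s : U := (xbar s, pbar s).
Hypothesis n0 : (0 < n)%N.
Hypothesis HSH : SH F.
Hypothesis Hreg : C21loc_on [set z : U | z.2 != 0] f.
Hypothesis Hphi : locally_lipschitz_on setT phi.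
Hypothesis t0T : t0 <= T.
Hypothesis ox : optimal T F phi t0 x0 xbar.
Hypothesis acp : abs_continuous t0 T pbar.
Hypothesis hx : {ae (@lebesgue_measure R), forall s, t0 <= s <= T ->
  derivable xbar s 1 /\ derive1 xbar s = gradp F (zb s)}.
Hypothesis hp : {ae (@lebesgue_measure R), forall s, t0 <= s <= T ->
  derivable pbar s 1 /\ forall i, (- derive1 pbar s) 0 i = partial1 f (inl i) (zb s)}.
Variables (r C : R).
Hypothesis r0 : 0 < r.
Hypothesis C0 : 0 < C.
Hypothesis tb : forall s, t0 <= s -> s <= T -> tube_bounds F (zb s) r C.
Let N : R := #|{: I}|%:R.

Let acx : abs_continuous t0 T xbar.
Proof. by case: ox => -[[]]. Qed.

Let cp s : t0 <= s -> s <= T -> contw t0 T pbar s.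
Proof. exact: (absc_contw (abs_continuous_absc acp)). Qed.

(** With zero feedback gain the costate along the new arc is [pbar] itself.  These
   arcs show that admissible arcs exist from every point near the reference one,
   without which the value there would be a default value. *)
Lemma open_loop_forward : exists rho c : R, [/\ 0 < rho, 0 < c &
  forall t h, t0 <= t -> t <= T -> `|h| <= rho ->
    exists d : R -> 'rV[R]_n, [/\ d t = h,
      forall s, t <= s -> s <= T -> `|d s| <= c * `|h|,
      forall s, t <= s -> s <= T -> `|graphU 0 (d s)| <= r,
      forall s, t <= s -> s <= T -> derivw t T d s (gradp F (zb s + graphU 0 (d s)) - gradp F (zb
        s)) &
      admissible T F t (xbar t + h) (fun s => xbar s + d s)]].
Proof.
have [rho [c [rho0 c0 H]]] := feedback n0 HSH Hreg acx cp hx r0 C0 tb (lexx (0 : R)).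
exists rho, c; split => // t h t0t tT hr.
have [|||d [d1 d2 d3 [_ d4] d5]] := H t T t (fun=> 0) h t0t tT (lexx T) (or_introl (erefl t)).
- by move=> s _ _; exact: contw_cst.
- by move=> s _ _; rewrite normr0.
- exact: hr.
by exists d; split => //; split => //; rewrite d1.
Qed.

(** From [xbar t + h] a feedback arc is followed backward to time [t0], where
   the given subjet applies to [d t0 = O(|h|)]; the model transports the
   inequality back to time [t] with an error [O(|h| ^+ 3)]. *)
Lemma subjet_propagation a (Q : R -> 'M[R]_n) (R0 : 'M[R]_n) : t0 <= a -> a <= T -> R0^T = R0 ->
  Q t0 = R0 ->
  (forall s, t0 <= s -> s <= a -> derivw t0 a Q s (riccati_rhs F xbar pbar s (Q s))) ->
  subjet (value T F phi t0) x0 (- pbar t0, - R0) ->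
  forall t, t0 <= t -> t <= a -> subjet (value T F phi t) (xbar t) (- pbar t, - Q t).
Proof.
move=> t0a aT R0T Q0 hQ /subjetP[_ hV0] t t0t ta.
have Q0T : (Q t0)^T = Q t0 by rewrite Q0.
have QT := @riccati_symmetric _ _ F _ _ _ _ n0 Hreg _ _ r0 C0 tb a Q t0a aT Q0T hQ.
have tT : t <= T := le_trans ta aT.
apply/subjetP; split; first by rewrite linearN /= QT.
move=> e e0.
have cQ s : t0 <= s -> s <= a -> contw t0 a Q s by move=> h1 h2; exact: derivw_contw (hQ s h1 h2).
have [B B0 hB] := contw_bounded t0a cQ.
have [rho [c [rho0 c0 Hf]]] := feedback n0 HSH Hreg acx cp hx r0 C0 tb (ltW B0).
have [rho' [c' [rho'0 _ Hfwd]]] := open_loop_forward.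
pose D := 1 + n%:R * B.
have D0 : 0 < D by rewrite /D ltr_wpDr// mulr_ge0// ltW.
pose M := N ^+ 2 * C * (D * c) ^+ 3 * (t - t0) + 1.
have M0 : 0 < M.
  rewrite /M ltr_wpDl// !mulr_ge0 ?subr_ge0 ?exprn_ge0 ?mulr_ge0// ?sqr_ge0//; exact: ltW.
(* Half of [e] pays for the given subjet at [t0], the other half for the cubic
   drift of the model. *)
pose e1 := e / 2 / c ^+ 2.
have c20 : 0 < c ^+ 2 by rewrite exprn_gt0.
have e10 : 0 < e1 by rewrite !divr_gt0.
have [d1 d10 hd1] := hV0 e1 e10.
exists (Num.min rho (Num.min rho' (Num.min (d1 / c) (e / 2 / M)))).
  by rewrite !lt_min rho0 rho'0 !divr_gt0.
move=> h; rewrite !le_min => /and4P[h1 h2 h3 h4].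
have [|||d [dt dle dr [acd dD] dtr]] := Hf t0 t t Q h (lexx t0) t0t tT (or_intror (erefl t)).
- by move=> s t0s st; apply: contw_sub (cQ s t0s (le_trans st ta)).
- by move=> s t0s st; exact: hB (le_trans st ta).
- exact: h1.
have [dd [_ _ _ _ adm]] := Hfwd t h t0t tT h2.
have V1 := value_nondecreasing HSH Hphi t0t tT dtr.
rewrite /= dt in V1; have {}V1 := V1 (ex_intro _ _ adm).
have x0E : xbar t0 = x0 by case: ox => -[].
rewrite x0E in V1.
have Vt : value T F phi t (xbar t) = value T F phi t0 x0.
  by rewrite (value_along_optimal HSH Hphi t0t tT ox) (value_optimal HSH Hphi t0T ox).
have k0 := dle t0 (lexx t0) t0t.
have k1 : `|d t0| <= d1.
  by apply: le_trans k0 _; rewrite mulrC -ler_pdivlMr.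
have V0 := hd1 _ k1.
have W1 := @model_decrease _ _ F t0 T xbar pbar n0 HSH Hreg acp hp r C r0 C0 tb a t Q d (D * c *
  `|h|).
have {}W1 := W1 t0t ta aT hQ QT acd dD dr.
have lle s : t0 <= s -> s <= t -> `|graphU (Q s) (d s)| <= D * c * `|h|.
  move=> t0s st; apply: le_trans (graphU_le _ (hB s t0s (le_trans st ta))) _.
  by rewrite -mulrA ler_pM2l// dle.
have {}W1 := W1 lle _ (erefl _).
have QTt := QT t t0t ta.
rewrite dt in W1.
have e2 : N ^+ 2 * C * (D * c * `|h|) ^+ 3 * (t - t0) <= e / 2 * `|h| ^+ 2.
  have -> : N ^+ 2 * C * (D * c * `|h|) ^+ 3 * (t - t0) = (M - 1) * `|h| * `|h| ^+ 2.
    by rewrite /M addrK; ring.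
  apply: ler_wpM2r; first exact: sqr_ge0.
  have : `|h| * M <= e / 2 by rewrite -ler_pdivlMr.
  by have := normr_ge0 h; lra.
have e3 : e1 * `|d t0| ^+ 2 <= e / 2 * `|h| ^+ 2.
  have -> : e / 2 * `|h| ^+ 2 = e1 * (c * `|h|) ^+ 2.
    by rewrite /e1; field; rewrite gt_eqF.
  by rewrite ler_pM2l// lerXn2r// nnegrE// mulr_ge0// ltW.
rewrite linearN /= R0T mulmxN !dotpNl in V0.
rewrite Vt linearN /= QTt mulmxN !dotpNl.
rewrite Q0 in W1.
lra.
Qed.

End Propagation.

(** * Second differences of the value function *)

Section MidpointBound.
Context {R : realType} {n : nat}.

(** Split at the midpoint [m] of the two displaced points: semiconcavity
   controls the second difference around [m], the Lipschitz property the
   difference between [m] and [X]. *)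
Lemma semiconcave_second_difference (phi : 'rV[R]_n -> R) (X : 'rV[R]_n) :
  locally_lipschitz_on setT phi -> locally_semiconcave phi ->
  exists r c L : R, [/\ 0 < r, 0 <= c, 0 <= L & forall u v, `|u| <= r -> `|v| <= r ->
    phi (X + u) + phi (X + v) - 2 * phi X <= c * `|u - v| ^+ 2 + L * `|u + v|].
Proof.
move=> hl hs; have [r1 [L [r10 L0 hL]]] := locally_lipschitz_ball hl (I : setT X).
have [K nK [_ [c hc]]] := hs X.
have /nbhs_ballP [r2 /= r20 hr2] := nK.
exists (Num.min r1 (r2 / 3)), (`|c| * n%:R ^+ 2), L; split.
- by rewrite lt_min r10 divr_gt0.
- by rewrite mulr_ge0// sqr_ge0.
- exact: ltW.
move=> u v; rewrite !le_min => /andP[u1 u2] /andP[v1 v2].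
pose m := X + 2^-1 *: (u + v); pose k := 2^-1 *: (u - v).
have h2 (w : 'rV[R]_n) : 2^-1 *: (w + w) = w.
  rewrite scalerDr -scalerDl (_ : 2^-1 + 2^-1 = 1) ?scale1r//.
  by field.
have mk1 : m + k = X + u.
  by rewrite /m /k -addrA -scalerDr addrACA subrr addr0 h2.
have mk2 : m - k = X + v.
  by rewrite /m /k -addrA -scalerBr opprB [v - u]addrC addrACA subrr add0r h2.
have nuv : `|u + v| <= `|u| + `|v| := ler_normD _ _.
have nuv' : `|u - v| <= `|u| + `|v| := ler_normB _ _.
have half (w : 'rV[R]_n) : `|2^-1 *: w| = 2^-1 * `|w| by rewrite normrZ ger0_norm.
have seg : segment m k `<=` K.
  move=> _ [l + <-]; rewrite /= in_itv /= => l1; apply: hr2; rewrite -ball_normE /=.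
  have -> : X - (m + l *: k) = - (2^-1 *: (u + v) + l *: k).
    by rewrite /m -addrA opprD addNKr.
  rewrite normrN.
  apply: le_lt_trans (ler_normD _ _) _; rewrite half normrZ /k half.
  have l0 : `|l| <= 1 by rewrite ler_norml.
  have : `|l| * (2^-1 * `|u - v|) <= 2^-1 * `|u - v| by rewrite ler_piMl// mulr_ge0.
  lra.
have := hc m k seg; rewrite mk1 mk2.
have Ek : enorm k ^+ 2 <= n%:R ^+ 2 * `|u - v| ^+ 2.
  apply: le_trans (enorm_sqr_le _) _; rewrite ler_wpM2l ?sqr_ge0// half lerXn2r ?nnegrE ?mulr_ge0//.
  by have := normr_ge0 (u - v); lra.
have Ec : c * enorm k ^+ 2 <= `|c| * (n%:R ^+ 2 * `|u - v| ^+ 2).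
  apply: le_trans (ler_wpM2r (sqr_ge0 _) (ler_norm c)) _.
  by rewrite ler_wpM2l.
have mX : m - X = 2^-1 *: (u + v) by rewrite /m addrAC subrr add0r.
have : `|phi m - phi X| <= L * `|m - X|.
  apply: hL => //; last by rewrite subrr normr0 ltW.
  by rewrite mX half; lra.
rewrite mX half ler_norml => /andP[_ hm] hsc.
by rewrite mulrA in Ec; lra.
Qed.

End MidpointBound.

Section Bounds.
Context {R : realType} {n : nat}.
Notation U := ('rV[R]_n * 'rV[R]_n)%type.
Notation I := ('I_n + 'I_n)%type.
Variables (F : 'rV[R]_n -> set 'rV[R]_n) (phi : 'rV[R]_n -> R) (t0 T : R)
  (x0 : 'rV[R]_n) (xbar pbar : R -> 'rV[R]_n).
Let f (z : U) := hamiltonian F z.1 z.2.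
Let zb s : U := (xbar s, pbar s).
Hypothesis n0 : (0 < n)%N.
Hypothesis HSH : SH F.
Hypothesis Hreg : C21loc_on [set z : U | z.2 != 0] f.
Hypothesis Hphi : locally_lipschitz_on setT phi.
Hypothesis ox : optimal T F phi t0 x0 xbar.
Hypothesis acp : abs_continuous t0 T pbar.
Hypothesis hx : {ae (@lebesgue_measure R), forall s, t0 <= s <= T ->
  derivable xbar s 1 /\ derive1 xbar s = gradp F (zb s)}.
Variables (r C : R).
Hypothesis r0 : 0 < r.
Hypothesis C0 : 0 < C.
Hypothesis tb : forall s, t0 <= s -> s <= T -> tube_bounds F (zb s) r C.
Let N : R := #|{: I}|%:R.

Lemma graphU0_norm (d : 'rV[R]_n) : `|graphU 0 d| = `|d|.
Proof. by rewrite /graphU mulmx0 prod_normE /= normr0 max_l. Qed.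

(** The first order terms at [u] and [v] add up to the one at [u + v], and the
   remainders are quadratic. *)
Lemma gradp_second_difference s (u v : 'rV[R]_n) (eta : R) : t0 <= s -> s <= T ->
  `|u| <= r -> `|v| <= r -> `|u| <= eta -> `|v| <= eta ->
  `|(gradp F (zb s + graphU 0 u) - gradp F (zb s)) + (gradp F (zb s + graphU 0 v) - gradp F (zb s))|
  <= N * C * `|u + v| + 2 * (N * C * eta ^+ 2).
Proof.
move=> t0s sT ur vr ue ve.
have eta0 : 0 <= eta := le_trans (normr_ge0 _) ue.
have NC0 : 0 <= N * C by rewrite mulr_ge0// ltW.
apply: mx_norm_le => [|i j]; first by rewrite !(addr_ge0, mulr_ge0, sqr_ge0)// ltW.
have ctr : `|zb s - zb s| <= r by rewrite subrr normr0 ltW.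
have shift (w : 'rV[R]_n) : `|w| <= r -> `|zb s + graphU 0 w - zb s| <= r.
  by rewrite addrAC subrr add0r graphU0_norm.
have T1 := tube_taylor1 Hreg (tb t0s sT) (ltW C0) (inr j) n0 ctr (shift u ur).
have T2 := tube_taylor1 Hreg (tb t0s sT) (ltW C0) (inr j) n0 ctr (shift v vr).
have sq (w : 'rV[R]_n) : `|w| <= eta -> N * C * `|graphU 0 w| ^+ 2 <= N * C * eta ^+ 2.
  by move=> we; rewrite graphU0_norm; apply: ler_wpM2l => //; apply: lerXn2r => //; rewrite nnegrE.
pose S w := \sum_l coordU l (graphU 0 w) * partial2 f (inr j) l (zb s).
have {}T1 : `|partial1 f (inr j) (zb s + graphU 0 u) - partial1 f (inr j) (zb s) - S u| <= N * C
  * eta ^+ 2.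
  exact: le_trans T1 (sq u ue).
have {}T2 : `|partial1 f (inr j) (zb s + graphU 0 v) - partial1 f (inr j) (zb s) - S v| <= N * C
  * eta ^+ 2.
  exact: le_trans T2 (sq v ve).
have lin : S u + S v = S (u + v).
  have liftD : graphU 0 u + graphU 0 v = graphU 0 (u + v).
    by rewrite /graphU !mulmx0 -[LHS]/(u + v, 0 + 0) addr0.
  by rewrite /S -(sum_coordD _ _ (fun l => partial2 f (inr j) l (zb s))) liftD.
have hC l : `|partial2 f (inr j) l (zb s)| <= C.
  by have [_ _ h _] := tb t0s sT (inr j) l ctr.
have bnd : `|S (u + v)| <= N * C * `|u + v|.
  have := sum_coord_le coordU_le (graphU 0 (u + v)) hC.
  by rewrite graphU0_norm.
have ent (M1 M2 M3 : 'rV[R]_n) : (M1 - M2 + (M3 - M2)) i j = M1 i j - M2 i j + (M3 i j - M2 i j).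
  by rewrite !mxE.
have gE z : gradp F z i j = partial1 f (inr j) z by rewrite mxE.
rewrite ent !gE.
move: (partial1 f _ (zb s + graphU 0 u)) (partial1 f _ (zb s + graphU 0 v)) (partial1 f _ (zb s))
  T1 T2 => g1 g2 g T1 T2.
rewrite -lin in bnd; move: (S u) (S v) T1 T2 bnd => S1 S2 T1 T2 bnd.
have -> : g1 - g + (g2 - g) = (g1 - g - S1) + (g2 - g - S2) + (S1 + S2) by ring.
apply: le_trans (ler_normD _ _) _.
rewrite [leRHS]addrC lerD//.
by apply: le_trans (ler_normD _ _) _; rewrite mulr_natl mulr2n lerD.
Qed.

(** Run the open loop arcs from [xbar t + h] and [xbar t - h].  The sum of their
   deviations starts at 0 and is driven by second differences of the field, so
   that it stays [O(|h| ^+ 2)], while each deviation is [O(|h|)]. *)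
Lemma value_second_difference : locally_semiconcave phi ->
  exists2 c : R, 0 <= c & forall t, t0 <= t -> t <= T -> exists2 rho : R, 0 < rho &
    forall h, `|h| <= rho -> value T F phi t (xbar t + h) + value T F phi t (xbar t - h)
       - 2 * value T F phi t (xbar t) <= c * `|h| ^+ 2.
Proof.
move=> hsc.
have [rho [c [rho0 c0 Hf]]] := open_loop_forward n0 HSH Hreg ox acp hx r0 C0 tb.
have [r1 [cs [L [r10 cs0 L0 Hphi2]]]] := semiconcave_second_difference (xbar T) Hphi hsc.
have NC0 : 0 <= N * C by rewrite mulr_ge0// ltW.
pose K := N * C + 1.
have K0 : 0 < K by rewrite ltr_wpDl.
pose E := expR (K * (T - t0)).
have E0 : 0 < E := expR_gt0 _.
pose c2 := 2 * (N * C * c ^+ 2) / K * E.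
have c20 : 0 <= c2 by rewrite /c2 !mulr_ge0 ?invr_ge0 ?sqr_ge0// ltW.
exists (cs * (4 * c ^+ 2) + L * c2).
  by apply: addr_ge0; apply: mulr_ge0 => //; apply: mulr_ge0 => //; exact: sqr_ge0.
move=> t t0t tT; exists (Num.min rho (r1 / c)); first by rewrite lt_min rho0 divr_gt0.
move=> h; rewrite le_min => /andP[hrho hr1].
have [d1 [d1t d1c d1r d1D adm1]] := Hf t h t0t tT hrho.
have hrho' : `|- h| <= rho by rewrite normrN.
have [d2 [d2t d2c d2r d2D adm2]] := Hf t (- h) t0t tT hrho'.
have V1 := value_le HSH Hphi tT adm1.
have V2 := value_le HSH Hphi tT adm2.
have V0 := value_along_optimal HSH Hphi t0t tT ox.
have TT := lexx T.
have n1 := d1c T tT TT; have n2 := d2c T tT TT; rewrite normrN in n2.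
have chr : c * `|h| <= r1 by rewrite mulrC -ler_pdivlMr.
have P2 := Hphi2 _ _ (le_trans n1 chr) (le_trans n2 chr).
have wT : `|d1 T + d2 T| <= c2 * `|h| ^+ 2.
  have := @gronwall_derivw R _ (fun s => d1 s + d2 s) t T K (2 * (N * C * (c * `|h|) ^+ 2)) tT K0.
  rewrite d1t d2t subrr normr0 add0r => G.
  apply: le_trans (G _ _) _.
  - by rewrite !mulr_ge0 ?sqr_ge0// ltW.
  - move=> s ts sT; have t0s := le_trans t0t ts.
    exists ((gradp F (zb s + graphU 0 (d1 s)) - gradp F (zb s)) + (gradp F (zb s + graphU 0 (d2
      s)) - gradp F (zb s))).
      by apply: derivw_add; [exact: d1D|exact: d2D].
    have m1 := d1c s ts sT; have m2 := d2c s ts sT; rewrite normrN in m2.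
    have k1 := d1r s ts sT; have k2 := d2r s ts sT; rewrite !graphU0_norm in k1 k2.
    apply: le_trans (gradp_second_difference t0s sT k1 k2 m1 m2) _.
    by rewrite lerD2r ler_wpM2r// /K lerDl.
  have EE : expR (K * (T - t)) <= E by rewrite ler_expR ler_pM2l//; lra.
  have -> : c2 * `|h| ^+ 2 = 2 * (N * C * (c * `|h|) ^+ 2) / K * E.
    by rewrite /c2; field; rewrite gt_eqF.
  by rewrite ler_wpM2l// divr_ge0 ?(ltW K0)// mulr_ge0// mulr_ge0// sqr_ge0.
have uv : `|d1 T - d2 T| ^+ 2 <= 4 * c ^+ 2 * `|h| ^+ 2.
  have -> : 4 * c ^+ 2 * `|h| ^+ 2 = (2 * (c * `|h|)) ^+ 2 by ring.
  have ch0 : 0 <= c * `|h| := le_trans (normr_ge0 _) n1.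
  rewrite lerXn2r// ?nnegrE ?mulr_ge0 ?(ltW c0)//; apply: le_trans (ler_normB _ _) _.
  by rewrite mulr_natl mulr2n lerD.
rewrite V0; move: V1 V2 P2 => /=.
move: (value _ _ _ _ _) (value _ _ _ _ _) (phi (_ + d1 T)) (phi (_ + d2 T)) (phi (xbar T)) =>
  v1 v2 p1 p2 p0 V1 V2 P2.
have k1 := ler_wpM2l cs0 uv; have k2 := ler_wpM2l L0 wT.
have -> : (cs * (4 * c ^+ 2) + L * c2) * `|h| ^+ 2 = cs * (4 * c ^+ 2 * `|h| ^+ 2) + L * (c2 *
  `|h| ^+ 2).
  by ring.
move: V1 V2 (le_trans P2 (lerD k1 k2)); lra.
Qed.

(** Add the subjet inequalities at small multiples of [h] and [- h]: the
   linear terms cancel and only the quadratic form remains. *)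
Lemma subjet_lower_bound (V : 'rV[R]_n -> R) x q (Q : 'M[R]_n) (c rho : R) : 0 < rho ->
  (forall h, `|h| <= rho -> V (x + h) + V (x - h) - 2 * V x <= c * `|h| ^+ 2) ->
  subjet V x (q, - Q) -> forall h, - dotp (h *m Q) h <= c * `|h| ^+ 2.
Proof.
move=> rho0 hV /subjetP[QT hQ] h.
have {}QT : Q^T = Q by apply: oppr_inj; rewrite -linearN.
apply/ler_addgt0Pl => e e0.
have h10 : 0 < `|h| ^+ 2 + 1 by have := sqr_ge0 `|h|; lra.
have e10 : 0 < e / 2 / (`|h| ^+ 2 + 1) by rewrite !divr_gt0.
have [d d0 hd] := hQ _ e10.
have h1 : 0 < `|h| + 1 by have := normr_ge0 h; lra.
pose t := Num.min rho d / (`|h| + 1).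
have t0' : 0 < t by rewrite divr_gt0// lt_min rho0.
have th : `|t *: h| <= Num.min rho d.
  rewrite normrZ gtr0_norm// /t mulrAC ler_pdivrMr// ler_wpM2l//; last by lra.
  by rewrite le_min !ltW.
move: th; rewrite le_min => /andP[th1 th2].
have A1 := hd (t *: h) th2; have A2 := hd (- (t *: h)) ltac:(by rewrite normrN).
have A3 := hV (t *: h) th1.
have quadE k : dotp (k *m (- Q)^T) k = - dotp (k *m Q) k by rewrite linearN /= QT mulmxN dotpNl.
have quadN k : dotp (- k *m Q) (- k) = dotp (k *m Q) k.
  by rewrite mulNmx dotpNl dotpNr opprK.
have quadZ : dotp ((t *: h) *m Q) (t *: h) = t * (t * dotp (h *m Q) h).
  by rewrite -scalemxAl dotpZl dotpZr.
have nt : `|t *: h| ^+ 2 = t ^+ 2 * `|h| ^+ 2 by rewrite normrZ gtr0_norm// exprMn.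
rewrite quadE quadZ nt in A1; rewrite quadE quadN quadZ dotpNr normrN nt in A2; rewrite nt in A3.
move: (V (x + _)) (V (x - _)) (V x) (dotp (h *m _) _) (dotp q _) A1 A2 A3 => v1 v2 v0 D qh A1 A2 A3.
have t2 : 0 < t ^+ 2 by rewrite exprn_gt0.
have hh := div_succ_le (ltW (divr_gt0 e0 (ltr0Sn R 1))) (sqr_ge0 `|h|).
suff : t ^+ 2 * - D <= t ^+ 2 * (e + c * `|h| ^+ 2) by rewrite ler_pM2l.
have := ler_wpM2l (ltW t2) hh.
move: (e / 2 / _) A1 A2 => e1 A1 A2 hh'.
rewrite expr2 in A1 A2 A3 hh' *; lra.
Qed.

End Bounds.

(** * Global solutions of the Riccati equation *)

Section TraceBound.
Context {R : realType} {n : nat}.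
Implicit Types (M Q D : 'M[R]_n).

Lemma dotp_delta_mulmx M i j : dotp (delta_mx 0 i *m M) (delta_mx 0 j) = M i j.
Proof. by rewrite dotp_delta -rowE mxE. Qed.

(** Test the form at [e_i], which bounds the diagonal, and at [e_i + e_j] and
   [e_i - e_j]. *)
Lemma psd_norm_le_trace M : M^T = M -> (forall h, 0 <= dotp (h *m M) h) -> `|M| <= \tr M.
Proof.
move=> MT psd.
have diag i : 0 <= M i i by have := psd (delta_mx 0 i); rewrite dotp_delta_mulmx.
have tr i : M i i <= \tr M.
  by rewrite /mxtrace (bigD1 i)//= lerDl sumr_ge0.
apply: mx_norm_le => [|i j]; first exact: sumr_ge0.
have sym : M j i = M i j by rewrite -[in LHS]MT mxE.
have h1 := psd (delta_mx 0 i + delta_mx 0 j).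
have h2 := psd (delta_mx 0 i - delta_mx 0 j).
rewrite mulmxDl !dotpDl !dotpDr !dotp_delta_mulmx sym in h1.
rewrite mulmxBl !dotpBl !dotpBr !dotp_delta_mulmx sym in h2.
by have := tr i; have := tr j; rewrite ler_norml; lra.
Qed.

Lemma trace_le M : \tr M <= n%:R * `|M|.
Proof.
rewrite /mxtrace; apply: (@le_trans _ _ (\sum_(i < n) `|M|)).
  by apply: ler_sum => i _; apply: le_trans (ler_norm _) _; exact: mx_entry_le.
by rewrite sumr_const card_ord mulr_natl.
Qed.

Lemma trace_conj_ge0 Q D : Q^T = Q -> (forall h, 0 <= dotp (h *m D) h) -> 0 <= \tr (Q *m D *m Q).
Proof.
move=> QT psd; apply: sumr_ge0 => i _.
rewrite -dotp_delta_mulmx !mulmxA dotp_mulmxT QT; exact: psd.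
Qed.

Lemma derivw_upper (f : R -> R) a b s v : derivw a b f s v -> forall e : R,
  0 < e -> exists2 d : R, 0 < d &
  forall u w, a <= u -> u <= s -> s <= w -> w <= b -> w - u <= d -> f w - f u <= (v + e) * (w - u).
Proof.
move=> h e e0.
have hD := derivw_diff h (derivw_line a b (v : R^o) s).
have v0 : v - v <= 0 by rewrite subrr.
have [d d0 hd] := straddle_derivw v0 hD e0.
exists d => // u w au us sw wb wu; have := hd u w au us sw wb wu.
by rewrite /GRing.scale /=; lra.
Qed.

Lemma derivw_trace (Q : R -> 'M[R]_n) a b s V : derivw a b Q s V -> derivw a b (fun t =>
  \tr (Q t)) s (\tr V).
Proof. by move=> h; apply: derivw_sum => i _; exact: derivw_entry. Qed.

Lemma absc_trace (Q : R -> 'M[R]_n) a b : absc a b Q -> absc a b (fun t => \tr (Q t)).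
Proof. by move=> h; apply: absc_sum => i _; exact: absc_entry. Qed.

(** The term quadratic in [Q] would spoil a linear bound, but its trace has the
   favorable sign since [D] is nonnegative. *)
Lemma trace_riccati_le A B D X Q (C m : R) : Q^T = Q -> (forall h, 0 <= dotp (h *m D) h) ->
  `|A| <= C -> `|B| <= C -> `|X| <= C -> `|Q| <= m ->
  \tr (- (A *m Q + Q *m B + Q *m D *m Q + X)) <= 2 * n%:R ^+ 2 * C * m + n%:R * C.
Proof.
move=> QT psd hA hB hX hQ.
have n0 : 0 <= n%:R :> R by [].
have C0 : 0 <= C := le_trans (normr_ge0 _) hA.
have m0 : 0 <= m := le_trans (normr_ge0 _) hQ.
have tN (M : 'M[R]_n) b : `|M| <= b -> - \tr M <= n%:R * b.
  move=> hM; have -> : - \tr M = \tr (- M) by rewrite linearN.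
  by apply: le_trans (trace_le _) _; rewrite normrN ler_wpM2l.
have prod (M1 M2 : 'M[R]_n) b1 b2 : `|M1| <= b1 -> `|M2| <= b2 -> `|M1 *m M2| <= n%:R * (b1 * b2).
  move=> h1 h2; apply: le_trans (mulmx_norm_le _ _) _.
  by rewrite -mulrA ler_wpM2l//; apply: ler_pM.
have k1 := tN _ _ (prod _ _ _ _ hA hQ); have k2 := tN _ _ (prod _ _ _ _ hQ hB).
have k3 := trace_conj_ge0 QT psd; have k4 := tN _ _ hX.
rewrite linearN !linearD /=.
have -> : 2 * n%:R ^+ 2 * C * m + n%:R * C = n%:R * (n%:R * (C * m)) + n%:R * (n%:R * (m * C)) +
  n%:R * C.
  by ring.
move: (\tr _) (\tr _) (\tr _) (\tr _) k1 k2 k3 k4 => T1 T2 T3 T4 k1 k2 k3 k4.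
lra.
Qed.

End TraceBound.

Section Global.
Context {R : realType} {n : nat}.
Notation U := ('rV[R]_n * 'rV[R]_n)%type.
Notation I := ('I_n + 'I_n)%type.
Variables (F : 'rV[R]_n -> set 'rV[R]_n) (t0 T : R) (xbar pbar : R -> 'rV[R]_n).
Let f (z : U) := hamiltonian F z.1 z.2.
Let zb s : U := (xbar s, pbar s).
Hypothesis n0 : (0 < n)%N.
Hypothesis HSH : SH F.
Hypothesis Hreg : C21loc_on [set z : U | z.2 != 0] f.
Hypothesis t0T : t0 <= T.
Hypothesis czb : forall s, t0 <= s -> s <= T -> contw t0 T zb s.
Variables (r C : R).
Hypothesis r0 : 0 < r.
Hypothesis C0 : 0 < C.
Hypothesis tb : forall s, t0 <= s -> s <= T -> tube_bounds F (zb s) r C.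

(** The lower bound on the form makes [Q + c I] nonnegative, hence controlled by
   its trace, which satisfies a linear differential inequality. *)
Lemma riccati_bound (c m0 : R) : 0 <= c -> exists2 B : R, m0 <= B &
  forall u (Q : R -> 'M[R]_n), t0 <= u -> u <= T ->
    (forall s, t0 <= s -> s <= u -> derivw t0 u Q s (riccati_rhs F xbar pbar s (Q s))) ->
    (forall s, t0 <= s -> s <= u -> (Q s)^T = Q s) ->
    (forall s, t0 <= s -> s <= u -> forall h, - dotp (h *m Q s) h <= c * `|h| ^+ 2) ->
    `|Q t0| <= m0 -> `|Q u| <= B.
Proof.
move=> c0.
have N0 : 0 <= n%:R :> R by [].
pose K := 2 * n%:R ^+ 2 * C + 1.
pose eps := 2 * n%:R ^+ 2 * C * c + n%:R * C.
have K0 : 0 < K.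
  by rewrite ltr_wpDl// mulr_ge0 ?(ltW C0)// mulr_ge0// sqr_ge0.
have eps0 : 0 <= eps.
  by rewrite addr_ge0 ?mulr_ge0 ?(ltW C0)//; rewrite sqr_ge0.
pose E := expR (K * (T - t0)).
exists (Num.max m0 ((n%:R * m0 + n%:R * c + eps / K) * E + c)); first by rewrite le_max lexx.
move=> u Q t0u uT hQ QT lower Q0.
pose q s := \tr (Q s) + n%:R * c.
have bound s : t0 <= s -> s <= u -> 0 <= q s /\ `|Q s| <= q s + c.
  move=> t0s su; pose M := Q s + c%:M.
  have MT : M^T = M by rewrite linearD /= QT// tr_scalar_mx.
  have psd h : 0 <= dotp (h *m M) h.
    rewrite mulmxDr mul_mx_scalar dotpDl dotpZl.
    have := lower s t0s su h; have := ler_wpM2l c0 (norm_sqr_le h); rewrite enorm_sqr; lra.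
  have trM : \tr M = q s by rewrite /M mxtraceD mxtrace_scalar /q mulr_natl.
  have Mq := psd_norm_le_trace MT psd; rewrite trM in Mq.
  split; first exact: le_trans (normr_ge0 _) Mq.
  apply: mx_norm_le => [|i j]; first by have := normr_ge0 M; lra.
  have -> : Q s i j = M i j - (c%:M : 'M[R]_n) i j by rewrite !mxE addrK.
  apply: le_trans (ler_normB _ _) _; apply: lerD; first exact: le_trans (mx_entry_le M i j) Mq.
  by rewrite mxE; case: (i == j); rewrite ?mulr1n ?mulr0n ?normr0// ger0_norm.
have acQ := riccati_absc n0 Hreg r0 C0 tb t0u uT hQ.
have G : q u <= (q t0 + eps / K) * expR (K * (u - t0)).
  apply: (@gronwall R q t0 u K eps t0u K0 eps0).
  - by move=> s t0s su; have [] := bound s t0s su.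
  - by apply: absc_add; [exact: absc_trace|exact: absc_cst].
  - apply: ae_all => s /andP[t0s su] e e0; have sT := le_trans su uT.
    have DT := derivw_add (derivw_trace (hQ s t0s su)) (derivw_cst t0 u (n%:R * c : R^o) s).
    have [d d0 hd] := derivw_upper DT e0; exists d => // a b ta ts sb bu ba.
    apply: le_trans (hd a b ta ts sb bu ba) _; apply: ler_wpM2r; first by lra.
    rewrite addr0 lerD2r.
    have [h0 h1 h2 h3] := hess_le Hreg n0 r0 C0 (tb t0s sT).
    have [q0 Qq] := bound s t0s su.
    apply: le_trans (trace_riccati_le (QT s t0s su) (fun h =>
      Hpp_ge0 Hreg n0 r0 C0 (tb t0s sT) h HSH) h2 h1 h0 Qq) _.
    have -> : 2 * n%:R ^+ 2 * C * (q s + c) + n%:R * C = K * q s + eps - q s by rewrite /K /eps;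
      ring.
    by rewrite gerBl.
have [q0 Q0q] := bound t0 (lexx t0) t0u.
have [qu Quq] := bound u t0u (lexx u).
rewrite le_max; apply/orP; right; apply: le_trans Quq _; rewrite lerD2r.
apply: le_trans G _.
have qt0 : q t0 <= n%:R * m0 + n%:R * c.
  by rewrite /q lerD2r; apply: le_trans (trace_le _) _; rewrite ler_wpM2l.
apply: ler_pM; [|exact: expR_ge0| |].
- by rewrite addr_ge0// divr_ge0// ltW.
- by rewrite lerD2r.
- by rewrite ler_expR ler_pM2l//; lra.
Qed.

Lemma partial2_contw k l s : t0 <= s -> s <= T -> contw t0 T (fun t => partial2 f k l (zb t)) s.
Proof.
move=> t0s sT e e0.
have eC : 0 < Num.min r (e / C) by rewrite lt_min r0 divr_gt0.
have [d d0 hd] := czb t0s sT eC; exists d => // u t0u uT us.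
have := hd u t0u uT us; rewrite le_min => /andP[h1 h2].
have ctr : `|zb s - zb s| <= r by rewrite subrr normr0 ltW.
have [_ _ _ h] := tb t0s sT k l h1.
by apply: le_trans (h _ ctr) _; rewrite mulrC -ler_pdivlMr.
Qed.

Lemma pbar_neq0 s : t0 <= s -> s <= T -> pbar s != 0.
Proof.
move=> t0s sT; have ctr : `|zb s - zb s| <= r by rewrite subrr normr0 ltW.
exact: (tube_p0 (tb t0s sT) n0 ctr).
Qed.

Lemma contw_eq (V : normedModType R) (g h : R -> V) a b s : a <= s -> s <= b ->
  (forall t, a <= t -> t <= b -> g t = h t) -> contw a b g s -> contw a b h s.
Proof.
move=> as_ sb gh hg e e0; have [d d0 hd] := hg e e0; exists d => // u au ub us.
by rewrite -!gh//; exact: hd.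
Qed.

Lemma hessian_contw (H : 'rV[R]_n -> 'rV[R]_n -> 'M[R]_n) (k l : 'I_n -> I) s :
  (forall y p i j, p != 0 -> H y p i j = partial2 f (k i) (l j) (y, p)) ->
  t0 <= s -> s <= T -> contw t0 T (fun t => H (xbar t) (pbar t)) s.
Proof.
move=> hH t0s sT; apply: contw_mx => i j.
apply: (@contw_eq _ (fun t => partial2 f (k i) (l j) (zb t))) => //; last exact: partial2_contw.
by move=> t t0t tT; rewrite hH//; exact: pbar_neq0.
Qed.

Lemma contw_mulmx (A B : R -> 'M[R]_n) a b s : contw a b A s -> contw a b B s ->
  contw a b (fun t => A t *m B t) s.
Proof.
move=> hA hB.
have hBB : contw a b (fun t => A s *m B t) s.
  apply: (@contw_lip _ _ _ B _ _ _ _ (n%:R * `|A s|)) hB => u v.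
  by rewrite -mulmxBr; exact: mulmx_norm_le.
move=> e e0; have e2 : 0 < e / 2 by rewrite divr_gt0.
have [d1 d10 h1] := hBB _ e2.
have [d2 d20 h2] := hB 1 ltr01.
pose L := n%:R * (`|B s| + 1) + 1.
have L0 : 0 < L by rewrite ltr_wpDl// mulr_ge0// addr_ge0.
have [d3 d30 h3] := hA _ (divr_gt0 e2 L0).
exists (Num.min d1 (Num.min d2 d3)) => [|u au ub]; first by rewrite !lt_min d10 d20.
rewrite !le_min => /and3P[u1 u2 u3].
have {h1} h1 := h1 u au ub u1; have {h2} h2 := h2 u au ub u2; have {h3} h3 := h3 u au ub u3.
have Bu : `|B u| <= `|B s| + 1.
  by have := ler_normD (B u - B s) (B s); rewrite subrK; lra.
have k : `|A u *m B u - A s *m B u| <= e / 2.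
  rewrite -mulmxBl; apply: le_trans (mulmx_norm_le _ _) _.
  rewrite mulrAC; apply: le_trans (ler_wpM2r (normr_ge0 _) (ler_wpM2l (ler0n R n) Bu)) _.
  have : `|A u - A s| * L <= e / 2 by rewrite -ler_pdivlMr.
  by rewrite /L; have := normr_ge0 (A u - A s); lra.
have := ler_normD (A u *m B u - A s *m B u) (A s *m B u - A s *m B s).
by rewrite subrKA; lra.
Qed.

Lemma riccati_rhs_contw (Q : 'M[R]_n) s : t0 <= s -> s <= T ->
  contw t0 T (fun t => riccati_rhs F xbar pbar t Q) s.
Proof.
move=> t0s sT.
have c1 := @hessian_contw (Hpx F) inl inr s (fun y p i j => @Hpx_entry _ _ F Hreg y p i j) t0s sT.
have c2 := @hessian_contw (Hxp F) inr inl s (fun y p i j => @Hxp_entry _ _ F Hreg y p i j) t0s sT.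
have c3 := @hessian_contw (Hpp F) inr inr s (fun y p i j => @Hpp_entry _ _ F Hreg y p i j) t0s sT.
have c4 := @hessian_contw (Hxx F) inl inl s (fun y p i j => @Hxx_entry _ _ F Hreg y p i j) t0s sT.
have cQ := contw_cst Q t0 T s.
have c5 := contw_add (contw_add (contw_add (contw_mulmx c1 cQ) (contw_mulmx cQ c2)) (contw_mulmx
  (contw_mulmx cQ c3) cQ)) c4.
apply: (@contw_lip _ _ _ _ _ _ _ _ 1) c5 => u v.
by rewrite mul1r /riccati_rhs -opprD normrN.
Qed.

(** Truncation of the matrix variable makes the quadratic field globally
   Lipschitz. *)
Lemma riccati_clipped (m : R) (R0 : 'M[R]_n) : 0 <= m -> exists Q : R -> 'M[R]_n,
  Q t0 = R0 /\ forall s, t0 <= s -> s <= T -> derivw t0 T Q s (riccati_rhs F xbar pbar s (clip m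
    (Q s))).
Proof.
move=> m0; have N0 : 0 <= n%:R :> R by [].
pose K := 2 * n%:R * C + 2 * n%:R ^+ 2 * C * m + 1.
have K0 : 0 < K.
  by rewrite ltr_wpDl// addr_ge0//; do ?apply: mulr_ge0 => //; rewrite ?(ltW C0)// exprn_ge0.
apply: (@ode_exists _ _ _ (fun s Q => riccati_rhs F xbar pbar s (clip m Q)) t0 T K R0 t0T K0).
- by move=> Q s t0s sT; exact: riccati_rhs_contw.
- move=> s Q Q' t0s sT.
  have [_ h1 h2 h3] := hess_le Hreg n0 r0 C0 (tb t0s sT).
  apply: le_trans (riccati_diff_le _ h2 h1 h3 (clip_le Q m0) (clip_le Q' m0)) _.
  apply: ler_pM => //; last exact: clip_lip.
    by rewrite addr_ge0//; do ?apply: mulr_ge0 => //; rewrite ?(ltW C0)// exprn_ge0.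
  by rewrite /K lerDl ler01.
Qed.

(** The solution truncated at [B + 1] is a true solution up to the first time
   its norm exceeds [B + 1]; until then its norm is at most [B], and by
   continuity that time is never reached. *)
Lemma riccati_global (R0 : 'M[R]_n) (B : R) : `|R0| <= B ->
  (forall u (Q : R -> 'M[R]_n), t0 <= u -> u <= T -> Q t0 = R0 ->
     (forall s, t0 <= s -> s <= u -> derivw t0 u Q s (riccati_rhs F xbar pbar s (Q s))) ->
     `|Q u| <= B) ->
  exists Q : R -> 'M[R]_n, Q t0 = R0 /\
    forall s, t0 <= s -> s <= T -> derivw t0 T Q s (riccati_rhs F xbar pbar s (Q s)).
Proof.
move=> R0B apriori.
have B0 : 0 <= B := le_trans (normr_ge0 _) R0B.
have B1 : 0 <= B + 1 by rewrite addr_ge0.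
have [Q [Q0 hQ]] := riccati_clipped R0 B1.
have step : (forall s, t0 <= s -> s <= t0 -> `|Q s| <= B + 1) ->
    (forall s, t0 <= s -> s <= T -> `|Q s| <= B + 1).
  apply: (@cousin _ (fun u v => (forall s, t0 <= s -> s <= u -> `|Q s| <= B + 1) ->
    (forall s, t0 <= s -> s <= v -> `|Q s| <= B + 1)) t0 T t0T).
  - by move=> u v w _ _ _ _ h1 h2 /h1 /h2.
  - move=> s t0s sT.
    have [d d0 hd] := derivw_contw (hQ s t0s sT) (divr_gt0 ltr01 (ltr0Sn _ 1)).
    exists d => // u v t0u us sv vT vu small t t0t tv.
    have [tu|ut] := leP t u; first exact: small.
    have uT : u <= T := le_trans us sT.
    have Qu : `|Q u| <= B.
      apply: apriori => // x t0x xu; have := hQ x t0x (le_trans xu uT).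
      by rewrite clip_id; [apply: derivw_sub|exact: small].
    have h1 := hd u t0u uT ltac:(rewrite ler_norml; lra).
    have h2 := hd t t0t (le_trans tv vT) ltac:(rewrite ler_norml; lra).
    have h3 := ler_normD (Q t - Q s) (Q s - Q u); rewrite subrKA in h3.
    have h4 := ler_normD (Q t - Q u) (Q u); rewrite subrK in h4.
    by rewrite distrC in h1; lra.
have bnd : forall s, t0 <= s -> s <= T -> `|Q s| <= B + 1.
  apply: step => s t0s st0; have -> : s = t0 by apply/eqP; rewrite eq_le t0s st0.
  by rewrite Q0; lra.
exists Q; split => // s t0s sT.
by have := hQ s t0s sT; rewrite clip_id//; exact: bnd.
Qed.

End Global.

(** * Propagation along the optimal arc *)

Theorem theorem3p8 (R : realType) (n : nat) (T : R)
  (F : 'rV[R]_n -> set 'rV[R]_n) (phi : 'rV[R]_n -> R)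
  (t0 : R) (x0 : 'rV[R]_n) (xbar pbar : R -> 'rV[R]_n) (R0 : 'M[R]_n) :
  SH F ->
  C21loc_on [set z : 'rV[R]_n * 'rV[R]_n | z.2 != 0]
    (fun z => hamiltonian F z.1 z.2) ->
  locally_lipschitz_on setT phi ->
  t0 <= T ->
  optimal T F phi t0 x0 xbar ->
  dual_arc T F phi t0 xbar pbar ->
  (forall s, t0 <= s <= T -> pbar s != 0) ->
  R0^T = R0 ->
  subjet (value T F phi t0) x0 (- pbar t0, - R0) ->
  (forall (a : R) (Ric : R -> 'M[R]_n),
     t0 < a -> a <= T ->
     riccati_solution F xbar pbar t0 a R0 Ric ->
     forall t, t0 <= t <= a ->
       subjet (value T F phi t) (xbar t) (- pbar t, - Ric t)) /\
  (locally_semiconcave phi ->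
   exists2 Ric : R -> 'M[R]_n,
     riccati_solution F xbar pbar t0 T R0 Ric &
     forall t, t0 <= t <= T ->
       subjet (value T F phi t) (xbar t) (- pbar t, - Ric t)).
Proof.
move=> HSH Hreg Hphi t0T ox [acp hae _] pne R0T hV0.
(* A nonvanishing costate exists in positive dimension only. *)
have n0 : (0 < n)%N.
  rewrite lt0n; apply: contra_neq (pne t0 ltac:(by rewrite lexx)) => n0.
  by move: (pbar t0); rewrite n0 => v; apply/rowP => -[].
have hx : {ae (@lebesgue_measure R), forall s, t0 <= s <= T ->
    derivable xbar s 1 /\ derive1 xbar s = gradp F (xbar s, pbar s)}.
  move: hae; apply: ae_sub => s hs st; have [dx _ sp _] := hs st; split => //.
  exact: (subdiff_p Hreg (pne s st) sp).
have hp : {ae (@lebesgue_measure R), forall s, t0 <= s <= T -> derivable pbar s 1 /\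
    forall i, (- derive1 pbar s) 0 i =
      partial1 (fun z : 'rV[R]_n * 'rV[R]_n => hamiltonian F z.1 z.2) (inl i) (xbar s, pbar s)}.
  move: hae; apply: ae_sub => s hs st; have [_ dp _ sx] := hs st; split => //.
  exact: (subdiff_x Hreg (pne s st) sx).
have acx : abs_continuous t0 T xbar by case: ox => -[[]].
have cp s : t0 <= s -> s <= T -> contw t0 T pbar s := absc_contw (abs_continuous_absc acp).
have czb := zb_contw acx cp.
have zb0 s : t0 <= s -> s <= T -> (xbar s, pbar s).2 != 0.
  by move=> t0s sT; apply: pne; rewrite t0s.
have [r [C [r0 C0 tb]]] := tube_uniform Hreg t0T czb zb0.
have prop := subjet_propagation n0 HSH Hreg Hphi t0T ox acp hx hp r0 C0 tb.
split=> [a Q t0a aT /riccati_solutionP[Q0 hQ] t /andP[t0t ta]|hsc].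
  exact: (prop a Q R0 (ltW t0a) aT R0T Q0 hQ hV0).
have [c c0 hc] := value_second_difference n0 HSH Hreg Hphi ox acp hx r0 C0 tb hsc.
have [B B0 hB] := riccati_bound n0 HSH Hreg r0 C0 tb `|R0| c0.
have [Q [Q0 hQ]] : exists Q : R -> 'M[R]_n, Q t0 = R0 /\
    forall s, t0 <= s -> s <= T -> derivw t0 T Q s (riccati_rhs F xbar pbar s (Q s)).
  apply: (riccati_global n0 Hreg t0T czb r0 C0 tb B0) => u Q t0u uT Q0 hQ.
  apply: hB => //; last by rewrite Q0.
    by apply: (riccati_symmetric n0 Hreg r0 C0 tb t0u uT) => //; rewrite Q0.
  move=> s t0s su; have sT := le_trans su uT.
  have [rho rho0 hrho] := hc s t0s sT.
  exact: (subjet_lower_bound rho0 hrho (prop u Q R0 t0u uT R0T Q0 hQ hV0 s t0s su)).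
exists Q; first by apply/riccati_solutionP.
move=> t /andP[t0t tT].
exact: (prop T Q R0 t0T (lexx T) R0T Q0 hQ hV0).
Qed.
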